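(* Let $c>1$, $r>0$, and consider the $(c,r)$-ANN problem in the $d$-dimensional Hamming hypercube $\{0,1\}^d$ with a dataset $S$ of $n$ points. There exists an adversarially robust algorithm solving this problem that answers all possible queries $q\in\{0,1\}^d$ correctly with probability at least $1-1/n^2$. Its space requirement is $\widetilde{O}(d\cdot n^{1+\rho+o(1)})$ and its time per query is $\widetilde{O}(d\cdot n^{\rho})$, where $\rho=1/c$.
   Context: Distances in $\{0,1\}^d$ are Hamming distances. $B_S(q,r):=\{p\in S:\|p-q\|\le r\}$. The $(c,r)$-ANN problem: for each query $q$, if $B_S(q,r)\neq\emptyset$ output a point of $B_S(q,cr)$; if $B_S(q,cr)=\emptyset$ output $\perp$; otherwise either is acceptable. $\widetilde{O}$ hides polylogarithmic factors. *)

(* Defs.v *)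
From HB Require Import structures.
From mathcomp Require Export all_boot all_order all_algebra.
From mathcomp Require Export boolp classical_sets reals topology normedtype.
From mathcomp Require Export sequences exp.

Set Implicit Arguments.
Unset Strict Implicit.
Unset Printing Implicit Defensive.

Import Order.TTheory GRing.Theory Num.Theory.
Export numFieldNormedType.Exports.

Local Open Scope ring_scope.

(** * The word RAM *)

(* A unit-cost word RAM with structured control flow.  A machine has words of
   [w] bits, [M] memory cells, a read-only input array and a tape of random
   words.  Registers are named by numbers; a given program mentions finitely
   many of them, so they contribute O(1) to the space. *)

Inductive binop := OAdd | OSub | OMul | ODiv | OMod | OLt | OEq.

Inductive cmd :=
  | CSkip
  | CConst of nat & nat          (* x := k *)
  | COp of binop & nat & nat & nat (* x := y o z *)
  | CLoad of nat & nat           (* x := mem[y] *)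
  | CStore of nat & nat          (* mem[x] := y *)
  | CInput of nat & nat          (* x := input[y] *)
  | CRand of nat                 (* x := next random word *)
  | CSeq of cmd & cmd
  | CIf of nat & cmd & cmd       (* if x <> 0 then _ else _ *)
  | CWhile of nat & cmd.         (* while x <> 0 do _ *)

(* Subtraction is truncated at 0, and m %/ 0 = 0, m %% 0 = m. *)
Definition binop_eval (w : nat) (o : binop) (a b : nat) : nat :=
  (match o with
   | OAdd => a + b | OSub => a - b | OMul => a * b
   | ODiv => a %/ b | OMod => a %% b
   | OLt => nat_of_bool (a < b) | OEq => nat_of_bool (a == b)
   end %% 2 ^ w)%N.

Record state := State { regs : nat -> nat; mem : nat -> nat; tape : seq nat }.

Definition upd (f : nat -> nat) (x v : nat) : nat -> nat :=
  fun y => if y == x then v else f y.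

Definition set_reg (s : state) (x v : nat) : state :=
  State (upd (regs s) x v) (mem s) (tape s).

Definition set_mem (s : state) (a v : nat) : state :=
  State (regs s) (upd (mem s) a v) (tape s).

(* [exec w M inp p s t s'] : started in [s], program [p] halts in [s'] after
   exactly [t] steps.  There is no rule for an access outside the [M] memory
   cells or outside the input, nor for reading an exhausted tape: a program
   attempting one of these does not halt. *)
Inductive exec (w M : nat) (inp : seq nat) :
    cmd -> state -> nat -> state -> Prop :=
  | exec_skip s : exec w M inp CSkip s 1 s
  | exec_const s x k : exec w M inp (CConst x k) s 1 (set_reg s x (k %% 2 ^ w)%N)
  | exec_op s o x y z :
      exec w M inp (COp o x y z) s 1
        (set_reg s x (binop_eval w o (regs s y) (regs s z)))
  | exec_load s x y : (regs s y < M)%N ->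
      exec w M inp (CLoad x y) s 1 (set_reg s x (mem s (regs s y)))
  | exec_store s x y : (regs s x < M)%N ->
      exec w M inp (CStore x y) s 1 (set_mem s (regs s x) (regs s y))
  | exec_input s x y : (regs s y < size inp)%N ->
      exec w M inp (CInput x y) s 1 (set_reg s x (nth 0%N inp (regs s y)))
  | exec_rand s x v tp : tape s = v :: tp ->
      exec w M inp (CRand x) s 1 (State (upd (regs s) x v) (mem s) tp)
  | exec_seq s s1 s2 p1 p2 t1 t2 :
      exec w M inp p1 s t1 s1 -> exec w M inp p2 s1 t2 s2 ->
      exec w M inp (CSeq p1 p2) s (t1 + t2)%N s2
  | exec_if_true s s1 x p1 p2 t : regs s x != 0%N ->
      exec w M inp p1 s t s1 -> exec w M inp (CIf x p1 p2) s t.+1 s1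
  | exec_if_false s s1 x p1 p2 t : regs s x = 0%N ->
      exec w M inp p2 s t s1 -> exec w M inp (CIf x p1 p2) s t.+1 s1
  | exec_while_end s x p : regs s x = 0%N -> exec w M inp (CWhile x p) s 1 s
  | exec_while_step s s1 s2 x p t1 t2 : regs s x != 0%N ->
      exec w M inp p s t1 s1 -> exec w M inp (CWhile x p) s1 t2 s2 ->
      exec w M inp (CWhile x p) s (t1 + t2).+1 s2.

(** * The approximate near neighbor problem *)

Definition hcube (d : nat) : finType := (d.-tuple bool : finType).

Definition hamming (d : nat) (p q : hcube d) : nat :=
  #|[pred i : 'I_d | tnth p i != tnth q i]|.

Definition hball (R : realType) (n d : nat) (S : n.-tuple (hcube d))
    (q : hcube d) (r : R) : {set hcube d} :=
  [set p in S | (hamming p q)%:R <= r]%SET.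

(* [None] is the answer ⊥. *)
Definition ann_correct (R : realType) (c r : R) (n d : nat)
    (S : n.-tuple (hcube d)) (q : hcube d) (a : option (hcube d)) : Prop :=
  [/\ hball S q r <> finset.set0 ->
        exists2 p, p \in hball S q (c * r) & a = Some p,
      hball S q (c * r) = finset.set0 -> a = None
    & hball S q r = finset.set0 -> hball S q (c * r) <> finset.set0 ->
        a = None \/ exists2 p, p \in hball S q (c * r) & a = Some p].

(** * Algorithms for the problem *)

(* A preprocessing program, a query program, and the constant factor of the
   word size; none of these depends on n, d, r or the dataset. *)
Record ann_algo := AnnAlgo { prep : cmd; query : cmd; wfactor : nat }.

(* Θ(log(nd)) bits *)
Definition wsize (A : ann_algo) (n d : nat) : nat :=
  ((wfactor A).+1 * up_log 2 (n * d).+2)%N.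

(* Registers 0 to 3 initially hold n, d, ⌊r⌋ and ⌊cr⌋, the last two capped at d
   so as to fit in a word.  As distances are integers in [0, d], this loses no
   information on the balls of radius r and cr. *)
Definition init_regs (R : realType) (c r : R) (n d : nat) : nat -> nat :=
  nth 0%N [:: n; d; minn d (Num.truncn r); minn d (Num.truncn (c * r))].

Definition encode_point (d : nat) (q : hcube d) : seq nat :=
  [seq nat_of_bool b | b <- q].

Definition encode_data (n d : nat) (S : n.-tuple (hcube d)) : seq nat :=
  flatten [seq encode_point p | p <- S].

(* The random words available to the preprocessing. *)
Definition coins (A : ann_algo) (n d m : nat) : finType :=
  (m.-tuple 'I_(2 ^ wsize A n d) : finType).

(* With coins [om], preprocessing the dataset [S] in [M] cells of zeroed memory
   leaves the memory [mu]. *)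
Definition prepares (R : realType) (c r : R) (A : ann_algo) (n d M m : nat)
    (S : n.-tuple (hcube d)) (om : coins A n d m) (mu : nat -> nat) : Prop :=
  exists t s,
    exec (wsize A n d) M (encode_data S) (prep A)
      (State (init_regs c r n d) (fun=> 0%N) [seq val v | v <- om]) t s
    /\ mem s = mu.

(* The output is read in register 0: i + 1 stands for the i-th point of [S],
   and any other value for ⊥. *)
Definition decode (n d : nat) (S : n.-tuple (hcube d)) (v : nat) :
    option (hcube d) :=
  if v is i.+1 then onth S i else None.

(* With coins [om], the query [q] is answered by [a] in time [t].  The query
   program has no coins and no access to the dataset other than through the
   memory left by the preprocessing.  It may use the memory as workspace, but
   has to restore it, so that the answer does not depend on earlier queries. *)
Definition answers (R : realType) (c r : R) (A : ann_algo) (n d M m : nat)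
    (S : n.-tuple (hcube d)) (om : coins A n d m) (q : hcube d)
    (t : nat) (a : option (hcube d)) : Prop :=
  exists mu s,
    [/\ prepares c r M S om mu,
        exec (wsize A n d) M (encode_point q) (query A)
          (State (init_regs c r n d) mu [::]) t s,
        mem s = mu & decode S (regs s 0%N) = a].

Definition answers_all (R : realType) (c r : R) (A : ann_algo) (n d M m : nat)
    (S : n.-tuple (hcube d)) (om : coins A n d m) : Prop :=
  forall q : hcube d, exists t a,
    answers c r M S om q t a /\ ann_correct c r S q a.

(* An adaptive adversary picks the next query from the previous queries and
   their answers (most recent first). *)
Definition adversary (d : nat) : Type :=
  seq (hcube d * option (hcube d)) -> hcube d.

Fixpoint transcript (R : realType) (c r : R) (A : ann_algo) (n d M m : nat)
    (S : n.-tuple (hcube d)) (om : coins A n d m) (adv : adversary d)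
    (h : seq (hcube d * option (hcube d))) : Prop :=
  if h is (q, a) :: h' then
    [/\ transcript c r M S om adv h', q = adv h'
      & exists t, answers c r M S om q t a]
  else True.

Definition withstands (R : realType) (c r : R) (A : ann_algo) (n d M m : nat)
    (S : n.-tuple (hcube d)) (om : coins A n d m) (adv : adversary d) : Prop :=
  forall h, transcript c r M S om adv h ->
    forall q a, (q, a) \in h -> ann_correct c r S q a.

Definition uniform_prob (R : realType) (T : finType) (E : T -> Prop) : R :=
  #|[pred x | `[< E x >]]|%:R / #|T|%:R.

(* Õ(f): up to the factor C * log(nd + 2)^e *)
Definition softO (R : realType) (C e n d : nat) (f : R) : R :=
  C%:R * f * ln (n * d).+2%:R ^+ e.

(* Main.v *)
(** The preprocessing is deterministic, and the query program merely interprets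
    a graph that the preprocessing has left in memory: each node reads a bit of
    the query, compares the clock or a counter with a constant, or increments
    the counter.  For X = 1, 2, ... the preprocessing enumerates all graphs
    with n * X nodes and tests, on each of the 2^d queries, whether X steps lead
    to a correct answer; it keeps the first graph that passes.  Its running time
    is irrelevant, every query is answered correctly, and the program never has
    to compute n^(1/c).  What remains is the existence of a correct graph with
    X = Õ(d n^(1/c)).

    Let b = floor(c r) + 1.  Only the at most n (d+1)^floor(r) = 2^Õ(b) queries
    that have a near neighbor need an answer.  A group of O(n^(1/c)) bit-sampling
    hash tables, cut off by the clock, in which candidates are tested on
    Õ(d/b) sampled coordinates, is right on 3/4 of any given set of queries for
    some choice of the samples.  Two procedures that fail on a fraction f, the
    second one being chosen for the failures of the first, are combined by
    testing their proposals on a sample twice as large: the result fails on a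
    fraction f^2 plus an error of the same order, at twice the cost.  After
    log Õ(b) rounds, that is at total cost Õ(b) * (d/b) n^(1/c), no failure is
    left.  The thresholds of the tests increase slowly from round to round, all
    within a factor 1 - 1/log n of c r, which costs only a constant factor in
    n^(1/c).  A final exact test makes the answers sound for all queries. *)

From HB Require Import structures.
Require Import Defs.
From mathcomp Require Import zify ring lra.

Set Implicit Arguments.
Unset Strict Implicit.
Unset Printing Implicit Defensive.

Import Order.TTheory GRing.Theory Num.Theory.

(** The obstacle is the product of two costs. A union bound over 2^Õ(b) queries asks for Õ(b) groups
    of tables, and tests accurate enough for that union bound read about d coordinates each.
    Squaring avoids the product: the error of a test only has to match the fraction of queries still
    failing, and a test of twice the size is used half as often, so every round costs the same. A
    sampled test distinguishes two thresholds only across a gap, and whatever one round accepts must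
    pass the test of the next; this forces the increasing thresholds.

    Strategies are built in continuation-passing style: a procedure receives what is to follow each
    of its proposals. Continuations are thereby shared, each node is counted once, and [n * X] nodes
    suffice. The clock bounds the time on every query, including those on which a procedure fails,
    so that the next procedure has a known latest start.

    Robustness requires no analysis of the adversary: runs are deterministic and each query has a
    correct answer for each choice of coins, so transcripts can only contain correct answers. *)

(** * Total correctness and determinism of the word RAM *)

Definition wp (w M : nat) (inp : seq nat) (p : cmd) (s : state)
    (Q : nat -> state -> Prop) : Prop :=
  exists t s', exec w M inp p s t s' /\ Q t s'.

Definition frame (L : seq nat) (f f' : nat -> nat) : Prop :=
  forall x, x \notin L -> f' x = f x.

Lemma frame_trans L f f' f'' : frame L f f' -> frame L f' f'' -> frame L f f''.
Proof. by move=> h1 h2 x hx; rewrite h2 // h1. Qed.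

Lemma frame_sub L L' f f' : {subset L <= L'} -> frame L f f' -> frame L' f f'.
Proof. by move=> s h x hx; apply: h; apply: contraNN hx; apply: s. Qed.

Lemma frame_upd L f f' x v : frame L f f' -> x \in L -> frame L f (upd f' x v).
Proof.
by move=> h xL y yL; rewrite /upd; case: eqP => [e|_]; [rewrite e xL in yL | apply: h].
Qed.

Lemma frame_refl L f : frame L f f.
Proof. by []. Qed.

Section Wp.
Variables (w M : nat) (inp : seq nat).
Local Notation wp := (wp w M inp).
Implicit Types (f m : nat -> nat) (tp : seq nat) (Q : nat -> state -> Prop).

Lemma wp_conseq p s Q Q' :
  wp p s Q -> (forall t s', Q t s' -> Q' t s') -> wp p s Q'.
Proof. by move=> [t [s' [e q]]] h; exists t, s'; split => //; apply: h. Qed.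

Lemma wp_skip s Q : Q 1 s -> wp CSkip s Q.
Proof. by move=> q; exists 1, s; split => //; constructor. Qed.

Lemma wp_const f m tp x k Q : k < 2 ^ w ->
  Q 1 (State (upd f x k) m tp) -> wp (CConst x k) (State f m tp) Q.
Proof.
move=> kw q; exists 1, (State (upd f x k) m tp); split => //.
by rewrite -[in X in exec _ _ _ _ _ _ X](modn_small kw); constructor.
Qed.

Lemma wp_op f m tp o x y z v Q : binop_eval w o (f y) (f z) = v ->
  Q 1 (State (upd f x v) m tp) -> wp (COp o x y z) (State f m tp) Q.
Proof.
by move=> <- q; eexists 1, _; split; last exact: q; exact: exec_op.
Qed.

Lemma wp_load f m tp x y Q : f y < M ->
  Q 1 (State (upd f x (m (f y))) m tp) -> wp (CLoad x y) (State f m tp) Q.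
Proof. by move=> h q; eexists 1, _; split; last exact: q; exact: exec_load. Qed.

Lemma wp_store f m tp x y Q : f x < M ->
  Q 1 (State f (upd m (f x) (f y)) tp) -> wp (CStore x y) (State f m tp) Q.
Proof. by move=> h q; eexists 1, _; split; last exact: q; exact: exec_store. Qed.

Lemma wp_input f m tp x y Q : f y < size inp ->
  Q 1 (State (upd f x (nth 0 inp (f y))) m tp) ->
  wp (CInput x y) (State f m tp) Q.
Proof. by move=> h q; eexists 1, _; split; last exact: q; exact: exec_input. Qed.

Lemma wp_seq p1 p2 s Q :
  wp p1 s (fun t1 s1 => wp p2 s1 (fun t2 s2 => Q (t1 + t2) s2)) ->
  wp (CSeq p1 p2) s Q.
Proof.
move=> [t1 [s1 [e1 [t2 [s2 [e2 q]]]]]].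
by exists (t1 + t2), s2; split => //; apply: exec_seq e1 e2.
Qed.

Lemma wp_if f m tp x p1 p2 Q :
  (f x != 0 -> wp p1 (State f m tp) (fun t => Q t.+1)) ->
  (f x = 0 -> wp p2 (State f m tp) (fun t => Q t.+1)) ->
  wp (CIf x p1 p2) (State f m tp) Q.
Proof.
move=> h1 h2; case: (eqVneq (f x) 0) => e.
  have [t [s' [e' q]]] := h2 e.
  by exists t.+1, s'; split => //; apply: exec_if_false.
have [t [s' [e' q]]] := h1 e.
by exists t.+1, s'; split => //; apply: exec_if_true.
Qed.

Lemma wp_while_end f m tp x p Q : f x = 0 ->
  Q 1 (State f m tp) -> wp (CWhile x p) (State f m tp) Q.
Proof. by move=> h q; eexists 1, _; split; last exact: q; exact: exec_while_end. Qed.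

Lemma wp_while_step f m tp x p Q : f x != 0 ->
  wp p (State f m tp)
    (fun t1 s1 => wp (CWhile x p) s1 (fun t2 s2 => Q (t1 + t2).+1 s2)) ->
  wp (CWhile x p) (State f m tp) Q.
Proof.
move=> h [t1 [s1 [e1 [t2 [s2 [e2 q]]]]]].
by exists (t1 + t2).+1, s2; split => //; apply: exec_while_step e1 e2.
Qed.

Lemma binop_add a b : a + b < 2 ^ w -> binop_eval w OAdd a b = a + b.
Proof. exact: modn_small. Qed.

Lemma binop_mul a b : a * b < 2 ^ w -> binop_eval w OMul a b = a * b.
Proof. exact: modn_small. Qed.

Lemma binop_mod a b : a < 2 ^ w -> binop_eval w OMod a b = a %% b.
Proof. by move=> h; apply: modn_small; apply: leq_ltn_trans h; apply: leq_mod. Qed.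

Lemma binop_lt a b : 1 < 2 ^ w -> binop_eval w OLt a b = (a < b).
Proof. by move=> h; apply: modn_small; case: (a < b) => //; apply: ltnW. Qed.

Lemma binop_eq a b : 1 < 2 ^ w -> binop_eval w OEq a b = (a == b).
Proof. by move=> h; apply: modn_small; case: (a == b) => //; apply: ltnW. Qed.

End Wp.

Arguments wp_const {w M inp f m tp x k Q}.
Arguments wp_op {w M inp f m tp o x y z v Q}.

(** Determinism makes the existential [wp] a statement about the only run, and later turns the
    existence of a correct answer into the correctness of every answer in a transcript. *)
Lemma exec_det w M inp p s t s' : exec w M inp p s t s' ->
  forall t2 s2, exec w M inp p s t2 s2 -> t = t2 /\ s' = s2.
Proof.
elim=> {p s t s'}.
- by move=> s t2 s2 h; inversion h.
- by move=> s x k t2 s2 h; inversion h.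
- by move=> s o x y z t2 s2 h; inversion h.
- by move=> s x y _ t2 s2 h; inversion h.
- by move=> s x y _ t2 s2 h; inversion h.
- by move=> s x y _ t2 s2 h; inversion h.
- move=> s x v tp e t2 s2 h; inversion h; subst.
  by match goal with H : tape _ = _ :: _ |- _ => move: H; rewrite e => -[-> ->] end.
- move=> s s1 s2 p1 p2 t1 t2 _ ih1 _ ih2 t3 s3 h; inversion h; subst.
  match goal with H : exec _ _ _ p1 _ _ _ |- _ => have [-> e] := ih1 _ _ H end.
  subst; match goal with H : exec _ _ _ p2 _ _ _ |- _ => by have [-> ->] := ih2 _ _ H end.
- move=> s s1 x p1 p2 t hx _ ih t3 s3 h; inversion h; subst.
    match goal with H : exec _ _ _ p1 _ _ _ |- _ => by have [-> ->] := ih _ _ H end.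
  by match goal with H : regs s x = 0 |- _ => rewrite H in hx end.
- move=> s s1 x p1 p2 t hx _ ih t3 s3 h; inversion h; subst.
    by match goal with H : is_true (regs s x != 0) |- _ => rewrite hx in H end.
  match goal with H : exec _ _ _ p2 _ _ _ |- _ => by have [-> ->] := ih _ _ H end.
- move=> s x p hx t3 s3 h; inversion h; subst => //.
  by match goal with H : is_true (regs _ x != 0) |- _ => rewrite hx in H end.
- move=> s s1 s2 x p t1 t2 hx _ ih1 _ ih2 t3 s3 h; inversion h; subst.
    by match goal with H : regs _ x = 0 |- _ => rewrite H in hx end.
  match goal with H : exec _ _ _ p s _ _ |- _ => have [-> e] := ih1 _ _ H end.
  subst; match goal with H : exec _ _ _ (CWhile x p) _ _ _ |- _ => by have [-> ->] := ih2 _ _ H end.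
Qed.

(** * Odometers *)

(** Used twice: base 2 runs through the 2^d queries, base [n * X] through the graphs with [n * X]
    nodes. [digits_val] is the rank by which both enumerations terminate. *)
Fixpoint inc (B : nat) (l : seq nat) : seq nat * bool :=
  if l is v :: l' then
    if v.+1 == B then (0 :: (inc B l').1, (inc B l').2) else (v.+1 :: l', false)
  else ([::], true).

Fixpoint digits_val (B : nat) (l : seq nat) : nat :=
  if l is v :: l' then v + B * digits_val B l' else 0.

Lemma size_inc B l : size (inc B l).1 = size l.
Proof. by elim: l => //= v l ih; case: ifP => //= _; rewrite ih. Qed.

Lemma inc_digits B l : 0 < B ->
  all (fun v => v < B) l -> all (fun v => v < B) (inc B l).1.
Proof.
move=> B0; elim: l => //= v l ih /andP[hv hl]; case: eqP => /= e; first by rewrite B0 ih.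
by rewrite hl andbT; lia.
Qed.

Lemma inc_carryN B l : ~~ (inc B l).2 ->
  digits_val B (inc B l).1 = (digits_val B l).+1.
Proof.
elim: l => //= v l ih; case: eqP => /= e h; last by rewrite addSn.
by rewrite ih // mulnS -addSn e.
Qed.

Lemma inc_carry B l : (inc B l).2 ->
  (inc B l).1 = nseq (size l) 0 /\ (digits_val B l).+1 = B ^ size l.
Proof.
elim: l => //= v l ih; case: eqP => //= e h; have [-> e2] := ih h.
by rewrite expnS -e2; split=> //; rewrite -addSn e mulnS.
Qed.

Lemma digits_val_lt B l : 0 < B -> all (fun v => v < B) l ->
  digits_val B l < B ^ size l.
Proof.
move=> B0; elim: l => //= v l ih /andP[hv /ih h]; rewrite expnS.
apply: (@leq_trans (B + B * digits_val B l)); first by rewrite -addSn leq_add2r.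
by rewrite -mulnS leq_mul2l h orbT.
Qed.

Lemma digits_val_inj B l l' : size l = size l' ->
  all (fun v => v < B) l -> all (fun v => v < B) l' ->
  digits_val B l = digits_val B l' -> l = l'.
Proof.
elim: l l' => [|v l ih] [|v' l'] //= [e] /andP[hv hl] /andP[hv' hl'] E.
have B0 : 0 < B by apply: leq_ltn_trans hv.
have ev : v = v'.
  by move: (congr1 (modn^~ B) E); rewrite ![_ + B * _]addnC ![B * _]mulnC !modnMDl !modn_small.
rewrite ev; congr cons; apply: ih => //; move: E; rewrite ev => /eqP.
by rewrite eqn_add2l eqn_pmul2l // => /eqP.
Qed.

Lemma digits_val_nseq0 B N : digits_val B (nseq N 0) = 0.
Proof. by elim: N => //= N ->; rewrite muln0. Qed.

Definition cells (m : nat -> nat) (s N : nat) : seq nat := mkseq (fun i => m (s + i)) N.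

Definition mset (m : nat -> nat) (s : nat) (l : seq nat) : nat -> nat :=
  fun y => if s <= y < s + size l then nth 0 l (y - s) else m y.

Lemma cellsS m s N : cells m s N.+1 = m s :: cells m s.+1 N.
Proof.
rewrite /cells /mkseq /= addn0; congr cons.
by rewrite -[1]addn0 iotaDl -map_comp; apply: eq_map => i /=; rewrite addnA addn1.
Qed.

Lemma mset_cons m s v l : mset m s (v :: l) = mset (upd m s v) s.+1 l.
Proof.
apply: funext => y; rewrite /mset /upd /=.
case: (ltngtP s y) => [h|h|->] /=.
- rewrite addSnnS; case: ifP => // _; rewrite subnS.
  by move: h; rewrite -subn_gt0; case: (y - s).
- by [].
- by rewrite ifT ?subnn //; lia.
Qed.

Lemma mset_nil m s : mset m s [::] = m.
Proof. by apply: funext => y; rewrite /mset /= addn0; case: ltngtP. Qed.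

Lemma cells_upd m s v N : cells (upd m s v) s.+1 N = cells m s.+1 N.
Proof. by apply: eq_map => i; rewrite /upd ifF //; apply/negbTE; lia. Qed.

Local Arguments upd f x v y /.

Lemma mset_cells m s N : mset m s (cells m s N) = m.
Proof.
apply: funext => y; rewrite /mset size_map size_iota; case: ifP => // h.
by rewrite nth_mkseq; [congr m|]; lia.
Qed.

Definition cseq : seq cmd -> cmd := foldr CSeq CSkip.

(* The digits are mem[r33], ..., mem[r33 + r34 - 1], least significant first,
   the base is r35; r41 is the final carry. *)
Definition inc_body : cmd :=
  cseq [:: COp OAdd 38 33 36; CLoad 39 38; COp OAdd 39 39 5; COp OEq 40 39 35;
    CIf 40 (cseq [:: CStore 38 9; COp OAdd 36 36 5; COp OLt 37 36 34])
           (cseq [:: CStore 38 39; CConst 37 0; CConst 41 0])].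

Definition inc_cmd : cmd :=
  cseq [:: CConst 36 0; CConst 37 1; CConst 41 1; CWhile 37 inc_body].

Definition inc_temps := [:: 36; 37; 38; 39; 40; 41].

Ltac op_step lem :=
  apply: wp_seq; apply: wp_op; [rewrite /=; apply: lem | rewrite /=].

Ltac frame_tac :=
  repeat (first [assumption | exact: frame_refl | apply: frame_upd; last by []]).

(** Invariant: a carry is pending at digit [i]. Register 41 starts at 1 and is cleared only where
    the carry is absorbed, so running off the last digit leaves the final carry there. *)
Lemma inc_loop w M inp f m tp B s N i : N + s <= M -> M < 2 ^ w -> i < N ->
  B < 2 ^ w -> 1 < 2 ^ w -> all (fun v => v < B) (cells m s N) ->
  f 33 = s -> f 34 = N -> f 35 = B -> f 5 = 1 -> f 9 = 0 -> f 36 = i ->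
  f 37 = 1 -> f 41 = 1 ->
  wp w M inp (CWhile 37 inc_body) (State f m tp) (fun _ s' => exists f',
    [/\ s' = State f' (mset m (s + i) (inc B (cells m (s + i) (N - i))).1) tp,
       frame inc_temps f f'
     & f' 41 = (inc B (cells m (s + i) (N - i))).2 :> nat]).
Proof.
move=> NM Mw iN Bw w1; elim: {i}(N - i) {-2}i (erefl (N - i)) iN f m.
  by move=> i; lia.
move=> k ih i ek iN f m dig f33 f34 f35 f5 f9 f36 f37 f41.
have mdig : m (s + i) < B.
  by move/allP: dig => /(_ (m (s + i)) (map_f _ _)); rewrite mem_iota; apply.
apply: wp_while_step; first by rewrite f37.
op_step binop_add; first by rewrite f33 f36; lia.
apply: wp_seq; apply: wp_load => /=; first by rewrite f33 f36; lia.
rewrite f33 f36.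
op_step binop_add; first by rewrite f5; lia.
op_step binop_eq; first by [].
rewrite f5 f35 addn1.
apply: wp_seq; apply: wp_if => /=.
  rewrite eqb0 negbK => e.
  apply: wp_seq; apply: wp_store => /=; first by lia.
  rewrite f9.
  op_step binop_add; first by rewrite f36 f5; lia.
  op_step binop_lt; first by [].
  apply: wp_skip; apply: wp_skip.
  rewrite f36 f5 f34 addn1 ek cellsS /= e.
  case: (ltnP i.+1 N) => iN'.
    apply: wp_conseq; first apply: (ih i.+1) => //=; first by lia.
    - apply/allP => v /mapP[j]; rewrite mem_iota => hj ->; rewrite /upd.
      case: eqP => _; first by apply: leq_ltn_trans mdig.
      by move/allP: dig; apply; apply: map_f; rewrite mem_iota.
    move=> t s' [f' [-> fr e']]; exists f'.
    have ek' : N - i.+1 = k by lia.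
    rewrite ek' !addnS cells_upd in e' *.
    split=> //; first by rewrite mset_cons.
    by apply: frame_trans fr; frame_tac.
  have -> : k = 0 by lia.
  apply: wp_while_end => //=.
  eexists; split; first by rewrite mset_cons mset_nil.
    by frame_tac.
  by rewrite /= f41.
move=> /eqP; rewrite eqb0 => /negbTE e.
apply: wp_seq; apply: wp_store => /=; first by lia.
do 2 (apply: wp_seq; apply: wp_const; first by lia).
apply: wp_skip; apply: wp_skip; apply: wp_while_end => //=.
rewrite ek cellsS /= e /=.
eexists; split; first by rewrite mset_cons -(cells_upd _ _ (m (s + i)).+1) mset_cells.
  by frame_tac.
by rewrite /=.
Qed.

Lemma inc_spec w M inp f m tp B s N : N + s <= M -> M < 2 ^ w -> 0 < N ->
  B < 2 ^ w -> 1 < 2 ^ w -> all (fun v => v < B) (cells m s N) ->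
  f 33 = s -> f 34 = N -> f 35 = B -> f 5 = 1 -> f 9 = 0 ->
  wp w M inp inc_cmd (State f m tp) (fun _ s' => exists f',
    [/\ s' = State f' (mset m s (inc B (cells m s N)).1) tp,
       frame inc_temps f f' & f' 41 = (inc B (cells m s N)).2 :> nat]).
Proof.
move=> NM Mw N0 Bw w1 dig f33 f34 f35 f5 f9.
do 3 (apply: wp_seq; apply: wp_const; first by lia).
apply: wp_seq; apply: wp_conseq; first exact: (@inc_loop _ _ _ _ _ _ B s N 0).
rewrite addn0 subn0 => t s' [f' [-> fr e]]; apply: wp_skip; exists f'; split => //.
by apply: frame_trans fr; frame_tac.
Qed.

(** * The interpreter *)

(** A node is four cells: kind, argument, successor if the condition fails, successor if it holds;
    the state consists of node, clock and counter. Reading modulo [d] keeps every enumerated graph,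
    however meaningless, inside the query. *)
Definition node_step (g q : nat -> nat) (d : nat) (s : nat * nat * nat) :
    nat * nat * nat :=
  let: (pc, t, c) := s in
  let k := g (pc * 4) in
  let a := g (pc * 4 + 1) in
  let cond := if k == 1 then q (a %% d) != 0 else if k == 2 then t < a
              else if k == 3 then c < a else false in
  (if cond then g (pc * 4 + 3) else g (pc * 4 + 2), t.+1,
   if k == 3 then 0 else if k == 4 then c.+1 else c).

(** There is no halting test: exactly [X] steps are made. A [Halt] node will be encoded as its own
    successor, so that its argument remains the output. *)
Definition graph_output (g q : nat -> nat) (d X : nat) : nat :=
  g ((iter X (node_step g q d) (0, 0, 0)).1.1 * 4 + 1).

(** Register map: 0 to 3 hold n, d and the two capped radii, 4 holds X, 5 and 6 the constants 1 and
    4, 8 the address of the graph; 9 is never written and stays 0. Registers 10 to 12 are node,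
    clock and counter, 15 to 18 the cells of the current node, 19 its condition. The parameter [rd]
    exists because the preprocessing reads the tested query from memory and the query program reads
    its input. *)
Definition decide_cmd (rd : cmd) : cmd :=
  cseq [:: CConst 19 0; COp OEq 20 15 5;
   CIf 20 (cseq [:: COp OMod 19 16 1; rd])
  (cseq [:: CConst 20 2; COp OEq 20 15 20;
   CIf 20 (COp OLt 19 11 16)
  (cseq [:: CConst 20 3; COp OEq 20 15 20;
   CIf 20 (cseq [:: COp OLt 19 12 16; CConst 12 0])
  (cseq [:: COp OEq 20 15 6;
   CIf 20 (COp OAdd 12 12 5) CSkip])])])].

(* [rd] replaces the index in r19 by the corresponding bit of the query. *)
Definition reads (w M : nat) (inp : seq nat) (m : nat -> nat) (d : nat) (rd : cmd)
    (q : nat -> nat) : Prop :=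
  forall f tp, f 19 < d -> f 5 = 1 ->
  wp w M inp rd (State f m tp) (fun t s' => t <= 2 /\ exists f',
    [/\ s' = State f' m tp, f' 19 = q (f 19) & frame [:: 19] f f']).

Lemma decide_spec w M inp m d rd q f tp k a t c : 4 < 2 ^ w -> 0 < d ->
  reads w M inp m d rd q -> a < 2 ^ w -> c.+1 < 2 ^ w ->
  f 1 = d -> f 5 = 1 -> f 6 = 4 -> f 11 = t -> f 12 = c -> f 15 = k -> f 16 = a ->
  wp w M inp (decide_cmd rd) (State f m tp) (fun t' s' => t' <= 18 /\ exists f',
    [/\ s' = State f' m tp,
       (f' 19 != 0) = (if k == 1 then q (a %% d) != 0 else if k == 2 then t < a
              else if k == 3 then c < a else false),
       f' 12 = (if k == 3 then 0 else if k == 4 then c.+1 else c)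
       & frame [:: 12; 19; 20] f f']).
Proof.
move=> w4 d0 hrd aw cw f1 f5 f6 f11 f12 f15 f16; have w1 : 1 < 2 ^ w by lia.
apply: wp_seq; apply: wp_const; first by lia.
op_step binop_eq; first by [].
apply: wp_seq; apply: wp_if => /=; rewrite f15 f5.
  rewrite eqb0 negbK => /eqP ->.
  op_step binop_mod; first by rewrite f16.
  rewrite f16 f1; apply: wp_seq; apply: wp_conseq.
    by apply: hrd; rewrite /= ?ltn_mod.
  move=> t' s' [ht [f' [-> e fr]]]; do 2 apply: wp_skip; split; first by lia.
  exists f'; split => //=; rewrite ?e ?(fr 12) //= ?f12 //.
  apply: (@frame_trans _ _ _ _ _ (frame_sub _ fr)); first by frame_tac.
  by move=> x; rewrite !inE => /eqP->.
move=> /eqP; rewrite eqb0 => /negbTE ->.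
apply: wp_seq; apply: wp_const; first by lia.
op_step binop_eq; first by [].
apply: wp_seq; apply: wp_if => /=; rewrite f15.
  rewrite eqb0 negbK => /eqP -> /=.
  apply: wp_op; first by apply: binop_lt.
  do 2 apply: wp_skip; split; first by [].
  by eexists; split; [reflexivity|..|by frame_tac]; rewrite /= ?f11 ?f16 ?eqb0 ?negbK //.
move=> /eqP; rewrite eqb0 => /negbTE ->.
apply: wp_seq; apply: wp_const; first by lia.
op_step binop_eq; first by [].
apply: wp_seq; apply: wp_if => /=; rewrite f15.
  rewrite eqb0 negbK => /eqP -> /=.
  op_step binop_lt; first by [].
  apply: wp_seq; apply: wp_const; first by lia.
  do 4 apply: wp_skip; split; first by [].
  by eexists; split; [reflexivity|..|by frame_tac]; rewrite /= ?f12 ?f16 ?eqb0 ?negbK //.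
move=> /eqP; rewrite eqb0 => /negbTE ->.
op_step binop_eq; first by [].
apply: wp_seq; apply: wp_if => /=; rewrite f15 f6.
  rewrite eqb0 negbK => /eqP -> /=.
  apply: wp_op; first by apply: binop_add; rewrite /= f12 f5; lia.
  do 4 apply: wp_skip; split; first by [].
  by eexists; split; [reflexivity|..|by frame_tac]; rewrite /= ?f12 ?f5 ?addn1 //.
move=> /eqP; rewrite eqb0 => /negbTE ->.
do 5 apply: wp_skip; split; first by [].
by eexists; split; [reflexivity|..|by frame_tac].
Qed.

Definition node_body (rd : cmd) : cmd :=
  cseq [:: COp OMul 14 10 6; COp OAdd 14 14 8; CLoad 15 14;
    COp OAdd 14 14 5; CLoad 16 14; COp OAdd 14 14 5; CLoad 17 14;
    COp OAdd 14 14 5; CLoad 18 14; decide_cmd rd;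
    CIf 19 (COp OAdd 10 18 9) (COp OAdd 10 17 9);
    COp OAdd 11 11 5; COp OLt 13 11 4].

Definition interp_cmd (rd : cmd) : cmd :=
  cseq [:: CConst 10 0; CConst 11 0; CConst 12 0; COp OLt 13 11 4;
    CWhile 13 (node_body rd);
    COp OMul 14 10 6; COp OAdd 14 14 8; COp OAdd 14 14 5; CLoad 16 14].

Definition interp_temps := iota 10 11.

Section Interp.
Variables (w M : nat) (inp : seq nat) (m q : nat -> nat) (rd : cmd).
Variables (d X N gb : nat) (tp : seq nat).
Hypotheses (w4 : 4 < 2 ^ w) (d0 : 0 < d) (hrd : reads w M inp m d rd q).
Hypotheses (NM : gb + N * 4 <= M) (Mw : M < 2 ^ w) (Xw : X.+1 < 2 ^ w).
Hypothesis dig : forall i, i < N * 4 -> m (gb + i) < N.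

Let g i := m (gb + i).

Definition interp_pre (f : nat -> nat) : Prop :=
  [/\ f 1 = d, f 4 = X, f 5 = 1 & f 6 = 4] /\ f 8 = gb /\ f 9 = 0.

Lemma interp_pre_frame f f' : interp_pre f -> frame interp_temps f f' -> interp_pre f'.
Proof.
by move=> [[f1 f4 f5 f6] [f8 f9]] fr; split; [split|split]; rewrite fr.
Qed.

Lemma node_body_spec f pc t c : interp_pre f -> t < X -> pc < N -> c <= t ->
  f 10 = pc -> f 11 = t -> f 12 = c ->
  wp w M inp (node_body rd) (State f m tp) (fun t' s' => t' <= 40 /\ exists f',
    [/\ s' = State f' m tp, (f' 10, f' 11, f' 12) = node_step g q d (pc, t, c),
        f' 13 = (t.+1 < X) & frame interp_temps f f']).
Proof.
move=> [[f1 f4 f5 f6] [f8 f9]] tX pcN ct f10 f11 f12.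
have w1 : 1 < 2 ^ w by lia.
have h0 : m (gb + pc * 4) < N by apply: dig; lia.
have h1 : m (gb + (pc * 4 + 1)) < N by apply: dig; lia.
have h2 : m (gb + (pc * 4 + 2)) < N by apply: dig; lia.
have h3 : m (gb + (pc * 4 + 3)) < N by apply: dig; lia.
have e0 : pc * 4 + gb = gb + pc * 4 by lia.
have e1 : gb + pc * 4 + 1 = gb + (pc * 4 + 1) by lia.
have e2 : gb + (pc * 4 + 1) + 1 = gb + (pc * 4 + 2) by lia.
have e3 : gb + (pc * 4 + 2) + 1 = gb + (pc * 4 + 3) by lia.
op_step binop_mul; first by rewrite f10 f6; lia.
op_step binop_add; first by rewrite f10 f6 f8; lia.
rewrite f10 f6 f8 e0.
apply: wp_seq; apply: wp_load => /=; first by lia.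
op_step binop_add; first by rewrite f5; lia.
rewrite f5 e1.
apply: wp_seq; apply: wp_load => /=; first by lia.
op_step binop_add; first by rewrite f5; lia.
rewrite f5 e2.
apply: wp_seq; apply: wp_load => /=; first by lia.
op_step binop_add; first by rewrite f5; lia.
rewrite f5 e3.
apply: wp_seq; apply: wp_load => /=; first by lia.
set f1' := upd _ 18 _.
have fr1 : frame interp_temps f f1' by rewrite /f1'; frame_tac.
apply: wp_seq; apply: wp_conseq.
  apply: (@decide_spec _ _ _ _ d _ q f1' tp (g (pc * 4)) (g (pc * 4 + 1)) t c) => //.
  - by rewrite /g; lia.
  - by lia.
move=> t1 s1 [ht1 [f2 [-> e19 e12 fr2]]].
have fr : frame interp_temps f f2.
  by apply: frame_trans fr1 (frame_sub _ fr2) => x; rewrite !inE => /or3P[] /eqP->.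
have e18 : f2 18 = g (pc * 4 + 3) by rewrite (fr2 18).
have e17 : f2 17 = g (pc * 4 + 2) by rewrite (fr2 17).
have e11 : f2 11 = t by rewrite (fr2 11).
have [e4 e5 e9] : [/\ f2 4 = X, f2 5 = 1 & f2 9 = 0] by rewrite !fr.
apply: wp_seq.
apply: (@wp_conseq _ _ _ _ _ (fun t s => t = 2 /\ s = State (upd f2 10
   (if f2 19 != 0 then g (pc * 4 + 3) else g (pc * 4 + 2))) m tp)).
  apply: wp_if => h19; apply: wp_op; rewrite ?e17 ?e18 ?e9.
  - by apply: binop_add; rewrite addn0 /g; lia.
  - by rewrite addn0 h19.
  - by apply: binop_add; rewrite addn0 /g; lia.
  - by rewrite addn0 h19.
move=> _ _ [-> ->].
op_step binop_add; first by rewrite e11 e5; lia.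
op_step binop_lt; first by [].
apply: wp_skip; split; first by lia.
eexists; split; first by reflexivity.
- by rewrite /= e11 e5 addn1 e12 e19.
- by rewrite /= e11 e5 addn1 e4.
- by frame_tac.
Qed.

(** A step increments the counter at most once, so [c <= t] persists; together with [t <= X] it
    prevents clock and counter from wrapping around. The factor 41 is the 40 steps of the body plus
    one for the loop. *)
Lemma node_loop f pc t c : interp_pre f -> t <= X -> pc < N -> c <= t ->
  f 10 = pc -> f 11 = t -> f 12 = c -> f 13 = (t < X) ->
  wp w M inp (CWhile 13 (node_body rd)) (State f m tp)
    (fun t' s' => t' <= 41 * (X - t) + 1 /\ exists f',
    [/\ s' = State f' m tp,
        f' 10 = (iter (X - t) (node_step g q d) (pc, t, c)).1.1,
        f' 10 < N & frame interp_temps f f']).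
Proof.
elim: {t}(X - t) {-2}t (erefl (X - t)) f pc c.
  move=> t et f pc c hp tX pcN ct f10 f11 f12 f13.
  apply: wp_while_end; first by rewrite f13; lia.
  by split; first lia; exists f; split; rewrite ?et ?f10.
move=> k ih t et f pc c hp tX pcN ct f10 f11 f12 f13.
have tX' : t < X by lia.
apply: wp_while_step; first by rewrite f13 tX'.
apply: wp_conseq; first exact: (node_body_spec hp tX' pcN ct).
move=> t1 _ [ht1 [f1 [-> e e13 fr]]].
have [e1 e2 e3] : [/\ f1 10 = (node_step g q d (pc, t, c)).1.1, f1 11 = t.+1
    & f1 12 = (node_step g q d (pc, t, c)).2] by rewrite -e; case: e.
apply: wp_conseq; first apply: (ih t.+1 _ f1 (f1 10) (f1 12)) => //.
- by lia.
- by apply: interp_pre_frame hp fr.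
- by rewrite e1 /=; case: ifP => _; apply: dig; lia.
- by rewrite e3 /=; case: ifP => // _; case: ifP => _; lia.
move=> t2 _ [ht2 [f2 [-> e10 lt fr2]]]; split; first by lia.
have -> : X - t = (X - t.+1).+1 by lia.
exists f2; split => //; last by apply: frame_trans fr fr2.
by rewrite iterSr e10 -e -e2.
Qed.

Lemma interp_spec f : 0 < N -> interp_pre f ->
  wp w M inp (interp_cmd rd) (State f m tp) (fun t' s' => t' <= 41 * X + 10 /\
    exists f', [/\ s' = State f' m tp, f' 16 = graph_output g q d X
      & frame interp_temps f f']).
Proof.
move=> N0 hp; have [[f1 f4 f5 f6] [f8 f9]] := hp.
do 3 (apply: wp_seq; apply: wp_const; first by lia).
op_step binop_lt; first by lia.
set f1' := upd _ 13 _.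
have fr1 : frame interp_temps f f1' by rewrite /f1'; frame_tac.
apply: wp_seq; apply: wp_conseq; first apply: (@node_loop f1' 0 0 0) => //=.
  by rewrite /f1' /= f4.
move=> t2 _ [ht2 [f2 [-> e10 lt fr2]]].
have fr : frame interp_temps f f2 by apply: frame_trans fr1 fr2.
op_step binop_mul; first by rewrite (fr 6) // f6; lia.
op_step binop_add; first by rewrite (fr 6) // f6 (fr 8) // f8; lia.
op_step binop_add; first by rewrite (fr 6) // f6 (fr 8) // f8 (fr 5) // f5; lia.
apply: wp_seq; apply: wp_load => /=; first by rewrite (fr 6) // f6 (fr 8) // f8 (fr 5) // f5; lia.
apply: wp_skip; split; first by lia.
eexists; split; first by reflexivity.
- rewrite /= (fr 6) // f6 (fr 8) // f8 (fr 5) // f5 /graph_output /g -[in RHS](subn0 X) -e10.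
  by congr m; lia.
- by frame_tac.
Qed.

End Interp.

(** * Exact check of an answer against the dataset *)

Definition row_dist (inp u : seq nat) (d i : nat) : nat :=
  \sum_(0 <= j < d) (nth 0 inp (i * d + j) != nth 0 u j).

(** Phrased through the counts that [check_cmd] accumulates in one pass over all rows; [acceptableP]
    is the reading in terms of distances. *)
Definition acceptable (inp u : seq nat) (n d a b v : nat) : bool :=
  if v == 0 then \sum_(0 <= i < n) (row_dist inp u d i <= a) == 0
  else \sum_(0 <= i < n) ((row_dist inp u d i <= b) && (v == i.+1)) != 0.

Definition dist_body : cmd :=
  cseq [:: CInput 29 24; COp OAdd 30 27 5; CLoad 30 30; COp OEq 29 29 30;
    COp OEq 29 29 9; COp OAdd 26 26 29; COp OAdd 24 24 5; COp OAdd 27 27 5;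
    COp OLt 28 27 1].

Definition row_body : cmd :=
  cseq [:: CConst 26 0; CConst 27 0; COp OLt 28 27 1; CWhile 28 dist_body;
    COp OAdd 21 21 5; COp OLt 29 3 26; COp OEq 29 29 9; COp OEq 30 16 21;
    COp OMul 29 29 30; COp OAdd 22 22 29; COp OLt 29 2 26; COp OEq 29 29 9;
    COp OAdd 23 23 29; COp OLt 25 21 0].

Definition check_cmd : cmd :=
  cseq [:: CConst 21 0; CConst 22 0; CConst 23 0; CConst 24 0; COp OLt 25 21 0;
    CWhile 25 row_body; COp OEq 29 23 9; CIf 16 (COp OAdd 29 22 9) CSkip;
    CIf 29 CSkip (CConst 31 0)].

Definition check_temps := iota 21 10.

Lemma sum_bool_le (P : nat -> bool) n : \sum_(0 <= i < n) P i <= n.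
Proof.
elim: n => [|n ih]; first by rewrite big_geq.
by rewrite big_nat_recr //=; case: (P n); lia.
Qed.

Section Check.
Variables (w M : nat) (inp u : seq nat) (m : nat -> nat) (tp : seq nat).
Variables (n d a b v : nat).
Hypotheses (w1 : 1 < 2 ^ w) (n0 : 0 < n) (d0 : 0 < d) (hinp : size inp = n * d).
Hypotheses (ndw : n * d < 2 ^ w) (dM : d < M) (Mw : M < 2 ^ w).
Hypothesis hm : forall j, j < d -> m j.+1 = nth 0 u j.

Definition check_pre (f : nat -> nat) : Prop :=
  [/\ f 0 = n, f 1 = d, f 2 = a & f 3 = b] /\ [/\ f 5 = 1, f 9 = 0 & f 16 = v].

Lemma check_pre_frame f f' : check_pre f -> frame check_temps f f' -> check_pre f'.
Proof. by move=> [[? ? ? ?] [? ? ?]] fr; split; split; rewrite fr. Qed.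

(** Register 24 runs through the whole input and is not reset between rows; it leaves row [i] at the
    start of row [i.+1]. *)
Lemma dist_loop f i j : check_pre f -> i < n -> j <= d ->
  f 24 = i * d + j -> f 27 = j -> f 28 = (j < d) ->
  f 26 = \sum_(0 <= j' < j) (nth 0 inp (i * d + j') != nth 0 u j') ->
  wp w M inp (CWhile 28 dist_body) (State f m tp) (fun _ s' => exists f',
    [/\ s' = State f' m tp, f' 24 = i.+1 * d, f' 26 = row_dist inp u d i
      & frame [:: 24; 26; 27; 28; 29; 30] f f']).
Proof.
move=> hp iN; elim: {j}(d - j) {-2}j (erefl (d - j)) f hp.
  move=> j ej f hp jd f24 f27 f28 f26.
  have {}ej : j = d by lia.
  apply: wp_while_end; first by rewrite f28 ej ltnn.
  by exists f; split => //; rewrite ?f24 ?f26 ej // mulSn addnC.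
move=> k ih j ej f hp jd f24 f27 f28 f26.
have [[f0 f1 f2 f3] [f5 f9 f16]] := hp.
have jd' : j < d by lia.
have ijn : i * d + j < n * d.
  by apply: (@leq_trans (i.+1 * d)); [rewrite mulSn addnC ltn_add2r | rewrite leq_mul2r iN orbT].
have hs : \sum_(0 <= j' < j) (nth 0 inp (i * d + j') != nth 0 u j') <= j.
  exact: (sum_bool_le (fun j' => nth 0 inp (i * d + j') != nth 0 u j')).
have dw : d.+1 < 2 ^ w by lia.
apply: wp_while_step; first by rewrite f28 jd'.
apply: wp_seq; apply: wp_input => /=; first by rewrite f24 hinp.
op_step binop_add; first by rewrite f27 f5; lia.
rewrite f27 f5 addn1.
apply: wp_seq; apply: wp_load => /=; first by lia.
rewrite hm // f24.
op_step binop_eq; first by [].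
op_step binop_eq; first by [].
rewrite f9 eqb0.
op_step binop_add; first by rewrite f26; case: (_ != _); lia.
op_step binop_add; first by rewrite f24 f5; lia.
op_step binop_add; first by rewrite f27 f5; lia.
op_step binop_lt; first by [].
apply: wp_skip; rewrite f26 f24 f27 f5 f1 !addn1.
set f' := upd _ 28 _.
have fr : frame [:: 24; 26; 27; 28; 29; 30] f f' by rewrite /f'; frame_tac.
apply: wp_conseq; first apply: (ih j.+1).
- by lia.
- by apply: check_pre_frame hp (frame_sub _ fr) => x; rewrite !inE => /or4P[| | |/or3P[]] /eqP->.
- by [].
- by rewrite /f' /= addnS.
- by [].
- by [].
- by rewrite /f' /= big_nat_recr.
by move=> t _ [f2' [-> e1 e2 fr2]]; exists f2'; split => //; apply: frame_trans fr fr2.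
Qed.

Lemma row_loop f i : check_pre f -> i <= n ->
  f 21 = i -> f 24 = i * d -> f 25 = (i < n) ->
  f 22 = \sum_(0 <= i' < i) ((row_dist inp u d i' <= b) && (v == i'.+1)) ->
  f 23 = \sum_(0 <= i' < i) (row_dist inp u d i' <= a) ->
  wp w M inp (CWhile 25 row_body) (State f m tp) (fun _ s' => exists f',
    [/\ s' = State f' m tp, frame check_temps f f',
      f' 22 = \sum_(0 <= i' < n) ((row_dist inp u d i' <= b) && (v == i'.+1))
    & f' 23 = \sum_(0 <= i' < n) (row_dist inp u d i' <= a)]).
Proof.
elim: {i}(n - i) {-2}i (erefl (n - i)) f.
  move=> i ei f hp iN f21 f24 f25 f22 f23.
  have {}ei : i = n by lia.
  apply: wp_while_end; first by rewrite f25 ei ltnn.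
  by exists f; split => //; rewrite ?f22 ?f23 ei.
move=> k ih i ei f hp iN f21 f24 f25 f22 f23.
have iN' : i < n by lia.
have nw : n < 2 ^ w by apply: leq_ltn_trans ndw; rewrite leq_pmulr.
have h22 := sum_bool_le (fun i' => (row_dist inp u d i' <= b) && (v == i'.+1)) i.
have h23 := sum_bool_le (fun i' => row_dist inp u d i' <= a) i.
apply: wp_while_step; first by rewrite f25 iN'.
do 2 (apply: wp_seq; apply: wp_const; first by lia).
op_step binop_lt; first by [].
set f1 := upd _ 28 _.
have fr1 : frame check_temps f f1 by rewrite /f1; frame_tac.
have hp1 := check_pre_frame hp fr1.
have [[g0 g1 g2 g3] [g5 g9 g16]] := hp.
apply: wp_seq; apply: wp_conseq; first apply: (@dist_loop f1 i 0) => //.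
- by rewrite addn0.
- by rewrite /f1 /= g1.
- by rewrite big_geq.
move=> t1 _ [f2 [-> e24 e26 fr2]].
have fr12 : frame check_temps f f2.
  by apply: frame_trans fr1 (frame_sub _ fr2) => x; rewrite !inE => /or4P[| | |/or3P[]] /eqP->.
have [[k0 k1 k2 k3] [k5 k9 k16]] := check_pre_frame hp fr12.
have e21 : f2 21 = i by rewrite (fr2 21).
have e22 : f2 22 = f 22 by rewrite (fr2 22).
have e23 : f2 23 = f 23 by rewrite (fr2 23).
op_step binop_add; first by rewrite e21 k5; lia.
op_step binop_lt; first by [].
op_step binop_eq; first by [].
rewrite e21 k5 k3 k9 e26 addn1 eqb0 -leqNgt.
op_step binop_eq; first by [].
op_step binop_mul; first by rewrite k16 mulnb; apply: leq_ltn_trans (leq_b1 _) w1.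
rewrite k16 mulnb.
op_step binop_add; first by rewrite e22 f22; case: (_ && _); lia.
op_step binop_lt; first by [].
op_step binop_eq; first by [].
rewrite k9 k2 e26 eqb0 -leqNgt.
op_step binop_add; first by rewrite e23 f23; have := leq_b1 (row_dist inp u d i <= a); lia.
op_step binop_lt; first by [].
rewrite e22 e23 k0; apply: wp_skip.
set f3 := upd _ 25 _.
have fr3 : frame check_temps f f3 by rewrite /f3; frame_tac.
apply: wp_conseq; first apply: (ih i.+1).
- by lia.
- exact: check_pre_frame hp fr3.
- by [].
- by [].
- by rewrite /f3 /= e24.
- by [].
- by rewrite /f3 /= f22 big_nat_recr.
- by rewrite /f3 /= f23 big_nat_recr.
by move=> t _ [f4 [-> fr4 e1 e2]]; exists f4; split => //; apply: frame_trans fr3 fr4.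
Qed.

Lemma check_spec f : check_pre f ->
  wp w M inp check_cmd (State f m tp) (fun _ s' => exists f',
    [/\ s' = State f' m tp, frame (31 :: check_temps) f f'
      & f' 31 = if acceptable inp u n d a b v then f 31 else 0]).
Proof.
move=> hp; have [[f0 f1 f2 f3] [f5 f9 f16]] := hp.
have nw : n < 2 ^ w by apply: leq_ltn_trans ndw; rewrite leq_pmulr.
have h22 := sum_bool_le (fun i' => (row_dist inp u d i' <= b) && (v == i'.+1)) n.
do 4 (apply: wp_seq; apply: wp_const; first by lia).
op_step binop_lt; first by [].
set f1' := upd _ 25 _.
have fr1 : frame check_temps f f1' by rewrite /f1'; frame_tac.
apply: wp_seq; apply: wp_conseq; first apply: (@row_loop f1' 0) => //.
- by rewrite /f1' /= f0.
- by rewrite big_geq.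
- by rewrite big_geq.
move=> t1 _ [f2' [-> fr2 e22 e23]].
have fr12 := frame_trans fr1 fr2.
have e31 : f2' 31 = f 31 by rewrite (fr12 31).
have [[k0 k1 k2 k3] [k5 k9 k16]] := check_pre_frame hp fr12.
have frS g : frame check_temps f g -> frame (31 :: check_temps) f g.
  by apply: frame_sub => x hx; rewrite inE hx orbT.
op_step binop_eq; first by [].
rewrite k9 e23.
apply: wp_seq; apply: (@wp_conseq _ _ _ _ _ (fun _ s => exists f3, [/\
   s = State f3 m tp, frame check_temps f f3, f3 31 = f 31
   & (f3 29 != 0) = acceptable inp u n d a b v])).
  apply: wp_if; rewrite /= k16 /acceptable.
    move=> /negbTE ->; apply: wp_op; first by apply: binop_add; rewrite /= e22 k9; lia.
    eexists; split; first by reflexivity.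
    - by frame_tac.
    - by rewrite /= e31.
    - by rewrite /= e22 k9 addn0.
  move=> ->; apply: wp_skip; eexists; split; first by reflexivity.
  - by frame_tac.
  - by rewrite /= e31.
  - by rewrite /= eqb0 negbK.
move=> _ _ [f3' [-> fr3 e3 e29]].
apply: wp_seq; apply: wp_if; rewrite -e29.
  move=> ->; apply: wp_skip; apply: wp_skip; exists f3'; split => //.
  exact: frS.
move=> ->; apply: wp_const; first by lia.
apply: wp_skip; eexists; split; first by reflexivity.
- by apply: frame_upd; first exact: frS.
- by [].
Qed.

End Check.

(** * The search for a good graph *)

(* Cell 0 is left for the number of steps, cells 1 to d hold the query under
   test and the graph starts at cell d + 1. *)
Definition layout (d : nat) (u g : seq nat) : nat -> nat :=
  fun y => if y == 0 then 0 else if y <= d then nth 0 u y.-1 else nth 0 g (y - d.+1).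

Lemma layout_query d u g j : j < d -> layout d u g j.+1 = nth 0 u j.
Proof. by rewrite /layout /= => ->. Qed.

Lemma layout_graph d u g i : layout d u g (d.+1 + i) = nth 0 g i.
Proof. by rewrite /layout addSn /= ltnNge leq_addr /= subSS addKn. Qed.

Lemma cells_query d u g : size u = d -> cells (layout d u g) 1 d = u.
Proof.
move=> su; apply: (@eq_from_nth _ 0); first by rewrite size_mkseq.
by move=> i; rewrite size_mkseq => hi; rewrite nth_mkseq // add1n layout_query.
Qed.

Lemma cells_graph d u g : cells (layout d u g) d.+1 (size g) = g.
Proof.
apply: (@eq_from_nth _ 0); first by rewrite size_mkseq.
by move=> i; rewrite size_mkseq => hi; rewrite nth_mkseq // layout_graph.
Qed.

Lemma mset_query d u u' g : size u' = d -> mset (layout d u g) 1 u' = layout d u' g.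
Proof.
move=> su; apply: funext => -[|y] //; rewrite /mset /layout su add1n /= subSS subn0 ltnS.
by case: (ltnP y d).
Qed.

Lemma mset_graph d u g g' : size g' = size g ->
  mset (layout d u g) d.+1 g' = layout d u g'.
Proof.
move=> sg; apply: funext => y; rewrite /mset /layout; case: y => [|y] //=.
rewrite ltnS; case: (leqP d y) => //= dy.
by case: ltnP => // h; rewrite !nth_default //; lia.
Qed.

(** When the odometer overflows, its digits are zero and the cells beyond it have never been
    written, so memory already contains the first graph of the next size. *)
Lemma layout_zeros d u N N' : layout d u (nseq N 0) = layout d u (nseq N' 0).
Proof. by apply: funext => y; rewrite /layout !nth_nseq !if_same. Qed.

Definition read_mem : cmd := CSeq (COp OAdd 19 19 5) (CLoad 19 19).
Definition read_input : cmd := CInput 19 19.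

Definition verify_body : cmd :=
  cseq [:: interp_cmd read_mem; check_cmd; COp OAdd 33 5 9; COp OAdd 34 1 9;
    CConst 35 2; inc_cmd; COp OEq 32 41 9].

Definition verify_cmd : cmd :=
  cseq [:: CConst 31 1; CConst 32 1; CWhile 32 verify_body].

Definition search_body : cmd :=
  cseq [:: COp OMul 7 0 4; verify_cmd;
    CIf 31 (CConst 42 0)
      (cseq [:: COp OAdd 33 8 9; COp OMul 34 7 6; COp OAdd 35 7 9; inc_cmd;
         CIf 41 (COp OAdd 4 4 5) CSkip])].

Definition prep_cmd : cmd :=
  cseq [:: CConst 4 1; CConst 5 1; CConst 6 4; COp OAdd 8 1 5; CConst 42 1;
    CWhile 42 search_body; CStore 9 4].

Definition query_cmd : cmd :=
  cseq [:: CConst 5 1; CConst 6 4; COp OAdd 8 1 5; CLoad 4 9;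
    interp_cmd read_input; COp OAdd 0 16 9].

Definition good_graph (inp : seq nat) (n d a b X : nat) (g : seq nat) : Prop :=
  forall u, size u = d -> all (fun v => v < 2) u ->
  acceptable inp u n d a b (graph_output (nth 0 g) (nth 0 u) d X).

(** One bound for all cells makes the graphs the numerals of a single odometer. Every clock value,
    threshold, coordinate, answer and node number of the construction therefore has to stay below
    [n * X]. *)
Definition graph_shape (n X : nat) (g : seq nat) : Prop :=
  size g = n * X * 4 /\ all (fun v => v < n * X) g.

Section Search.
Variables (w M : nat) (inp : seq nat) (tp : seq nat).
Variables (n d a b Xs : nat).
Hypotheses (w4 : 4 < 2 ^ w) (n0 : 0 < n) (d0 : 0 < d) (hinp : size inp = n * d).
Hypotheses (ndw : n * d < 2 ^ w) (hM : d.+1 + n * Xs * 4 <= M) (Mw : M < 2 ^ w).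

Let w1 : 1 < 2 ^ w. Proof. by lia. Qed.

Definition search_pre (X : nat) (f : nat -> nat) : Prop :=
  [/\ f 0 = n, f 1 = d, f 2 = a & f 3 = b] /\
  [/\ f 4 = X, f 5 = 1, f 6 = 4, f 8 = d.+1 & f 9 = 0].

Definition verify_temps := iota 10 32.

Lemma search_pre_frame X f f' :
  search_pre X f -> frame verify_temps f f' -> search_pre X f'.
Proof. by move=> [[? ? ? ?] [? ? ? ? ?]] fr; split; split; rewrite fr. Qed.

Lemma reads_mem u g : reads w M inp (layout d u g) d read_mem (nth 0 u).
Proof.
move=> f tp' fd f5; op_step binop_add; first by rewrite f5; lia.
apply: wp_load => /=; first by rewrite f5; lia.
split=> //; eexists; split; first by reflexivity.
  by rewrite /= f5 addn1 layout_query.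
by frame_tac.
Qed.

Section Verify.
Variables (X : nat) (g : seq nat).
Hypotheses (X0 : 0 < X) (XXs : X <= Xs) (hg : graph_shape n X g).

Let nXle : n * X <= n * Xs. Proof. by rewrite leq_mul2l XXs orbT. Qed.
Let Xn : X <= n * X. Proof. by rewrite leq_pmull. Qed.

Lemma verify_body_spec f u : search_pre X f -> size u = d ->
  all (fun v => v < 2) u ->
  wp w M inp verify_body (State f (layout d u g) tp) (fun _ s' => exists f',
    [/\ s' = State f' (layout d (inc 2 u).1 g) tp, frame verify_temps f f',
      f' 31 = if acceptable inp u n d a b (graph_output (nth 0 g) (nth 0 u) d X)
              then f 31 else 0
    & f' 32 = ~~ (inc 2 u).2]).
Proof.
move=> hp su bu; have [sg dg] := hg.
have [[f0 f1 f2 f3] [f4 f5 f6 f8 f9]] := hp.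
have eg : (fun i => layout d u g (d.+1 + i)) = nth 0 g.
  by apply: funext => i; rewrite layout_graph.
apply: wp_seq; apply: wp_conseq.
  apply: (@interp_spec w M inp (layout d u g) (nth 0 u) read_mem d X (n * X) d.+1) => //.
  - exact: reads_mem.
  - by lia.
  - by lia.
  - move=> i hi; rewrite layout_graph; move/allP: dg; apply.
    by rewrite mem_nth // sg.
  - by rewrite muln_gt0 n0.
rewrite eg => _ _ [_ [f1' [-> e16 fr1]]].
have fr1' : frame verify_temps f f1'.
  apply: frame_sub fr1 => x; rewrite !mem_iota; lia.
have [[k0 k1 k2 k3] [k4 k5 k6 k8 k9]] := search_pre_frame hp fr1'.
apply: wp_seq; apply: wp_conseq.
  apply: (@check_spec w M inp u _ tp n d a b (f1' 16)) => //.
  - by lia.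
  - by move=> j; apply: layout_query.
move=> _ _ [f2' [-> fr2 e31]].
have fr2' : frame verify_temps f f2'.
  apply: (frame_trans fr1'); apply: frame_sub fr2 => x; rewrite inE !mem_iota; lia.
have [[l0 l1 l2 l3] [l4 l5 l6 l8 l9]] := search_pre_frame hp fr2'.
op_step binop_add; first by rewrite l5 l9; lia.
op_step binop_add; first by rewrite l1 l9; lia.
apply: wp_seq; apply: wp_const; first by lia.
rewrite l5 l9 l1 !addn0.
set f3' := upd _ 35 _.
have fr3 : frame verify_temps f f3' by rewrite /f3'; frame_tac.
apply: wp_seq; apply: wp_conseq.
  apply: (@inc_spec _ _ _ f3' _ _ 2 1 d) => //; first by lia.
  - by lia.
  - by rewrite cells_query.
rewrite cells_query // mset_query ?size_inc // => _ _ [f4' [-> fr4 e41]].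
have fr4' : frame verify_temps f f4'.
  apply: (frame_trans fr3); apply: frame_sub fr4 => x; rewrite mem_iota !inE; lia.
have [[m0 m1 m2 m3] [m4 m5 m6 m8 m9]] := search_pre_frame hp fr4'.
op_step binop_eq; first by [].
apply: wp_skip; eexists; split; first by reflexivity.
- by frame_tac.
- by rewrite /= (fr4 31) // /f3' /= e31 e16 (fr1 31).
- by rewrite /= e41 m9 eqb0.
Qed.

(** Induction on the number of queries still to be tested. Register 31 is only ever cleared here, so
    it accumulates a conjunction; the final carry leaves the query cells at zero, ready for the next
    graph. *)
Lemma verify_loop f u : search_pre X f -> size u = d ->
  all (fun v => v < 2) u -> f 32 = 1 ->
  wp w M inp (CWhile 32 verify_body) (State f (layout d u g) tp) (fun _ s' =>
    exists f', [/\ s' = State f' (layout d (nseq d 0) g) tp, frame verify_temps f f'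
    & f' 31 != 0 <-> f 31 != 0 /\ forall u', size u' = d -> all (fun v => v < 2) u' ->
        digits_val 2 u <= digits_val 2 u' ->
        acceptable inp u' n d a b (graph_output (nth 0 g) (nth 0 u') d X)]).
Proof.
move: {2}(2 ^ d - digits_val 2 u) (erefl (2 ^ d - digits_val 2 u)) => k.
elim: k u f => [|k ih] u f ek hp su bu f32.
  by have := digits_val_lt (isT : 0 < 2) bu; rewrite su; lia.
apply: wp_while_step; first by rewrite f32.
apply: wp_conseq; first exact: verify_body_spec.
move=> _ _ [f1 [-> fr1 e31 e32]].
case c : (inc 2 u).2; rewrite c /= in e32.
  have [-> ev] := inc_carry c.
  apply: wp_while_end => //; exists f1; split => //; first by rewrite su.
  rewrite e31; split.
    case: ifP => // ac h; split => // u' su' bu' le; suff -> : u' = u by [].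
    apply: (@digits_val_inj 2); rewrite ?su ?su' //.
    by have := digits_val_lt (isT : 0 < 2) bu'; rewrite su'; rewrite su in ev; lia.
  by move=> [h /(_ u su bu (leqnn _)) ->].
have {}c : ~~ (inc 2 u).2 by rewrite c.
have ev := inc_carryN c.
apply: wp_conseq; first apply: (ih (inc 2 u).1 f1) => //.
- by rewrite ev; lia.
- exact: search_pre_frame hp fr1.
- by rewrite size_inc.
- exact: inc_digits.
move=> _ _ [f2 [-> fr2 e]]; exists f2; split=> //; first exact: frame_trans fr1 fr2.
rewrite e e31 ev; split.
  case: ifP => // ac [h h2]; split => // u' su' bu' le.
  case: (ltngtP (digits_val 2 u) (digits_val 2 u')) => [lt|gt|eq].
  - exact: h2.
  - by lia.
  - by rewrite -(@digits_val_inj 2 u u') // su su'.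
move=> [h h2]; rewrite h2 //; split => // u' su' bu' le; apply: h2 => //; lia.
Qed.

Lemma verify_spec f : search_pre X f ->
  wp w M inp verify_cmd (State f (layout d (nseq d 0) g) tp) (fun _ s' =>
    exists f', [/\ s' = State f' (layout d (nseq d 0) g) tp, frame verify_temps f f'
    & f' 31 != 0 <-> good_graph inp n d a b X g]).
Proof.
move=> hp; do 2 (apply: wp_seq; apply: wp_const; first by lia).
set f1 := upd _ 32 _.
have fr1 : frame verify_temps f f1 by rewrite /f1; frame_tac.
apply: wp_seq; apply: wp_conseq; first apply: verify_loop.
- exact: search_pre_frame hp fr1.
- by rewrite size_nseq.
- by rewrite all_nseq orbT.
- by [].
move=> _ _ [f2 [-> fr2 e]]; apply: wp_skip; exists f2; split=> //.
  exact: frame_trans fr1 fr2.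
rewrite e; split=> [[_ h] u su bu|h].
  by apply: h => //; rewrite digits_val_nseq0.
by split=> // u' su bu _; apply: h.
Qed.

End Verify.

Variable gs : seq nat.
Hypotheses (Xs0 : 0 < Xs) (hgs : graph_shape n Xs gs)
  (good_gs : good_graph inp n d a b Xs gs).

Definition search_post (s' : state) : Prop :=
  exists f' X g, [/\ s' = State f' (layout d (nseq d 0) g) tp, 0 < X <= Xs,
    search_pre X f', graph_shape n X g & good_graph inp n d a b X g].

(** The known good graph [gs] acts as a barrier: the last premise says that at size [Xs] the
    odometer has not passed it. The induction is lexicographic, on [Xs - X] and then on the numerals
    left at the current size. The search may stop at another graph before the barrier. *)
Lemma search_loop X g f : 0 < X <= Xs -> graph_shape n X g -> search_pre X f ->
  f 42 = 1 -> (X = Xs -> digits_val (n * X) g <= digits_val (n * X) gs) ->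
  wp w M inp (CWhile 42 search_body) (State f (layout d (nseq d 0) g) tp)
    (fun _ => search_post).
Proof.
move: {2}(Xs - X) (erefl (Xs - X)) => kx.
elim: kx X g f => [|kx ihx] X g f ekx.
all: move: {2}((n * X) ^ (n * X * 4) - digits_val (n * X) g)
  (erefl ((n * X) ^ (n * X * 4) - digits_val (n * X) g)) => k.
all: elim: k g f => [|k ih] g f ek /andP[X0 XXs] hg hp f42 hle.
1,3: by have [sg dg] := hg; have := digits_val_lt _ dg; rewrite sg muln_gt0 n0 X0; lia.
all: have [sg dg] := hg.
all: have nX0 : 0 < n * X by rewrite muln_gt0 n0.
all: have nXle : n * X <= n * Xs by rewrite leq_mul2l XXs orbT.
all: have Xn : X <= n * X by rewrite leq_pmull.
all: have [[f0 f1 f2 f3] [f4 f5 f6 f8 f9]] := hp.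
all: apply: wp_while_step; first by rewrite f42.
all: op_step binop_mul; first by rewrite f0 f4; lia.
all: rewrite f0 f4; set f1' := upd _ 7 _.
all: have hp1 : search_pre X f1' by split; split.
all: apply: wp_seq; apply: wp_conseq; first exact: (verify_spec X0 XXs hg hp1).
all: move=> _ _ [f2' [-> fr2 e31]].
all: have hp2 := search_pre_frame hp1 fr2.
all: have [[k0 k1 k2 k3] [k4 k5 k6 k8 k9]] := hp2.
all: apply: wp_seq; apply: wp_if.
1,3: move=> /e31 gd; apply: wp_const; first by lia.
1,2: apply: wp_skip; apply: wp_while_end => //.
1,2: eexists; exists X, g; split; [by reflexivity|by rewrite X0|by split; split|by []|by []].
all: move=> e0; have ngd : ~ good_graph inp n d a b X g by move=> /e31; rewrite e0.
all: have e7 : f2' 7 = n * X by rewrite (fr2 7).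
all: op_step binop_add; first by rewrite k8 k9; lia.
all: op_step binop_mul; first by rewrite e7 k6; lia.
all: op_step binop_add; first by rewrite e7 k9; lia.
all: rewrite k8 k9 e7 k6 !addn0; set f3' := upd _ 35 _.
all: have hp3 : search_pre X f3' by split; split.
all: apply: wp_seq; apply: wp_conseq;
  first by (apply: (@inc_spec _ _ _ f3' _ _ (n * X) d.+1 (n * X * 4)) => //;
            rewrite -?sg ?cells_graph //; lia).
all: rewrite -sg cells_graph mset_graph ?size_inc // => _ _ [f4' [-> fr4 e41]].
all: have fr4' : frame verify_temps f3' f4'
  by (apply: frame_sub fr4 => x; rewrite mem_iota !inE; lia).
all: have hp4 := search_pre_frame hp3 fr4'.
all: have [[m0 m1 m2 m3] [m4 m5 m6 m8 m9]] := hp4.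
all: have e42 : f4' 42 = 1 by rewrite (fr4' 42) // /f3' /= (fr2 42).
all: have eqgs : X = Xs -> digits_val (n * X) g = digits_val (n * X) gs -> False
  by (move=> eX; rewrite eX in sg dg ngd *; case: hgs => sgs dgs ev;
      apply: ngd; have -> : g = gs by (apply: digits_val_inj ev => //; rewrite sg)).
all: apply: wp_seq; apply: wp_if; rewrite e41.
all: case c : (inc (n * X) g).2 => // _.
(* An overflow at size [Xs] means that [g] is the largest numeral; as it has not passed [gs], it
   equals [gs], which contradicts the failed verification. *)
- exfalso; have eX : X = Xs by lia.
  have [_ ev] := inc_carry c; apply: (eqgs eX); apply/eqP; rewrite eqn_leq hle //=.
  have [sgs dgs] := hgs; rewrite -eX in sgs dgs.
  by have := digits_val_lt nX0 dgs; rewrite sgs; rewrite sg in ev; lia.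
- have {}c : ~~ (inc (n * X) g).2 by rewrite c.
  have ev := inc_carryN c; do 3 apply: wp_skip.
  apply: ih => //.
  + by rewrite ev; lia.
  + by rewrite X0.
  + by split; [rewrite size_inc | apply: inc_digits].
  + by move=> eX; rewrite ev ltn_neqAle hle // andbT; apply/eqP; apply: eqgs.
- have [-> ev] := inc_carry c.
  apply: wp_op; first by apply: binop_add; rewrite m4 m5; lia.
  do 2 apply: wp_skip; rewrite m4 m5 addn1 (layout_zeros _ _ _ (n * X.+1 * 4)).
  apply: (ihx X.+1) => //.
  + by lia.
  + by lia.
  + by split; [rewrite size_nseq | rewrite all_nseq muln_gt0 n0 orbT].
  + by rewrite digits_val_nseq0.
- have {}c : ~~ (inc (n * X) g).2 by rewrite c.
  have ev := inc_carryN c; do 3 apply: wp_skip.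
  apply: ih => //.
  + by rewrite ev; lia.
  + by rewrite X0.
  + by split; [rewrite size_inc | apply: inc_digits].
  + by move=> eX; rewrite ev ltn_neqAle hle // andbT; apply/eqP; apply: eqgs.
Qed.

Lemma prep_spec f : f 0 = n -> f 1 = d -> f 2 = a -> f 3 = b -> f 9 = 0 ->
  wp w M inp prep_cmd (State f (fun=> 0) tp) (fun _ s' =>
    exists X g, [/\ mem s' = upd (layout d (nseq d 0) g) 0 X, 0 < X <= Xs,
      graph_shape n X g & good_graph inp n d a b X g]).
Proof.
move=> f0 f1 f2 f3 f9.
do 3 (apply: wp_seq; apply: wp_const; first by lia).
op_step binop_add; first by rewrite f1; lia.
apply: wp_seq; apply: wp_const; first by lia.
rewrite f1 addn1.
have -> : (fun=> 0) = layout d (nseq d 0) (nseq (n * 1 * 4) 0).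
  by apply: funext => y; rewrite /layout !nth_nseq !if_same.
apply: wp_seq; apply: wp_conseq; first apply: (@search_loop 1) => //.
- by split; [rewrite size_nseq | rewrite all_nseq muln1 n0 orbT].
- by rewrite digits_val_nseq0.
move=> _ _ [f' [X [g [-> hX [_ [e4 _ _ _ e9]] sh gd]]]].
apply: wp_seq; apply: wp_store; first by rewrite e9; lia.
by apply: wp_skip; exists X, g; rewrite /= e9 e4.
Qed.

End Search.

(** The query program contains no store, which is why memory is returned unchanged. *)
Lemma query_spec w M inp tp n d X g f : 4 < 2 ^ w -> 0 < n -> 0 < d -> 0 < X ->
  size inp = d -> d.+1 + n * X * 4 <= M -> M < 2 ^ w -> graph_shape n X g ->
  f 1 = d -> f 9 = 0 ->
  wp w M inp query_cmd (State f (upd (layout d (nseq d 0) g) 0 X) tp) (fun t s' =>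
    [/\ t <= 41 * X + 16, mem s' = upd (layout d (nseq d 0) g) 0 X
    & regs s' 0 = graph_output (nth 0 g) (nth 0 inp) d X]).
Proof.
move=> w4 n0 d0 X0 si hM Mw [sg dg] f1 f9.
have nX0 : 0 < n * X by rewrite muln_gt0 n0.
have Xn : X <= n * X by rewrite leq_pmull.
set m := upd _ 0 X.
have hm i : m (d.+1 + i) = nth 0 g i by rewrite /m /upd /= layout_graph.
do 2 (apply: wp_seq; apply: wp_const; first by lia).
op_step binop_add; first by rewrite f1; lia.
apply: wp_seq; apply: wp_load => /=; first by rewrite f9; lia.
rewrite f9 f1 addn1.
apply: wp_seq; apply: wp_conseq.
  apply: (@interp_spec w M inp m (nth 0 inp) read_input d X (n * X) d.+1) => //.
  - move=> f' tp' fd f5; apply: wp_input; first by rewrite si.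
    by split=> //; eexists; split; [reflexivity| |by frame_tac].
  - by lia.
  - by move=> i hi; rewrite hm; move/allP: dg; apply; rewrite mem_nth // sg.
move=> t _ [ht [f' [-> e16 fr]]].
have e9 : f' 9 = 0 by rewrite (fr 9).
have hlt : f' 16 < 2 ^ w.
  rewrite e16 /graph_output hm; case: (ltnP ((iter X (node_step (fun i => m (d.+1 + i))
    (nth 0 inp) d) (0, 0, 0)).1.1 * 4 + 1) (size g)) => h.
    by apply: (@ltn_trans (n * X)); [move/allP: dg; apply; rewrite mem_nth | lia].
  by rewrite nth_default //; lia.
op_step binop_add; first by rewrite e9; lia.
apply: wp_skip; split; first by lia.
  by [].
rewrite /= e9 addn0 e16; congr graph_output.
by apply: funext => i; rewrite hm.
Qed.

(** * Strategies *)

(* [Clock] compares the number of steps made so far and [Test] the counter with a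
   constant, going to the second subtree if it is smaller; [Test] resets the
   counter.  A strategy is stored with one node per distinct subtree. *)
Inductive strat :=
  | Halt of nat
  | Read of nat & strat & strat
  | Clock of nat & strat & strat
  | Test of nat & strat & strat
  | Count of strat.

(** Classical decidable equality lets [index] number the nodes, identifying equal subtrees. *)
HB.instance Definition _ := gen_eqMixin strat.

Definition kind (T : strat) : nat :=
  match T with Halt _ => 0 | Read _ _ _ => 1 | Clock _ _ _ => 2 | Test _ _ _ => 3
  | Count _ => 4 end.

Definition arg (T : strat) : nat :=
  match T with Halt a | Read a _ _ | Clock a _ _ | Test a _ _ => a | Count _ => 0 end.

Definition next0 (T : strat) : strat :=
  match T with Halt _ => T | Read _ U _ | Clock _ U _ | Test _ U _ | Count U => U end.

Definition next1 (T : strat) : strat :=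
  match T with Halt _ => T | Read _ _ U | Clock _ _ U | Test _ _ U | Count U => U end.

Definition strat_step (q : nat -> nat) (s : strat * nat * nat) : strat * nat * nat :=
  let: (T, t, c) := s in
  match T with
  | Halt _ => (T, t.+1, c)
  | Read i U V => (if q i != 0 then V else U, t.+1, c)
  | Clock a U V => (if t < a then V else U, t.+1, c)
  | Test a U V => (if c < a then V else U, t.+1, 0)
  | Count U => (U, t.+1, c.+1)
  end.

Definition args_ok (d B : nat) (T : strat) : Prop :=
  arg T < B /\ (kind T == 1 -> arg T < d).

Definition closed_mod (d B : nat) (X : strat -> Prop) (l : seq strat) : Prop :=
  forall T, T \in l -> args_ok d B T /\
    forall U, U = next0 T \/ U = next1 T -> U \in l \/ X U.

Definition node_cells (l : seq strat) (T : strat) : seq nat :=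
  [:: kind T; arg T; index (next0 T) l; index (next1 T) l].

Definition encode_strats (l : seq strat) : seq nat := flatten [seq node_cells l T | T <- l].

Lemma nth_flatten4 (F : strat -> seq nat) l T0 i j : (forall T, size (F T) = 4) ->
  i < size l -> j < 4 ->
  nth 0 (flatten [seq F T | T <- l]) (i * 4 + j) = nth 0 (F (nth T0 l i)) j.
Proof.
move=> sF; elim: l i => // T l ih [|i] hi hj; first by rewrite [flatten _]/= nth_cat sF hj.
by rewrite [flatten _]/= mulSn -addnA nth_cat sF ltnNge leq_addr /= addKn ih.
Qed.

Lemma size_encode_strats l : size (encode_strats l) = size l * 4.
Proof.
rewrite /encode_strats; elim: {2 3}l => //= T l' ih.
by rewrite ih.
Qed.

Lemma step_encode l s d B q T t c : closed_mod d B (fun=> False) l -> T \in l ->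
  let g := nth 0 (encode_strats l ++ s) in
  let s' := strat_step q (T, t, c) in
  s'.1.1 \in l /\
  node_step g q d (index T l, t, c) = (index s'.1.1 l, s'.1.2, s'.2).
Proof.
move=> cl Tl g s'; have iT : index T l < size l by rewrite index_mem.
have hg j : j < 4 -> g (index T l * 4 + j) = nth 0 (node_cells l T) j.
  move=> hj; rewrite /g nth_cat size_encode_strats ifT; last by lia.
  by rewrite (nth_flatten4 T) // nth_index.
have [[_ hd] hn] := cl _ Tl.
have n0 : next0 T \in l by have [|] := hn _ (or_introl erefl).
have n1 : next1 T \in l by have [|] := hn _ (or_intror erefl).
rewrite /node_step -[X in g X]addn0 !hg // /s' => {s' hn cl Tl iT hg}.
case: T hd n0 n1 => [o|i U V|a U V|a U V|U] hd /= n0 n1; split => //.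
- by case: ifP.
- by rewrite modn_small ?hd //; case: ifP.
- by case: ifP.
- by case: ifP.
- by case: ifP.
- by case: ifP.
Qed.

Lemma iter_encode l s d B q T t c k : closed_mod d B (fun=> False) l -> T \in l ->
  let g := nth 0 (encode_strats l ++ s) in
  let s' := iter k (strat_step q) (T, t, c) in
  s'.1.1 \in l /\
  iter k (node_step g q d) (index T l, t, c) = (index s'.1.1 l, s'.1.2, s'.2).
Proof.
move=> cl Tl; elim: k => //= k [h1 h2]; rewrite h2.
case: (iter k _ _) h1 => -[T' t'] c' /= h1.
exact: (step_encode s q t' c' cl h1).
Qed.

Lemma iter_halt q k o t c :
  iter k (strat_step q) (Halt o, t, c) = (Halt o, t + k, c).
Proof. by elim: k => [|k /= ->]; rewrite ?addn0 //= addnS. Qed.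

Lemma graph_of_strats n d X root l : root \in l -> closed_mod d (n * X) (fun=> False) l ->
  size l < n * X -> 4 < n * X ->
  exists2 g, graph_shape n X g & forall q o k t c, k <= X ->
    iter k (strat_step q) (root, 0, 0) = (Halt o, t, c) ->
    graph_output (nth 0 g) q d X = o.
Proof.
move=> rl cl0 sl nX.
have cl : closed_mod d (n * X) (fun=> False) (root :: l).
  move=> T; rewrite inE => hT; have {}hT : T \in l by case/orP: hT => // /eqP ->.
  have [h1 h2] := cl0 _ hT; split => // U hU; left.
  by rewrite inE; have [->|] := h2 _ hU; rewrite ?orbT.
(* Execution starts at node 0, so the root is placed in front; its second occurrence is harmless
   because [index] returns the first. Zeros pad the graph to exactly [n * X] nodes. *)
set L := root :: l in cl; set z := nseq (n * X * 4 - size L * 4) 0.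
exists (encode_strats L ++ z).
  split; first by rewrite size_cat size_encode_strats size_nseq subnKC // leq_mul2r.
  rewrite all_cat all_nseq (ltn_trans _ nX) // orbT andbT.
  apply/allP => v /flattenP[r /mapP[T TL ->]].
  have [[aT _] hn] := cl _ TL.
  have h0 : next0 T \in L by have [|] := hn _ (or_introl erefl).
  have h1 : next1 T \in L by have [|] := hn _ (or_intror erefl).
  rewrite -index_mem in h0; rewrite -index_mem in h1.
  rewrite !inE => /or4P[] /eqP -> //.
  - by apply: leq_ltn_trans nX; case: (T).
  - exact: leq_trans h0 sl.
  - exact: leq_trans h1 sl.
move=> q o k t c kX e; have rL : root \in L by rewrite inE eqxx.
rewrite /graph_output -[X in iter X _ _](subnK kX).
have eS : iter (X - k + k) (strat_step q) (root, 0, 0) = (Halt o, t + (X - k), c).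
  by rewrite iterD e iter_halt.
have [hL eN] := @iter_encode L z d _ q root 0 0 (X - k + k) cl rL.
have e0 : index root L = 0 by rewrite /= eqxx.
rewrite e0 eS in eN; rewrite eS in hL; rewrite eN => {eN eS}.
change ((Halt o, t + (X - k), c).1.1) with (Halt o) in hL |- *.
change ((index (Halt o) L, (Halt o, t + (X - k), c).1.2, (Halt o, t + (X - k), c).2).1.1)
  with (index (Halt o) L).
rewrite nth_cat size_encode_strats ifT; last first.
  by move: hL; rewrite -index_mem; move: (index _ _) (size L) => i s; lia.
by rewrite (nth_flatten4 root) ?nth_index // index_mem.
Qed.

(** * Node counts relative to shared continuations *)

Section Within.
Variables (d B : nat).
Implicit Types (X Y Z : strat -> Prop).

(** The exits [X] come for free. Composition by [within_trans] therefore adds sizes, whereas a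
    strategy unfolded as a tree would repeat a continuation in every branch that leads to it. *)
Definition within N X Y : Prop :=
  exists2 l, size l <= N & (forall T, Y T -> T \in l \/ X T) /\ closed_mod d B X l.

Lemma within_sub N N' X X' Y Y' : N <= N' -> (forall T, X T -> X' T) ->
  (forall T, Y' T -> Y T) -> within N X Y -> within N' X' Y'.
Proof.
move=> NN XX YY [l sl [h1 h2]]; exists l; first exact: leq_trans NN.
split=> [T /YY /h1[->|/XX]|T /h2[h3 h4]]; [by left|by right|split=> // U /h4[->|/XX]].
  by left.
by right.
Qed.

Lemma within_trans N1 N2 X Y Z : within N1 X Y -> within N2 Y Z -> within (N1 + N2) X Z.
Proof.
move=> [l1 s1 [h1 h2]] [l2 s2 [h3 h4]]; exists (l1 ++ l2).
  by rewrite size_cat leq_add.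
split=> [T /h3[hT|/h1[hT|hT]]|T]; rewrite ?mem_cat ?hT ?orbT; auto.
case/orP => [/h2|/h4] [a b]; split => // U /b.
  by case=> [hU|hU]; [left; rewrite mem_cat hU | right].
by case=> [hU|/h1[hU|hU]]; [left; rewrite mem_cat hU orbT|left; rewrite mem_cat hU|right].
Qed.

Lemma within_or N1 N2 X Y Z :
  within N1 X Y -> within N2 X Z -> within (N1 + N2) X (fun T => Y T \/ Z T).
Proof.
move=> [l1 s1 [h1 h2]] [l2 s2 [h3 h4]]; exists (l1 ++ l2).
  by rewrite size_cat leq_add.
split=> [T [/h1|/h3] [hT|hT]|T]; rewrite ?mem_cat ?hT ?orbT; auto.
case/orP => [/h2|/h4] [a b]; split => // U /b [hU|hU]; rewrite ?mem_cat ?hU ?orbT; auto.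
Qed.

Lemma within0 X : within 0 X X.
Proof. by exists [::] => //; split => // T; right. Qed.

Lemma within_ext N X Y : within N X Y -> within N X (fun T => X T \/ Y T).
Proof. by move=> h; apply: within_sub (within_or (within0 X) h). Qed.

Lemma within_big n N X (F : 'I_n -> strat) :
  (forall i, within N X (eq (F i))) -> within (n * N) X (fun T => exists i, T = F i).
Proof.
move=> h; suff: within (size (enum 'I_n) * N) X (fun T => exists2 i, i \in enum 'I_n & T = F i).
  rewrite size_enum_ord; apply: within_sub => // T [i ->]; exists i => //.
  by rewrite mem_enum.
elim: (enum 'I_n) => [|i s ih]; first by exists [::] => //; split => // T [].
rewrite mulSn; apply: within_sub (within_or (h i) ih) => // T [j].
by rewrite inE => /orP[/eqP -> ->|hj ->]; [left|right; exists j].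
Qed.

Lemma within_node N X T : args_ok d B T ->
  within N X (fun U => U = next0 T \/ U = next1 T) -> within N.+1 X (eq T).
Proof.
move=> aT [l sl [h1 h2]]; exists (T :: l) => //.
split=> [U <-|U]; first by left; rewrite inE eqxx.
rewrite inE => /orP[/eqP ->|Ul].
  by split => // V /h1[]; [left; rewrite inE; apply/orP; right|right].
have [h3 h4] := h2 _ Ul; split => // V /h4[]; last by right.
by left; rewrite inE; apply/orP; right.
Qed.

End Within.

(** * Distance tests and hash tables as strategies *)

Definition qbits (d : nat) (q : hcube d) : nat -> nat := nth 0 (encode_point q).

Lemma qbits_ord d (q : hcube d) (j : 'I_d) : qbits q j = tnth q j.
Proof.
by rewrite /qbits /encode_point (nth_map false) ?size_tuple // -tnth_nth.
Qed.

(** The counter is 0 at both ends: only chains use it, and their closing [Test] resets it. This is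
    what lets blocks be composed by time alone. *)
Definition reach (d : nat) (q : hcube d) (T : strat) (t : nat) (U : strat) (t' : nat) :=
  exists k, iter k (strat_step (qbits q)) (T, t, 0) = (U, t', 0).

Lemma reach_refl d (q : hcube d) T t : reach q T t T t.
Proof. by exists 0. Qed.

Lemma reach_trans d (q : hcube d) T t U t' V t'' :
  reach q T t U t' -> reach q U t' V t'' -> reach q T t V t''.
Proof. by move=> [k1 e1] [k2 e2]; exists (k2 + k1); rewrite iterD e1. Qed.

Lemma reach1 d (q : hcube d) T t U t' :
  strat_step (qbits q) (T, t, 0) = (U, t', 0) -> reach q T t U t'.
Proof. by move=> e; exists 1. Qed.

Definition diffs (d : nat) (J : seq 'I_d) (p q : hcube d) : nat :=
  count (fun j => tnth p j != tnth q j) J.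

Lemma diffs_le d (J : seq 'I_d) p q : diffs J p q <= size J.
Proof. exact: count_size. Qed.

(** The counter of the machine keeps this test linear in the sample; a plain branching program would
    have a node for each pair of a position and a count. *)
Fixpoint chain (d : nat) (J : seq 'I_d) (p : hcube d) (th : nat) (kp kf : strat) : strat :=
  if J is j :: J' then
    let r := chain J' p th kp kf in
    if tnth p j then Read j (Count r) r else Read j r (Count r)
  else Test th kf kp.

Lemma chain_run d (J : seq 'I_d) p th kp kf q t c :
  iter (size J + diffs J p q + 1) (strat_step (qbits q)) (chain J p th kp kf, t, c) =
  (if c + diffs J p q < th then kp else kf, t + (size J + diffs J p q + 1), 0).
Proof.
elim: J t c => [|j J ih] t c; first by rewrite /diffs /= !addn0 !addn1.
have ed : diffs (j :: J) p q = (tnth p j != tnth q j) + diffs J p q by [].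
have -> : size (j :: J) + diffs (j :: J) p q + 1 =
    ((size J + diffs J p q + 1) + (tnth p j != tnth q j)).+1 by rewrite ed /=; lia.
rewrite iterSr; set r := chain J p th kp kf.
have -> : strat_step (qbits q) (chain (j :: J) p th kp kf, t, c) =
    (if tnth p j != tnth q j then Count r else r, t.+1, c).
  by rewrite /= -/r; case: (tnth p j); rewrite /= qbits_ord; case: (tnth q j).
rewrite iterD ed; case: (tnth p j != tnth q j) => /=; rewrite ih.
  by rewrite addSnnS; congr (_, _, _); lia.
by congr (_, _, _); lia.
Qed.

Lemma chain_reach d (J : seq 'I_d) p th kp kf q t : exists2 t',
  t < t' <= t + (2 * size J + 1) &
  reach q (chain J p th kp kf) t (if diffs J p q < th then kp else kf) t'.
Proof.
exists (t + (size J + diffs J p q + 1)); first by have := diffs_le J p q; lia.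
by exists (size J + diffs J p q + 1); rewrite chain_run.
Qed.

Lemma chain_within d B (J : seq 'I_d) p th kp kf : th < B -> d <= B ->
  within d B (2 * size J + 1) (fun T => T = kp \/ T = kf) (eq (chain J p th kp kf)).
Proof.
move=> tB dB; elim: J => [|j J ih].
  apply: (@within_node _ _ 0) => //.
  by apply: within_sub (within0 d B (fun T => T = kp \/ T = kf)) => // T /= [->|->]; [right|left].
have dj := ltn_ord j.
have -> : 2 * size (j :: J) + 1 = (2 * size J + 1).+2 by rewrite /=; lia.
set r := chain J p th kp kf in ih *.
have h2 : within d B (2 * size J + 1).+1 (fun T => T = kp \/ T = kf)
    (fun T => T = Count r \/ T = r).
  have [l sl [l1 l2]] := ih.
  exists (Count r :: l) => //; split=> [T [->|->]|T]; rewrite ?inE ?eqxx //; first by left.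
    by have [h|h] := l1 r erefl; [left; rewrite h orbT|right].
  case/orP => [/eqP ->|/l2[a b]].
    split; first by split => //=; apply: leq_ltn_trans tB.
    move=> U h; have -> : U = r by case: h.
    by have [h'|h'] := l1 r erefl; [left; rewrite inE h' orbT|right].
  by split => // U /b [h|h]; [left; rewrite inE h orbT|right].
rewrite [chain _ _ _ _ _]/= -/r; case: (tnth p j); apply: within_node;
  try (by split => //=; apply: leq_trans dB);
  by apply: within_sub h2 => // T /= [->|->]; auto.
Qed.

Section Tables.
Variables (n d : nat) (pt : 'I_n -> hcube d) (J0 : seq 'I_d) (th cut : nat).

Definition collide (J : seq 'I_d) (q : hcube d) (p : 'I_n) : bool :=
  all (fun j => tnth (pt p) j == tnth q j) J.

Section Cont.
Variable K : option 'I_n -> strat.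

Fixpoint cands (next : strat) (ps : seq 'I_n) : strat :=
  if ps is p :: ps' then
    Clock cut (K None) (chain J0 (pt p) th (K (Some p)) (cands next ps'))
  else next.

(** A hash table stored as a binary trie on the sampled bits. Leaving as soon as no point is left
    bounds it by [size ps * size J] read nodes instead of 2^[size J]. *)
Fixpoint walk (next : strat) (J : seq 'I_d) (ps : seq 'I_n) : strat :=
  if ps is [::] then next else
  if J is j :: J' then
    Read j (walk next J' [seq p <- ps | ~~ tnth (pt p) j])
           (walk next J' [seq p <- ps | tnth (pt p) j])
  else cands next ps.

Fixpoint tables (Js : seq (seq 'I_d)) : strat :=
  if Js is J :: Js' then walk (tables Js') J (enum 'I_n) else K None.

Definition passes (q : hcube d) (p : 'I_n) : bool := diffs J0 (pt p) q < th.

Lemma walk_reach q next J ps t : exists2 t', t' <= t + size J &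
  reach q (walk next J ps) t (cands next [seq p <- ps | collide J q p]) t'.
Proof.
elim: J ps t => [|j J ih] ps t.
  exists t; first by rewrite addn0.
  by rewrite filter_predT; case: ps => [|p ps]; apply: reach_refl.
case: ps => [|p0 ps0]; first by exists t; [exact: leq_addr | exact: reach_refl].
set ps := p0 :: ps0.
have ew : walk next (j :: J) ps = Read j (walk next J [seq p <- ps | ~~ tnth (pt p) j])
    (walk next J [seq p <- ps | tnth (pt p) j]) by [].
move: ps ew => ps ew.
have [t' ht' hr] := ih [seq p <- ps | tnth (pt p) j == tnth q j] t.+1.
exists t'; first by rewrite addnS -addSn.
have -> : [seq p <- ps | collide (j :: J) q p] =
    [seq p <- [seq p <- ps | tnth (pt p) j == tnth q j] | collide J q p].
  by rewrite -filter_predI; apply: eq_filter => p /=; rewrite andbC.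
apply: reach_trans hr; apply: reach1; rewrite ew /strat_step qbits_ord.
case: (tnth q j) => /=; congr (walk _ _ _, _, _); apply: eq_filter => p /=.
  by rewrite eqb_id.
by rewrite eqbF_neg.
Qed.

Local Notation s2 := (2 * size J0 + 2).

(** Three ways out: bucket exhausted, candidate accepted, clock expired. The clock is consulted
    before each candidate, so at most one chain runs past [cut]; an expired clock is charged to the
    rejected candidates. *)
Lemma cands_reach q next ps t : exists t' U, reach q (cands next ps) t U t' /\
  [\/ [/\ U = next, ~~ has (passes q) ps,
          t' <= t + count (predC (passes q)) ps * s2 & t' <= maxn t (cut + s2)],
      exists p, [/\ U = K (Some p), passes q p & t' <= maxn t (cut + s2)]
   |  [/\ U = K None, cut <= t + count (predC (passes q)) ps * s2
        & t' <= maxn t (cut + s2) + 1]].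
Proof.
elim: ps t => [|p ps ih] t.
  exists t, next; split; first exact: reach_refl.
  by apply: Or31; rewrite /= addn0 leq_maxl.
case: (ltnP t cut) => tc; last first.
  exists t.+1, (K None); split; first by apply: reach1; rewrite /= ltnNge tc.
  by apply: Or33; split => //; lia.
have st : reach q (cands next (p :: ps)) t
    (chain J0 (pt p) th (K (Some p)) (cands next ps)) t.+1.
  by apply: reach1; rewrite /= tc.
have [t1 ht1 hr1] := chain_reach J0 (pt p) th (K (Some p)) (cands next ps) q t.+1.
have {st hr1} := reach_trans st hr1; rewrite -/(passes q p); case: ifP => hp hr1.
  by exists t1, (K (Some p)); split => //; apply: Or32; exists p; split => //; lia.
have [t2 [U [hr2 h]]] := ih t1.
exists t2, U; split; first exact: reach_trans hr1 hr2.
rewrite [count _ _]/= hp /= mulSn.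
case: h => [[-> h1 h2 h3]|[p' [-> h1 h2]]|[-> h1 h2]].
- by apply: Or31; split => //; lia.
- by apply: Or32; exists p'; split => //; lia.
- by apply: Or33; split => //; lia.
Qed.

Definition failures (q : hcube d) (Js : seq (seq 'I_d)) : nat :=
  \sum_(J <- Js) count (fun p => collide J q p && ~~ passes q p) (enum 'I_n).

Lemma tables_reach q k Js t : all (fun J => size J <= k) Js ->
  exists t' e, [/\ reach q (tables Js) t (K e) t',
    t' <= maxn t (cut + s2) + size Js * k + 1,
    forall p, e = Some p -> passes q p
  & e = None -> (exists2 J, J \in Js & exists2 p, collide J q p & passes q p) ->
    cut <= t + size Js * k + failures q Js * s2].
Proof.
elim: Js t => [|J Js ih] t.
  move=> _; exists t, None; split => //; first exact: reach_refl.
    by rewrite /=; lia.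
  by move=> _ [].
move=> /= /andP[sJ sJs].
have [t1 ht1 hr1] := walk_reach q (tables Js) J (enum 'I_n) t.
have [t2 [U [hr2 h]]] := cands_reach q (tables Js)
  [seq p <- enum 'I_n | collide J q p] t1.
have hr := reach_trans hr1 hr2.
rewrite /failures big_cons -/(failures q Js) mulSn mulnDl.
have ec : count (predC (passes q)) [seq p <- enum 'I_n | collide J q p] =
   count (fun p => collide J q p && ~~ passes q p) (enum 'I_n).
  by rewrite count_filter; apply: eq_count => p /=; rewrite andbC.
rewrite ec in h.
case: h => [[eU h1 h2 h3]|[p [eU h1 h2]]|[eU h1 h2]].
- have [t3 [e [hr3 h4 h5 h6]]] := ih t2 sJs.
  exists t3, e; split => //; first by rewrite eU in hr; apply: reach_trans hr hr3.
    by lia.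
  move=> eN [J' hJ' [p cp pp]].
  have : cut <= t2 + size Js * k + failures q Js * s2.
    apply: h6 => //; move: hJ'; rewrite inE => /orP[/eqP eJ|hJ']; last by exists J' => //; exists p.
    exfalso; move/hasP: h1; apply; exists p => //.
    by rewrite mem_filter -eJ cp mem_enum.
  by lia.
- exists t2, (Some p); rewrite -eU; split => //; last by move=> p' [<-].
  by lia.
- exists t2, None; rewrite -eU; split => //; lia.
Qed.

Lemma cands_within B next ps : cut < B -> th < B -> d <= B ->
  within d B (size ps * s2) (fun T => (exists e, T = K e) \/ T = next) (eq (cands next ps)).
Proof.
move=> cB tB dB; elim: ps => [|p ps ih].
  by apply: within_sub (within0 d B (fun T => (exists e, T = K e) \/ T = next)) => // T <-; right.
have -> : size (p :: ps) * s2 = (size ps * s2 + (2 * size J0 + 1)).+1 by rewrite /=; lia.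
apply: within_node => //.
have hc := chain_within J0 (pt p) (K (Some p)) (cands next ps) tB dB.
have {}hc : within d B (2 * size J0 + 1) (fun T => ((exists e, T = K e) \/ T = next) \/
    cands next ps = T) (eq (chain J0 (pt p) th (K (Some p)) (cands next ps))).
  apply: within_sub hc => // T [->|->]; last by right.
  by left; left; exists (Some p).
apply: within_sub (within_trans (within_ext ih) (within_ext hc)) => // T /= [->|->].
  by left; left; left; exists None.
by right.
Qed.

Lemma walk_within B next J ps : cut < B -> th < B -> d <= B ->
  within d B (size ps * (size J + s2)) (fun T => (exists e, T = K e) \/ T = next)
    (eq (walk next J ps)).
Proof.
move=> cB tB dB; elim: J ps => [|j J ih] ps.
  by case: ps => [|p ps]; rewrite ?add0n; apply: cands_within.
case: ps => [|p0 ps0].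
  by apply: within_sub (within0 d B (fun T => (exists e, T = K e) \/ T = next)) => // T <-; right.
set ps := p0 :: ps0; have dj := ltn_ord j.
have h : within d B (size [seq p <- ps | ~~ tnth (pt p) j] * (size J + s2) +
    size [seq p <- ps | tnth (pt p) j] * (size J + s2)).+1
    (fun T => (exists e, T = K e) \/ T = next) (eq (walk next (j :: J) ps)).
  apply: within_node; first by split=> //=; apply: leq_trans dB.
  apply: within_sub (within_or (ih _) (ih _)) => // T [->|->]; [by left|by right].
apply: within_sub h => //; rewrite -mulnDl !size_filter addnC count_predC /=; lia.
Qed.

Lemma tables_within B k Js : cut < B -> th < B -> d <= B ->
  all (fun J => size J <= k) Js ->
  within d B (size Js * (n * (k + s2))) (fun T => exists e, T = K e) (eq (tables Js)).
Proof.
move=> cB tB dB; elim: Js => [|J Js ih] /=.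
  by move=> _; apply: within_sub (within0 d B (fun T => exists e, T = K e)) => // T <-; exists None.
move=> /andP[sJ /ih {}ih]; rewrite mulSn addnC.
have hw := walk_within (tables Js) J (enum 'I_n) cB tB dB.
apply: within_trans (within_ext ih) _; apply: within_sub hw => //.
- by rewrite size_enum_ord leq_mul2l leq_add2r sJ orbT.
- by move=> T [[e ->]|->]; [left; exists e|right].
Qed.

End Cont.
End Tables.

Lemma reach_time d (q : hcube d) T t U t' : reach q T t U t' ->
  exists2 k, t' = t + k & iter k (strat_step (qbits q)) (T, t, 0) = (U, t', 0).
Proof.
have tm j s0 : (iter j (strat_step (qbits q)) s0).1.2 = s0.1.2 + j.
  elim: j => [|j ih]; first by rewrite addn0.
  by rewrite iterS addnS -ih; case: (iter j _ s0) => -[[]].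
by move=> [k ek]; exists k => //; have := tm k (T, t, 0); rewrite ek.
Qed.

(** * Procedures with deadlines and their combination *)

Section Procedures.
Variables (n d B : nat) (pt : 'I_n -> hcube d).

(* A procedure, given its continuations, is entered at time at most [t0] and left
   at time at most [t1]; on a query of [G] it proposes a point that satisfies
   [near]. *)
Definition proc_ok (V t0 t1 : nat) (near : hcube d -> 'I_n -> Prop)
    (G : hcube d -> Prop) (P : (option 'I_n -> strat) -> strat) : Prop :=
  (forall K, within d B V (fun T => exists e, T = K e) (eq (P K))) /\
  forall K q t, t <= t0 -> exists t' e, [/\ reach q (P K) t (K e) t', t' <= t1
    & G q -> exists2 p, e = Some p & near q p].

Lemma proc_tables k s L Nc t0 (J0 : seq 'I_d) th Js near (G : hcube d -> Prop) :
  size J0 = s -> size Js = L -> all (fun J => size J <= k) Js -> th < B -> d <= B ->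
  t0 + L * k + Nc * (2 * s + 2) + 1 < B ->
  (forall q p, G q -> passes pt J0 th q p -> near q p) ->
  (forall q, G q -> (exists2 J, J \in Js & exists2 p, collide pt J q p & passes pt J0 th q p)
     /\ failures pt J0 th q Js <= Nc) ->
  exists P, proc_ok (L * (n * (k + (2 * s + 2)))) t0
    (t0 + 2 * (L * k) + Nc.+1 * (2 * s + 2) + 2) near G P.
Proof.
move=> sJ sJs kJs tB dB cB near_pass succ.
(* One more than the time spent on all keys and on [Nc] rejected candidates, so on [G] the clock
   cannot expire first. *)
set cut := t0 + L * k + Nc * (2 * s + 2) + 1 in cB.
exists (fun K => tables pt J0 th cut K Js); split=> [K|K q t tt0].
  by rewrite -sJs -sJ; apply: tables_within.
have [t' [e [h1 h2 h3 h4]]] := tables_reach pt J0 th cut K q t kJs.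
exists t', e; split => //.
  by rewrite sJs sJ /cut in h2; lia.
move=> Gq; have [hs hf] := succ q Gq.
case: e h1 h3 h4 => [p|] _ h3 h4; first by exists p => //; apply: near_pass (h3 p erefl).
have := h4 erefl hs; rewrite sJs sJ /cut.
have : failures pt J0 th q Js * (2 * s + 2) <= Nc * (2 * s + 2) by rewrite leq_mul2r hf orbT.
lia.
Qed.

(** Each proposal is filtered by the same test: a rejected or missing proposal of [P1] leads to
    [P2], one of [P2] leads to no proposal. [G3] is the set of queries on which the test judges all
    points rightly; there a success of either procedure survives, and a wrong proposal of [P1]
    cannot block [P2]. The relation weakens from [near1] to [near2], the gap of the test. *)
Lemma proc_combine V s t0 t1 t2 t3 J th near1 near2 G1 G2 (G3 : hcube d -> Prop) P1 P2 :
  size J = s -> th < B -> d <= B -> t1 + (2 * s + 1) <= t2 ->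
  proc_ok V t0 t1 near1 G1 P1 -> proc_ok V t2 t3 near1 G2 P2 ->
  (forall q p, G3 q -> near1 q p -> diffs J (pt p) q < th) ->
  (forall q p, G3 q -> diffs J (pt p) q < th -> near2 q p) ->
  exists P, proc_ok (2 * V + 2 * (n * (2 * s + 1))) t0 (t3 + (2 * s + 1)) near2
    (fun q => (G1 q \/ G2 q) /\ G3 q) P.
Proof.
move=> sJ tB dB t12 [w1 r1] [w2 r2] g31 g32.
pose K2 (K : option 'I_n -> strat) e :=
  if e is Some p then chain J (pt p) th (K (Some p)) (K None) else K None.
pose K1 K e :=
  if e is Some p then chain J (pt p) th (K (Some p)) (P2 (K2 K)) else P2 (K2 K).
exists (fun K => P1 (K1 K)); split=> [K|K q t tt0].
  set R := fun T => exists e, T = K e.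
  have c2 : within d B (n * (2 * s + 1)) R (fun T => exists p, T = K2 K (Some p)).
    apply: within_big => p; rewrite -sJ.
    apply: within_sub (chain_within J (pt p) (K (Some p)) (K None) tB dB) => //.
    by move=> T [->|->]; [exists (Some p)|exists None].
  have p2 : within d B (n * (2 * s + 1) + V) R (fun T => R T \/ P2 (K2 K) = T).
    apply: within_ext; apply: within_trans (within_ext c2) _.
    apply: within_sub (w2 (K2 K)) => // T [[p|] ->]; first by right; exists p.
    by left; exists None.
  have c1 : within d B (n * (2 * s + 1)) (fun T => R T \/ P2 (K2 K) = T)
      (fun T => exists p, T = K1 K (Some p)).
    apply: within_big => p; rewrite -sJ.
    apply: within_sub (chain_within J (pt p) (K (Some p)) (P2 (K2 K)) tB dB) => //.
    by move=> T [->|->]; [left; exists (Some p)|right].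
  have -> : 2 * V + 2 * (n * (2 * s + 1)) =
    n * (2 * s + 1) + V + n * (2 * s + 1) + V by lia.
  apply: within_trans (within_trans p2 (within_ext c1)) _.
  apply: within_sub (w1 (K1 K)) => // T [[p|] ->]; first by right; exists p.
  by left; right.
have run2 t' : t' <= t2 -> exists t'' e, [/\ reach q (P2 (K2 K)) t' (K e) t'',
    t'' <= t3 + (2 * s + 1) & G2 q /\ G3 q -> exists2 p, e = Some p & near2 q p].
  move=> tt2; have [t'' [e [h1 h2 h3]]] := r2 (K2 K) q t' tt2.
  case: e h1 h3 => [p|] h1 h3; last first.
    exists t'', None; split => //; first by lia.
    by move=> [Gq _]; have [] := h3 Gq.
  have [t4 ht4 hr4] := chain_reach J (pt p) th (K (Some p)) (K None) q t''.
  have hr := reach_trans h1 hr4; rewrite sJ in ht4.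
  case: ifP hr => hp hr.
    exists t4, (Some p); split => //; first by lia.
    by move=> [_ g3]; exists p => //; apply: g32.
  exists t4, None; split => //; first by lia.
  by move=> [/h3[p' [<-] np] g3]; rewrite g31 in hp.
have [t' [e [h1 h2 h3]]] := r1 (K1 K) q t tt0.
case: e h1 h3 => [p|] h1 h3; last first.
  have t'2 : t' <= t2 by lia.
  have [t'' [e [h4 h5 h6]]] := run2 t' t'2.
  exists t'', e; split => //; first exact: reach_trans h1 h4.
  by move=> [[/h3[]//|g2] g3]; apply: h6.
have [t4 ht4 hr4] := chain_reach J (pt p) th (K (Some p)) (P2 (K2 K)) q t'.
have hr := reach_trans h1 hr4; rewrite sJ in ht4.
have t42 : t4 <= t2 by lia.
case: ifP hr => hp hr.
  (* The deadline for [t4] comes from a hypothetical run of [P2] started at [t4]: it would end in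
     time, and time never decreases. *)
  have [t5 [e [h4 h5 _]]] := run2 t4 t42.
  exists t4, (Some p); split => //; last by move=> [_ g3]; exists p => //; apply: g32.
  have [k hk _] := reach_time h4.
  by lia.
have [t'' [e [h4 h5 h6]]] := run2 t4 t42.
exists t'', e; split => //; first exact: reach_trans hr h4.
move=> [[/h3[p' [<-] np]|g2] g3]; last exact: h6.
by rewrite g31 in hp.
Qed.

End Procedures.

Lemma diffs_enum d (p q : hcube d) : diffs (enum 'I_d) p q = hamming p q.
Proof. by rewrite /diffs /hamming cardE [in RHS]/enum_mem size_filter -enumT; apply: eq_count. Qed.

Lemma graph_of_proc n d (pt : 'I_n -> hcube d) V T0 X b near G P : 0 < n -> 0 < d ->
  proc_ok (n * X) V 0 T0 near G P ->
  V + n * (2 * d + 1) + n + 1 < n * X -> T0 + (2 * d + 1) <= X -> d <= n * X ->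
  b < n * X -> (forall q p, G q -> near q p -> hamming (pt p) q < b) ->
  exists2 g, graph_shape n X g & forall q : hcube d,
    let v := graph_output (nth 0 g) (qbits q) d X in
    (v = 0 /\ ~ G q) \/ exists2 p : 'I_n, v = p.+1 & hamming (pt p) q < b.
Proof.
move=> n0 d0 [wP rP] hV hX dX bX nearb.
pose K e := if e is Some p then chain (enum 'I_d) (pt p) b (Halt p.+1) (Halt 0) else Halt 0.
set Bd := n * X.
(* One output node per point and one for ⊥, then [n] tests on all [d] coordinates, then the
   procedure. *)
have [l sl [l1 l2]] : within d Bd (n * 1 + 1 + n * (2 * d + 1) + V) (fun=> False) (eq (P K)).
  have hh o : o < Bd -> within d Bd 1 (fun=> False) (eq (Halt o)).
    move=> oB; exists [:: Halt o] => //; split=> [T <-|T]; first by left; rewrite inE.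
    by rewrite inE => /eqP ->; split => // U [] ->; left; rewrite inE.
  have h1 : within d Bd (n * 1 + 1) (fun=> False)
      (fun T => (exists p : 'I_n, T = Halt p.+1) \/ Halt 0 = T).
    apply: within_or; last by apply: hh; lia.
    by apply: within_big => p; apply: within_sub (hh p.+1 _) => //; have := ltn_ord p; rewrite /Bd; lia.
  have h2 : within d Bd (n * (2 * d + 1))
      (fun T => (exists p : 'I_n, T = Halt p.+1) \/ Halt 0 = T)
      (fun T => exists p, T = K (Some p)).
    apply: within_big => p; have := chain_within (enum 'I_d) (pt p) (Halt p.+1) (Halt 0) bX dX.
    rewrite size_enum_ord; apply: within_sub => // T [->|->]; [by left; exists p|by right].
  apply: within_trans (within_trans h1 (within_ext h2)) _.
  apply: within_sub (wP K) => // T [[p|] ->]; first by right; exists p.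
  by left; right.
have rl : P K \in l by have [|[]] := l1 _ erefl.
have sl' : size l < n * X by rewrite muln1 in sl; apply: leq_ltn_trans hV; lia.
have nX4 : 4 < n * X by have := leq_pmulr (2 * d + 1) n0; lia.
have [g gs gP] := graph_of_strats rl l2 sl' nX4.
exists g => // q v; rewrite /v.
have [t' [e [h1 h2 h3]]] := rP K q 0 (leq0n _).
suff [o [t'' [ht'' hr ho]]] : exists o t'', [/\ t'' <= X, reach q (P K) 0 (Halt o) t''
    & (o = 0 /\ ~ G q) \/ exists2 p : 'I_n, o = p.+1 & hamming (pt p) q < b].
  have [k ek it] := reach_time hr.
  by rewrite (gP _ o k t'' 0) //; lia.
case: e h1 h3 => [p|] h1 h3; last first.
  exists 0, t'; split => //; first by lia.
  by left; split => // /h3[].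
have [t4 ht4 hr4] := chain_reach (enum 'I_d) (pt p) b (Halt p.+1) (Halt 0) q t'.
have hr := reach_trans h1 hr4; rewrite size_enum_ord in ht4; rewrite diffs_enum in hr.
exists (if hamming (pt p) q < b then p.+1 else 0), t4; split; first by lia.
  by case: ifP hr.
case: ifP => hb; first by right; exists p.
by left; split => // Gq; have [p' [ep] np] := h3 Gq; rewrite -ep in np; rewrite (nearb q p) in hb.
Qed.

Local Open Scope ring_scope.

(** * Averages *)

Section Mean.
Variable R : realType.

Definition mean (T : finType) (f : T -> R) : R := (\sum_x f x) / #|T|%:R.

Lemma mean_le (T : finType) (f g : T -> R) : (forall x, f x <= g x) -> mean f <= mean g.
Proof.
by move=> h; rewrite /mean ler_wpM2r ?invr_ge0 // ler_sum.
Qed.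

Lemma eq_mean (T : finType) (f g : T -> R) : f =1 g -> mean f = mean g.
Proof. by move=> h; rewrite /mean; congr (_ / _); apply: eq_bigr. Qed.

Lemma mean_sum (T I : finType) (A : {pred I}) (F : I -> T -> R) :
  mean (fun x => \sum_(i in A) F i x) = \sum_(i in A) mean (F i).
Proof. by rewrite /mean exchange_big /= mulr_suml. Qed.

Lemma meanD (T : finType) (f g : T -> R) : mean (fun x => f x + g x) = mean f + mean g.
Proof. by rewrite /mean big_split mulrDl. Qed.

Lemma meanZ (T : finType) c (f : T -> R) : mean (fun x => c * f x) = c * mean f.
Proof. by rewrite /mean -mulr_sumr mulrA. Qed.

Lemma mean_cst (T : finType) c : (0 < #|T|)%N -> mean (fun _ : T => c) = c.
Proof.
move=> T0; rewrite /mean; have -> : \sum_(x : T) c = #|T|%:R * c by rewrite sumr_const mulr_natl.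
by rewrite mulrAC divff ?mul1r // pnatr_eq0 -lt0n.
Qed.

(** First-moment argument by which every random sample of the construction is fixed. *)
Lemma exists_le_mean (T : finType) (f : T -> R) : (0 < #|T|)%N -> exists x, f x <= mean f.
Proof.
move=> T0; apply: contrapT => h.
have h' x : mean f < f x by rewrite ltNge; apply/negP => hx; apply: h; exists x.
have /card_gt0P[x0 _] := T0.
have : mean (fun _ : T => mean f) < mean f.
  rewrite {1 3}/mean ltr_pM2r ?invr_gt0 ?ltr0n //.
  by apply: ltr_sum => [|x _]; [apply/hasP; exists x0 => //; rewrite mem_index_enum|].
by rewrite mean_cst // ltxx.
Qed.

(** Independence of the coordinates of a uniform function, that is, the expansion of a product of
    sums. *)
Lemma mean_prod (I T : finType) (g : I -> T -> R) :
  mean (fun f : {ffun I -> T} => \prod_i g i (f i)) = \prod_i mean (g i).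
Proof.
rewrite /mean -(bigA_distr_bigA g) /= prodf_div card_ffun; congr (_ / _).
by rewrite prodr_const natrX.
Qed.

Lemma mean_marginal (I T : finType) (i : I) (g : T -> R) : (0 < #|T|)%N ->
  mean (fun f : {ffun I -> T} => g (f i)) = mean g.
Proof.
move=> T0.
have := mean_prod (fun j x => if j == i then g x else 1).
rewrite (eq_mean (g := fun f : {ffun I -> T} => g (f i))); last first.
  by move=> f; rewrite (bigD1 i) //= eqxx big1 ?mulr1 // => j /negbTE ->.
move=> ->; rewrite (bigD1 i) //= eqxx big1 ?mulr1 // => j /negbTE ->.
by rewrite mean_cst.
Qed.

End Mean.

(** * Sampling coordinates and exponential moments *)

Section Sampling.
Variables (R : realType) (d : nat).
Hypothesis d0 : (0 < d)%N.
Implicit Types (p q : hcube d).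

Let dR : 0 < d%:R :> R. Proof. by rewrite ltr0n. Qed.

Definition ffun_seq k (f : {ffun 'I_k -> 'I_d}) : seq 'I_d := [seq f i | i <- enum 'I_k].

Lemma size_ffun_seq k (f : {ffun 'I_k -> 'I_d}) : size (ffun_seq f) = k.
Proof. by rewrite size_map size_enum_ord. Qed.

Lemma mean_differ p q (x y : R) :
  mean (fun j : 'I_d => if tnth p j != tnth q j then x else y) =
  y + (x - y) * ((hamming p q)%:R / d%:R).
Proof.
rewrite /mean card_ord.
rewrite (eq_bigr (fun j => y + (x - y) * (tnth p j != tnth q j)%:R)); last first.
  by move=> j _; case: (_ != _) => /=; ring.
rewrite big_split /= sumr_const card_ord -mulr_sumr -natr_sum.
have -> : (\sum_i (tnth p i != tnth q i))%N = hamming p q.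
  by rewrite /hamming -sum1_card [RHS]big_mkcond /=; apply: eq_bigr => j _; rewrite inE; case: ifP.
by rewrite -mulr_natr; field; rewrite gt_eqF.
Qed.

Lemma hamming_le p q : (hamming p q <= d)%N.
Proof. by rewrite -[leqRHS]card_ord max_card. Qed.

Lemma diffs_ffun k (f : {ffun 'I_k -> 'I_d}) p q :
  diffs (ffun_seq f) p q = (\sum_i (tnth p (f i) != tnth q (f i)))%N.
Proof.
by rewrite /diffs /ffun_seq count_map -sum1_count big_mkcond /= big_enum.
Qed.

Lemma all_ffun_seq k (f : {ffun 'I_k -> 'I_d}) (P : pred 'I_d) :
  (all P (ffun_seq f))%:R = \prod_i (P (f i))%:R :> R.
Proof.
rewrite /ffun_seq all_map -[in RHS]big_enum /=; elim: (enum 'I_k) => [|i s ih] /=.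
  by rewrite big_nil.
by rewrite big_cons -ih; case: (P (f i)); rewrite ?mul1r ?mul0r.
Qed.

(** [expR z] is at most 1 / (1 - z), and (1 - z)(1 + z + 2z²) = 1 + z²(1 - 2z) is at least 1.
    Negative [z] is included, as the lower tail requires. *)
Lemma expR_le_quadratic (z : R) : z <= 2^-1 -> expR z <= 1 + z + 2 * z ^+ 2.
Proof.
move=> hz; have h1 : 1 - z <= expR (- z) by apply: expR_ge1Dx.
have h2 : 0 < 1 - z by lra.
have h3 : 0 < 1 + z + 2 * z ^+ 2 by rewrite expr2; nra.
have -> : expR z = (expR (- z))^-1 by rewrite expRN invrK.
rewrite -[leRHS]invrK lef_pV2 ?posrE ?expR_gt0 ?invr_gt0 //.
apply: le_trans h1; rewrite -[leLHS]div1r ler_pdivrMr //.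
have : z ^+ 2 * (1 - 2 * z) >= 0 by rewrite mulr_ge0 ?sqr_ge0 //; lra.
by rewrite expr2; nra.
Qed.

(* The exponential moment behind both Chernoff bounds ([z > 0] and [z < 0]). *)
Lemma mean_exp_diffs s p q (z x : R) : z <= 2^-1 ->
  mean (fun f : {ffun 'I_s -> 'I_d} => expR (z * ((diffs (ffun_seq f) p q)%:R - x))) <=
  expR ((z + 2 * z ^+ 2) * s%:R * ((hamming p q)%:R / d%:R) - z * x).
Proof.
move=> hz.
rewrite (eq_mean (g := fun f : {ffun 'I_s -> 'I_d} => expR (- (z * x)) *
    \prod_i (if tnth p (f i) != tnth q (f i) then expR z else 1))); last first.
  move=> f; rewrite diffs_ffun mulrBr addrC expRD; congr (_ * _).
  rewrite natr_sum mulr_sumr expR_sum; apply: eq_bigr => i _.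
  by case: (_ != _); rewrite ?mulr1 ?mulr0 ?expR0.
rewrite meanZ (mean_prod (fun _ j => if tnth p j != tnth q j then expR z else 1)).
rewrite prodr_const card_ord mean_differ.
rewrite [X in _ <= expR X]addrC [leRHS]expRD ler_wpM2l ?expR_ge0 //.
have hD : 0 <= (hamming p q)%:R / d%:R :> R by rewrite divr_ge0.
have hz2 := expR_le_quadratic hz.
rewrite [X in _ <= expR X](_ : _ = s%:R * ((z + 2 * z ^+ 2) * ((hamming p q)%:R / d%:R))); last by ring.
rewrite expRM_natl; apply: lerXn2r; rewrite ?nnegrE ?expR_ge0 //.
  have hD1 : (hamming p q)%:R / d%:R <= 1 :> R by rewrite ler_pdivrMr // mul1r ler_nat hamming_le.
  by have := expR_ge0 z; nra.
apply: le_trans (expR_ge1Dx _); rewrite lerD2l ler_wpM2r //.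
by lra.
Qed.

End Sampling.

(** * Existence of good tests and good tables *)

Section Exists.
Variables (R : realType) (n d : nat) (pt : 'I_n -> hcube d).
Hypothesis d0 : (0 < d)%N.
Implicit Types (Q : {set hcube d}).

Let dR : 0 < d%:R :> R. Proof. by rewrite ltr0n. Qed.

Lemma card_le_sum Q (P : pred (hcube d)) (F : hcube d -> R) :
  (forall q, q \in Q -> 0 <= F q) -> (forall q, q \in Q -> P q -> 1 <= F q) ->
  #|[set q in Q | P q]|%:R <= \sum_(q in Q) F q.
Proof.
move=> F0 F1; rewrite -sum1_card natr_sum.
rewrite (eq_bigl (fun q => (q \in Q) && P q)); last by move=> q; rewrite inE.
rewrite big_mkcondr /=; apply: ler_sum => q qQ; case: ifP => [hP|_]; first exact: F1.
exact: F0.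
Qed.

(** Chernoff with z = eta and z = -eta around the midpoint tau + 4·eta·b, scaled by s/d. On both
    sides the gain 4·eta²·b exceeds the quadratic loss, at most 2·eta²·b since the thresholds are
    below [b], by 2·eta²·b. The sum over the [n] points bounds the expected fraction of misjudged
    queries. *)
Lemma test_exists Q (tau eta b kap : R) s :
  0 <= eta <= 2^-1 -> 0 <= b -> 0 <= tau -> tau + 8 * eta * b <= b ->
  kap <= 2 * eta ^+ 2 * b * (s%:R / d%:R) ->
  exists J th (Bad : {set hcube d}), [/\ size J = s, (th <= s.+1)%N,
    #|Bad|%:R <= #|Q|%:R * (n%:R * expR (- kap))
    & forall q, q \in Q -> q \notin Bad -> forall p,
      ((hamming (pt p) q)%:R <= tau -> (diffs J (pt p) q < th)%N) /\
      ((diffs J (pt p) q < th)%N -> (hamming (pt p) q)%:R <= tau + 8 * eta * b)].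
Proof.
move=> /andP[e0 e2] b0 t0 tb hk.
have S0 : 0 <= s%:R / d%:R :> R by rewrite divr_ge0.
pose x : R := s%:R / d%:R * (tau + 4 * eta * b).
have eb : 0 <= eta * b by rewrite mulr_ge0.
have x0 : 0 <= x by rewrite mulr_ge0 //; lra.
pose wrong (f : {ffun 'I_s -> 'I_d}) q p :=
  let D := (hamming (pt p) q)%:R : R in
  let pass := (diffs (ffun_seq f) (pt p) q)%:R <= x in
  (D <= tau) && ~~ pass || (tau + 8 * eta * b < D) && pass.
have hmean q p : mean (fun f => (wrong f q p)%:R) <= expR (- kap).
  have DR : 0 <= (hamming (pt p) q)%:R :> R by [].
  case: (lerP (hamming (pt p) q)%:R tau) => hD.
    apply: (@le_trans _ _ (mean (fun f : {ffun 'I_s -> 'I_d} =>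
        expR (eta * ((diffs (ffun_seq f) (pt p) q)%:R - x))))).
      apply: mean_le => f; rewrite /wrong hD ltNge (le_trans hD) /=; last by lra.
      rewrite orbF; case: (lerP (diffs (ffun_seq f) (pt p) q)%:R x) => /= hx; first exact: expR_ge0.
      apply: le_trans (expR_ge1Dx _); rewrite lerDl mulr_ge0 //; lra.
    apply: le_trans (mean_exp_diffs d0 _ _ _ _ _) _; first by lra.
    rewrite ler_expR; apply: le_trans (_ : - (2 * eta ^+ 2 * b * (s%:R / d%:R)) <= _); last by lra.
    rewrite [X in X - _](_ : _ = (s%:R / d%:R) * ((eta + 2 * eta ^+ 2) * (hamming (pt p) q)%:R)); last by ring.
    rewrite /x; move: (s%:R / d%:R) S0 => S S0.
    suff : S * ((eta + 2 * eta ^+ 2) * (hamming (pt p) q)%:R) <= S * ((eta + 2 * eta ^+ 2) * tau).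
      suff : 0 <= S * (2 * eta ^+ 2 * (b - tau)) by lra.
      by rewrite !mulr_ge0 ?sqr_ge0 //; lra.
    by rewrite ler_wpM2l // ler_wpM2l // addr_ge0 // mulr_ge0 ?sqr_ge0.
  case: (lerP (hamming (pt p) q)%:R (tau + 8 * eta * b)) => hD2.
    apply: le_trans (expR_ge0 _); rewrite /mean big1 ?mul0r // => f _.
    by rewrite /wrong (lt_geF hD) (le_gtF hD2).
  apply: (@le_trans _ _ (mean (fun f : {ffun 'I_s -> 'I_d} =>
      expR (- eta * ((diffs (ffun_seq f) (pt p) q)%:R - x))))).
    apply: mean_le => f; rewrite /wrong (lt_geF hD) hD2 /=.
    case: (lerP (diffs (ffun_seq f) (pt p) q)%:R x) => /= hx; last exact: expR_ge0.
    apply: le_trans (expR_ge1Dx _); rewrite lerDl mulNr -mulrN mulr_ge0 //; lra.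
  apply: le_trans (mean_exp_diffs d0 _ _ _ _ _) _; first by lra.
  rewrite ler_expR; apply: le_trans (_ : - (2 * eta ^+ 2 * b * (s%:R / d%:R)) <= _); last by lra.
  rewrite [X in X - _](_ : _ = (s%:R / d%:R) * ((2 * eta ^+ 2 - eta) * (hamming (pt p) q)%:R)); last by ring.
  rewrite /x; move: (s%:R / d%:R) S0 => S S0.
  suff : S * ((2 * eta ^+ 2 - eta) * (hamming (pt p) q)%:R) <=
      S * ((2 * eta ^+ 2 - eta) * (tau + 8 * eta * b)).
    suff : 0 <= S * (2 * eta ^+ 2 * (b - (tau + 8 * eta * b))) by lra.
    by rewrite !mulr_ge0 ?sqr_ge0 //; lra.
  rewrite ler_wpM2l // ler_wnM2l //; last by apply: ltW.
  rewrite expr2; nra.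
have T0 : (0 < #|{ffun 'I_s -> 'I_d}|)%N by rewrite card_ffun !card_ord expn_gt0 d0.
have [f hf] := exists_le_mean (fun f => \sum_(q in Q) \sum_(p in 'I_n) (wrong f q p)%:R : R) T0.
(* [diffs < th] is equivalent to [diffs <= x]; the minimum with [s.+1] changes nothing for a sample
   of size [s] and makes [th] small enough for a cell. *)
exists (ffun_seq f), (minn s.+1 (Num.truncn x).+1), [set q in Q | [exists p, wrong f q p]].
split; [exact: size_ffun_seq | exact: geq_minl | |].
  apply: (le_trans (card_le_sum (F := fun q => \sum_(p in 'I_n) (wrong f q p)%:R) _ _)).
  - by move=> q _; apply: sumr_ge0.
  - move=> q _ /existsP[p hp]; rewrite (bigD1 p) //= hp lerDl; exact: sumr_ge0.
  apply: (le_trans hf); rewrite mean_sum.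
  rewrite (eq_bigr (fun q => \sum_(p in 'I_n) mean (fun f => (wrong f q p)%:R))); last first.
    by move=> q _; rewrite mean_sum.
  apply: (@le_trans _ _ (\sum_(q in Q) \sum_(p in 'I_n) expR (- kap))).
    by apply: ler_sum => q _; apply: ler_sum.
  by rewrite !sumr_const card_ord -[_ *+ #|Q|]mulr_natl -[_ *+ n]mulr_natl.
move=> q qQ; rewrite inE qQ /= negb_exists => /forallP hq p.
have -> : (diffs (ffun_seq f) (pt p) q < minn s.+1 (Num.truncn x).+1)%N =
    ((diffs (ffun_seq f) (pt p) q)%:R <= x).
  rewrite leq_min !ltnS truncn_ge_nat // -[X in (_ <= X)%N && _](size_ffun_seq f).
  by rewrite diffs_le.
have := hq p; rewrite /wrong negb_or !negb_and negbK -leNgt => /andP[h1 h2]; split.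
  by move=> h; rewrite h in h1.
by move=> h; rewrite h orbF in h2.
Qed.

Lemma mean_collide q p k :
  mean (fun f : {ffun 'I_k -> 'I_d} => (collide pt (ffun_seq f) q p)%:R) =
  (1 - (hamming (pt p) q)%:R / d%:R) ^+ k :> R.
Proof.
rewrite (eq_mean (g := fun f : {ffun 'I_k -> 'I_d} =>
   \prod_i (tnth (pt p) (f i) == tnth q (f i))%:R)); last first.
  by move=> f; rewrite /collide all_ffun_seq.
rewrite (mean_prod (fun _ j => (tnth (pt p) j == tnth q j)%:R)) prodr_const card_ord.
rewrite (eq_mean (g := fun j => if tnth (pt p) j != tnth q j then 0 else 1)); last first.
  by move=> j; case: (_ == _).
by rewrite mean_differ // sub0r mulN1r.
Qed.

(** The potential [miss + cost / (16 L)] has mean at most 1/16 + 1/16: all [L] tables miss with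
    probability at most exp(-4), below 2^-4, and each table has at most one far collision on
    average. Hence at most 1/8 of the queries reach potential 1. Below 1, the 0/1 quantity [miss]
    vanishes and [cost] is under [16 L]. *)
Lemma tables_exist Q (pstar : hcube d -> 'I_n) (a : R) (tau : R) k L :
  (forall q, q \in Q -> (hamming (pt (pstar q)) q)%:R <= a) -> a <= d%:R ->
  0 <= tau <= d%:R -> n%:R * (1 - tau / d%:R) ^+ k <= 1 ->
  4 <= L%:R * (1 - a / d%:R) ^+ k -> (0 < L)%N ->
  exists Js (Bad : {set hcube d}), [/\ size Js = L, all (fun J => size J <= k)%N Js,
    #|Bad|%:R <= #|Q|%:R / 8 :> R
    & forall q, q \in Q -> q \notin Bad ->
      (exists2 J, J \in Js & collide pt J q (pstar q)) /\
      (\sum_(J <- Js) count (fun p => collide pt J q p && (tau < (hamming (pt p) q)%:R)%R)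
        (enum 'I_n) <= 16 * L)%N].
Proof.
move=> hstar ad /andP[t0 td] hn hL L0.
have LR : 0 < L%:R :> R by rewrite ltr0n.
pose Om := {ffun 'I_L -> {ffun 'I_k -> 'I_d}}.
pose far q p := tau < (hamming (pt p) q)%:R.
pose miss (w : Om) q := \prod_i (1 - (collide pt (ffun_seq (w i)) q (pstar q))%:R) : R.
pose cost (w : Om) q := \sum_(i in 'I_L) \sum_(p in far q) (collide pt (ffun_seq (w i)) q p)%:R : R.
pose pot w q := miss w q + (16 * L%:R)^-1 * cost w q.
have cost0 w q : 0 <= cost w q by apply: sumr_ge0 => i _; apply: sumr_ge0.
have miss0 w q : 0 <= miss w q by apply: prodr_ge0 => i _; case: (collide _ _ _ _); rewrite ?subrr ?subr0.
have c16 : 0 <= (16 * L%:R)^-1 :> R by rewrite invr_ge0 mulr_ge0 // ltW.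
have T0 : (0 < #|{ffun 'I_k -> 'I_d}|)%N by rewrite card_ffun !card_ord expn_gt0 d0.
have T1 : (0 < #|{: Om}|)%N by rewrite card_ffun expn_gt0 T0.
have hmiss q : q \in Q -> mean (miss^~ q) <= 16^-1.
  move=> qQ; rewrite (mean_prod (fun _ f => 1 - (collide pt (ffun_seq f) q (pstar q))%:R)).
  rewrite prodr_const card_ord.
  have -> : mean (fun f : {ffun 'I_k -> 'I_d} =>
     1 - (collide pt (ffun_seq f) q (pstar q))%:R) =
     1 - (1 - (hamming (pt (pstar q)) q)%:R / d%:R) ^+ k :> R.
    rewrite (eq_mean (g := fun f : {ffun 'I_k -> 'I_d} => 1 + (-1) *
       (collide pt (ffun_seq f) q (pstar q))%:R)); last by move=> f; rewrite mulN1r.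
    by rewrite meanD meanZ mulN1r mean_cst // mean_collide.
  set y := (1 - _ / _) ^+ k.
  have y1 : (1 - a / d%:R) ^+ k <= y.
    have a1 : a / d%:R <= 1 by rewrite ler_pdivrMr // mul1r.
    have a2 : (hamming (pt (pstar q)) q)%:R / d%:R <= a / d%:R by rewrite ler_pM2r ?invr_gt0 // hstar.
    by apply: lerXn2r; rewrite ?nnegrE; lra.
  have y2 : y <= 1.
    have h0 : 0 <= (hamming (pt (pstar q)) q)%:R / d%:R :> R by rewrite divr_ge0.
    apply: exprn_ile1; last by lra.
    by rewrite subr_ge0 ler_pdivrMr // mul1r ler_nat hamming_le.
  apply: (@le_trans _ _ (expR (- y) ^+ L)).
    by apply: lerXn2r; rewrite ?nnegrE ?expR_ge0 ?subr_ge0 //; apply: expR_ge1Dx.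
  rewrite -expRM_natl mulrN expRN lef_pV2 ?posrE ?expR_gt0 //.
  have : 4 <= L%:R * y by apply: le_trans hL _; rewrite ler_pM2l.
  rewrite -(ler_expR (4 : R)); apply: le_trans.
  have -> : (4 : R) = 4%:R * 1 by rewrite mulr1.
  rewrite expRM_natl (_ : 16 = 2 ^+ 4 :> R); last by rewrite -natrX.
  apply: lerXn2r; rewrite ?nnegrE ?expR_ge0 //.
  by apply: le_trans (expR_ge1Dx _).
have hcost q : mean (cost^~ q) <= L%:R.
  rewrite mean_sum (eq_bigr (fun=> mean (fun f : {ffun 'I_k -> 'I_d} =>
     \sum_(p in far q) (collide pt (ffun_seq f) q p)%:R : R))); last first.
    move=> i _; exact: (mean_marginal i (fun f : {ffun 'I_k -> 'I_d} =>
     \sum_(p in far q) (collide pt (ffun_seq f) q p)%:R : R)).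
  rewrite sumr_const card_ord -[leLHS]mulr_natl -[leRHS]mulr1 ler_pM2l //.
  rewrite mean_sum; apply: le_trans hn.
  apply: (@le_trans _ _ (\sum_(p in far q) (1 - tau / d%:R) ^+ k)).
    apply: ler_sum => p hp; rewrite mean_collide.
    have h1 : (hamming (pt p) q)%:R / d%:R <= 1 :> R by rewrite ler_pdivrMr // mul1r ler_nat hamming_le.
    have h2 : tau / d%:R <= (hamming (pt p) q)%:R / d%:R by rewrite ler_pM2r ?invr_gt0 // ltW.
    by apply: lerXn2r; rewrite ?nnegrE; lra.
  rewrite sumr_const -[leLHS]mulr_natl ler_wpM2r ?ler_nat //.
    by apply: exprn_ge0; rewrite subr_ge0 ler_pdivrMr // mul1r.
  by rewrite -[leqRHS]card_ord max_card.
have [w hw] := exists_le_mean (fun w => \sum_(q in Q) pot w q) T1.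
exists [seq ffun_seq (w i) | i <- enum 'I_L], [set q in Q | 1 <= pot w q]; split.
- by rewrite size_map size_enum_ord.
- by apply/allP => J /mapP[i _ ->]; rewrite size_ffun_seq.
- apply: (le_trans (card_le_sum (F := pot w) _ _)) => //.
    by move=> q _; rewrite addr_ge0 // mulr_ge0.
  apply: (le_trans hw); rewrite mean_sum.
  apply: (@le_trans _ _ (\sum_(q in Q) 8^-1)); last by rewrite sumr_const -[leLHS]mulr_natl.
  apply: ler_sum => q qQ; rewrite /pot meanD meanZ.
  have h1 := hmiss q qQ; have h2 : (16 * L%:R)^-1 * mean (cost^~ q) <= 16^-1.
    by rewrite mulrC ler_pdivrMr ?mulr_gt0 //; have := hcost q; lra.
  by lra.
move=> q qQ; rewrite inE qQ /= -ltNge => hpot; split.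
  have hm : miss w q < 1 by apply: le_lt_trans hpot; rewrite lerDl mulr_ge0.
  case: (boolP [exists i, collide pt (ffun_seq (w i)) q (pstar q)]) => [/existsP[i hi]|].
    by exists (ffun_seq (w i)) => //; apply: map_f; rewrite mem_enum.
  rewrite negb_exists => /forallP h; move: hm; rewrite /miss big1 ?ltxx // => i _.
  by rewrite (negbTE (h i)) subr0.
have hc : cost w q <= 16 * L%:R.
  have : (16 * L%:R)^-1 * cost w q < 1 by apply: le_lt_trans hpot; rewrite lerDr.
  by rewrite mulrC ltr_pdivrMr ?mulr_gt0 // mul1r => /ltW.
rewrite -(ler_nat R) natrM; apply: le_trans hc.
rewrite big_map big_enum natr_sum /=; apply: ler_sum => i _.
rewrite -sum1_count natr_sum big_enum_cond /= [leRHS]big_mkcond /= [leLHS]big_mkcond /=.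
apply: ler_sum => p _; rewrite /in_mem /=.
by rewrite /far; case: (collide _ _ _ _); case: (tau < _).
Qed.

End Exists.

Lemma proc_ok_weaken n d B V V' t0 t1 t1' near (G G' : hcube d -> Prop)
    (P : (option 'I_n -> strat) -> strat) :
  (V <= V')%N -> (t1 <= t1')%N -> (forall q, G' q -> G q) ->
  proc_ok B V t0 t1 near G P -> proc_ok B V' t0 t1' near G' P.
Proof.
move=> hV ht hG [h1 h2]; split=> [K|K q t tt]; first exact: within_sub (h1 K).
have [t' [e [r1 r2 r3]]] := h2 K q t tt; exists t', e; split => //.
  exact: leq_trans ht.
by move=> /hG /r3.
Qed.

Lemma expRN_nat_le (R : realType) m : expR (- m%:R) <= 2^-1 ^+ m :> R.
Proof.
rewrite -[m%:R]mulr1 -mulrN expRM_natl; apply: lerXn2r; rewrite ?nnegrE ?expR_ge0 ?invr_ge0 //.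
rewrite expRN lef_pV2 ?posrE ?expR_gt0 //.
by apply: le_trans (expR_ge1Dx _).
Qed.

(** * Squaring the fraction of failures *)

Section Levels.
Variables (R : realType) (n d B k L sg l h : nat) (pt : 'I_n -> hcube d).
Variables (a b eta tau0 : R) (pstar : hcube d -> 'I_n).
Hypotheses (d0 : (0 < d)%N) (eta2 : 0 <= eta <= 2^-1) (b0 : 0 <= b).
Hypotheses (tau0d : 0 <= tau0 <= d%:R) (ad : a <= d%:R) (atau : a <= tau0).

Definition level_tau (i : nat) : R := tau0 + i%:R * (8 * eta * b).

Hypotheses (taub : level_tau h.+1 <= b)
  (hsg : (l + 4)%:R <= 2 * eta ^+ 2 * b * (sg%:R / d%:R)) (hnl : (n <= 2 ^ l)%N)
  (ksg : (k <= sg)%N) (sg0 : (0 < sg)%N) (L0 : (0 < L)%N) (dB : (d <= B)%N)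
  (hn : n%:R * (1 - tau0 / d%:R) ^+ k <= 1)
  (hL : 4 <= L%:R * (1 - a / d%:R) ^+ k).

(** Solution of T(i+1) = 2T(i) + 6·2^(i+1)·sg; sizes follow the same recurrence up to the factor n.
    The 72 bounds 2Lk + (16L + 1)(2sg + 2) + 2, and the 5 bounds L(k + 2sg + 2), both in units of
    L·sg. *)
Definition level_time i : nat := (2 ^ i * (72 * (L * sg) + 6 * (sg * i)))%N.
Definition level_size i : nat := (n * (2 ^ i * (5 * (L * sg) + 6 * (sg * i))))%N.

Lemma gap_ge0 : 0 <= 8 * eta * b.
Proof. by have /andP[e0 _] := eta2; rewrite !mulr_ge0. Qed.

Lemma level_tau_le i j : (i <= j)%N -> level_tau i <= level_tau j.
Proof. by move=> ij; rewrite /level_tau lerD2l ler_wpM2r ?gap_ge0 // ler_nat. Qed.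

(** The exponent 2^i (l + 4) is at least l + 2^i + 3: the [l] pays for the union over [n] points,
    2^i gives the accuracy of the round, and 3 the factor 1/8. *)
Lemma level_test i (Q : {set hcube d}) : (i <= h)%N ->
  exists J th (Bad : {set hcube d}), [/\ size J = (2 ^ i * sg)%N,
    (th <= (2 ^ i * sg).+1)%N,
    #|Bad|%:R <= #|Q|%:R * (2^-1 ^+ (2 ^ i) / 8) :> R
    & forall q, q \in Q -> q \notin Bad -> forall p,
      ((hamming (pt p) q)%:R <= level_tau i -> (diffs J (pt p) q < th)%N) /\
      ((diffs J (pt p) q < th)%N -> (hamming (pt p) q)%:R <= level_tau i.+1)].
Proof.
move=> ih; have t1 : level_tau i + 8 * eta * b = level_tau i.+1.
  by rewrite /level_tau -natr1; ring.
have h1 : level_tau i + 8 * eta * b <= b.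
  by rewrite t1; apply: le_trans taub; apply: level_tau_le.
have h0 : 0 <= level_tau i.
  by have g0 := gap_ge0; case/andP: tau0d => t0 _; rewrite addr_ge0 // mulr_ge0.
have hk : (2 ^ i * (l + 4))%:R <= 2 * eta ^+ 2 * b * ((2 ^ i * sg)%:R / d%:R).
  rewrite !natrM; set N := _%:R.
  have -> : 2 * eta ^+ 2 * b * (N * sg%:R / d%:R) = N * (2 * eta ^+ 2 * b * (sg%:R / d%:R)) by ring.
  by rewrite ler_wpM2l.
have [J [th [Bad [sJ hth hB hq]]]] := test_exists pt d0 Q eta2 b0 h0 h1 hk.
exists J, th, Bad; split => //; last by rewrite -t1.
apply: le_trans hB _; rewrite ler_wpM2l //.
apply: (@le_trans _ _ (n%:R * 2^-1 ^+ (l + (2 ^ i + 3)))).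
  rewrite ler_wpM2l //; apply: le_trans (expRN_nat_le _ _) _.
  apply: ler_wiXn2l; rewrite ?invr_ge0 ?invf_le1 ?ler1n //.
  have p2 : (0 < 2 ^ i)%N by rewrite expn_gt0.
  by have := leq_pmull l p2; rewrite mulnDr; clear -p2; lia.
have hnl' : n%:R * 2^-1 ^+ l <= 1 :> R.
  by rewrite exprVn ler_pdivrMr ?exprn_gt0 // mul1r -natrX ler_nat.
have e3 : 2^-1 ^+ 3 = 8^-1 :> R by rewrite !exprS expr0; lra.
rewrite exprD exprD e3 mulrA -[leRHS]mul1r; apply: ler_wpM2r hnl'.
by rewrite divr_ge0 // exprn_ge0 // invr_ge0.
Qed.

Lemma level_base t0 (Q : {set hcube d}) :
  (forall q, q \in Q -> (hamming (pt (pstar q)) q)%:R <= a) ->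
  (t0 + level_time 0 < B)%N ->
  exists P (Bad : {set hcube d}), #|Bad|%:R <= #|Q|%:R * (2^-1 ^+ (2 ^ 0) / 2) :> R /\
    proc_ok B (level_size 0) t0 (t0 + level_time 0)
      (fun q p => (hamming (pt p) q)%:R <= level_tau 1)
      (fun q => q \in Q /\ q \notin Bad) P.
Proof.
move=> hstar tB; rewrite /level_time expn0 mul1n muln0 muln0 addn0 in tB.
have LS : (0 < L * sg)%N by rewrite muln_gt0 L0.
have Lk : (L * k <= L * sg)%N by rewrite leq_mul2l ksg orbT.
have Ls : (L <= L * sg)%N by rewrite leq_pmulr.
have ss : (sg <= L * sg)%N by rewrite leq_pmull.
have [J0 [th [Bad1 [sJ hth hB1 hq1]]]] := level_test Q (leq0n h).
have [Js [Bad2 [sJs kJs hB2 hq2]]] := tables_exist d0 hstar ad tau0d hn hL L0.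
rewrite expn0 mul1n in sJ hth; rewrite /level_tau mul0r addr0 in hq1.
pose G q := q \in Q /\ q \notin Bad1 :|: Bad2.
have thB : (th < B)%N by clear -tB hth ss LS; lia.
have cutB : (t0 + L * k + 16 * L * (2 * sg + 2) + 1 < B)%N by rewrite mulnDr; clear -tB Lk Ls LS; lia.
have near_pass q p : G q -> passes pt J0 th q p -> (hamming (pt p) q)%:R <= level_tau 1.
  by move=> [qQ]; rewrite !inE negb_or => /andP[n1 _]; have [_] := hq1 q qQ n1 p.
have succ q : G q ->
  (exists2 J, J \in Js & exists2 p, collide pt J q p & passes pt J0 th q p) /\
  (failures pt J0 th q Js <= 16 * L)%N.
  move=> [qQ]; rewrite !inE negb_or => /andP[n1 n2].
  have [[J hJ cJ] hc] := hq2 q qQ n2; split.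
    exists J => //; exists (pstar q) => //; apply: (hq1 q qQ n1 _).1.
    exact: le_trans (hstar q qQ) atau.
  (* A rejected candidate is farther than [tau0], so rejections are among the far collisions already
     bounded by [16 * L]. *)
  apply: leq_trans hc; apply: leq_sum => J' _; apply: sub_count => p /= /andP[-> hp] /=.
  by rewrite ltNge; apply: contra hp => hp; apply: (hq1 q qQ n1 p).1.
have [P hP] := proc_tables sJ sJs kJs thB dB cutB near_pass succ.
exists P, (Bad1 :|: Bad2); split.
  apply: (@le_trans _ _ (#|Bad1|%:R + #|Bad2|%:R)).
    by rewrite -natrD ler_nat cardsU leq_subr.
  have Q0 : 0 <= #|Q|%:R :> R by [].
  (* 1/16 from the test and 1/8 from the tables stay below 1/4. *)
  by rewrite expn0 expr1 in hB1 *; lra.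
apply: proc_ok_weaken hP => //.
- rewrite /level_size expn0 mul1n muln0 muln0 addn0 mulnCA leq_mul2l.
  by apply/orP; right; rewrite !mulnDr; clear -Lk Ls; lia.
- by rewrite /level_time expn0 mul1n muln0 muln0 addn0 mulSn !mulnDr; clear -Lk Ls ss LS; lia.
Qed.

Lemma level_ok i : (i <= h)%N -> forall t0 (Q : {set hcube d}),
  (forall q, q \in Q -> (hamming (pt (pstar q)) q)%:R <= a) ->
  (t0 + level_time i < B)%N ->
  exists P (Bad : {set hcube d}), #|Bad|%:R <= #|Q|%:R * (2^-1 ^+ (2 ^ i) / 2) :> R /\
    proc_ok B (level_size i) t0 (t0 + level_time i)
      (fun q p => (hamming (pt p) q)%:R <= level_tau i.+1)
      (fun q => q \in Q /\ q \notin Bad) P.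
Proof.
elim: i => [_ t0 Q|i IH ih t0 Q hstar tB]; first exact: level_base.
set S := (2 ^ i.+1 * sg)%N.
have S0 : (0 < S)%N by rewrite muln_gt0 expn_gt0.
have eT : level_time i.+1 = (2 * level_time i + 6 * S)%N.
  by rewrite /level_time /S expnS; ring.
have eV : level_size i.+1 = (2 * level_size i + n * (6 * S))%N.
  by rewrite /level_size /S expnS; ring.
have [J [th [Bad3 [sJ hth hB3 hq3]]]] := level_test Q ih.
have ih' : (i <= h)%N by apply: ltnW.
have tB1 : (t0 + level_time i < B)%N by rewrite eT in tB; clear -tB S0; lia.
have [P1 [Bad1 [hB1 ok1]]] := IH ih' t0 Q hstar tB1.
have tB2 : (t0 + level_time i + (2 * S + 1) + level_time i < B)%N by rewrite eT in tB; clear -tB S0; lia.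
have hstar2 q : q \in Q :&: Bad1 -> (hamming (pt (pstar q)) q)%:R <= a.
  by rewrite inE => /andP[/hstar].
have [P2 [Bad2 [hB2 ok2]]] := IH ih' (t0 + level_time i + (2 * S + 1))%N _ hstar2 tB2.
have thB : (th < B)%N by apply: leq_ltn_trans hth _; rewrite -/S; rewrite eT in tB; clear -tB S0; lia.
have t31 q p : q \in Q /\ q \notin Bad3 ->
    (hamming (pt p) q)%:R <= level_tau i.+1 -> (diffs J (pt p) q < th)%N.
  by move=> [qQ qB]; have [] := hq3 q qQ qB p.
have t32 q p : q \in Q /\ q \notin Bad3 ->
    (diffs J (pt p) q < th)%N -> (hamming (pt p) q)%:R <= level_tau i.+2.
  by move=> [qQ qB]; have [] := hq3 q qQ qB p.
have [P ok] := proc_combine sJ thB dB (leqnn _) ok1 ok2 t31 t32.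
exists P, (Bad2 :|: Bad3); split; last first.
  apply: proc_ok_weaken ok.
  - by rewrite eV leq_add2l mulnCA leq_mul2l -/S; apply/orP; right; clear -S0; lia.
  - by rewrite eT -/S; clear -S0; lia.
  - move=> q [qQ]; rewrite inE negb_or => /andP[q2 q3]; split => //.
    by case: (boolP (q \in Bad1)) => q1; [right; rewrite inE qQ|left].
(* Both procedures fail on a fraction at most x²/4 and the test errs on x²/8; the sum is below
   x²/2. *)
set x := 2^-1 ^+ (2 ^ i) : R; have x0 : 0 <= x by rewrite exprn_ge0 // invr_ge0.
have ex : 2^-1 ^+ (2 ^ i.+1) = x * x :> R by rewrite expnS mulnC exprM expr2.
have x1 : x <= 1 by apply: exprn_ile1; rewrite ?invr_ge0 // invf_le1 // ler1n.
apply: (@le_trans _ _ (#|Bad2|%:R + #|Bad3|%:R)).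
  by rewrite -natrD ler_nat cardsU leq_subr.
rewrite ex in hB3 *.
have hB12 : #|Bad2|%:R <= #|Q|%:R * (x / 2) * (x / 2).
  apply: le_trans hB2 _; rewrite ler_wpM2r ?divr_ge0 //.
  by apply: le_trans hB1; rewrite ler_nat subset_leq_card // finset.subsetIr.
have : 0 <= #|Q|%:R * (x * x) by rewrite !mulr_ge0.
by lra.
Qed.

End Levels.

(** * Counting the queries near the dataset *)

Definition flip (d : nat) (i : 'I_d) (q : hcube d) : hcube d :=
  [tuple if j == i then ~~ tnth q j else tnth q j | j < d].

Lemma flipK d (i : 'I_d) : involutive (flip i).
Proof.
move=> q; apply: eq_from_tnth => j; rewrite !tnth_mktuple.
by case: (j == i); rewrite ?negbK.
Qed.

Lemma hamming_flip d (i : 'I_d) (p q : hcube d) : tnth p i != tnth q i ->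
  hamming p q = (hamming p (flip i q)).+1.
Proof.
move=> hi; rewrite /hamming (cardD1 i) inE hi add1n; congr S.
apply: eq_card => j; rewrite !inE tnth_mktuple; case: eqP => [->|_] //=.
by move: hi; case: (tnth p i); case: (tnth q i).
Qed.

Lemma hamming0 d (p q : hcube d) : hamming p q = 0%N -> p = q.
Proof.
move=> h; apply: eq_from_tnth => j; apply/eqP; apply: contraT => hj.
by move/card0_eq: h => /(_ j); rewrite inE hj.
Qed.

(** Each point of the ball of radius a + 1 arises from one of radius a by flipping one of the [d]
    coordinates or none. *)
Lemma card_ball d (p : hcube d) a : (#|[set q | (hamming p q <= a)%N]%SET| <= d.+1 ^ a)%N.
Proof.
elim: a => [|a ih].
  rewrite expn0 -(cards1 p) subset_leq_card //; apply/fintype.subsetP => q.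
  by rewrite !inE leqn0 => /eqP/hamming0 ->.
pose F (oq : option 'I_d * hcube d) := if oq.1 is Some i then flip i oq.2 else oq.2.
apply: (@leq_trans #|F @: finset.setX [set: option 'I_d] [set q | (hamming p q <= a)%N]%SET|).
  apply/subset_leq_card/fintype.subsetP => q; rewrite inE leq_eqVlt => /orP[/eqP h|h].
    have /card_gt0P[i] : (0 < hamming p q)%N by rewrite h.
    rewrite inE => hi; apply/imsetP; exists (Some i, flip i q); last by rewrite /F /= flipK.
    by rewrite !inE /=; move: h; rewrite (hamming_flip hi) => -[->].
  by apply/imsetP; exists (None, q) => //; rewrite !inE.
apply: leq_trans (leq_imset_card _ _) _.
by rewrite cardsX cardsT card_option card_ord expnS leq_mul2l ih orbT.
Qed.

Lemma card_near n d (pt : 'I_n -> hcube d) a :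
  (#|[set q | [exists p, (hamming (pt p) q <= a)%N]]%SET| <= n * d.+1 ^ a)%N.
Proof.
rewrite -sum1_card big_mkcond /=.
apply: (@leq_trans (\sum_q \sum_p (hamming (pt p) q <= a)%N)%N).
  apply: leq_sum => q _; rewrite inE; case: ifP => // /existsP[p hp].
  by rewrite (bigD1 p) //= hp.
rewrite exchange_big /= -[X in (_ <= X * _)%N]card_ord -sum_nat_const.
apply: leq_sum => p _; apply: leq_trans (card_ball (pt p) a).
rewrite -sum1_card [X in (_ <= X)%N]big_mkcond /=; apply: leq_sum => q _.
by rewrite inE; case: ifP.
Qed.

(** * The exponent 1/c *)

Section Exponent.
Variable R : realType.

Lemma ln_le_sub1 (w : R) : 0 < w -> ln w <= w - 1.
Proof.
move=> w0; have := @le_ln1Dx R (w - 1); rewrite (_ : 1 + (w - 1) = w); last by ring.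
by apply; lra.
Qed.

Lemma expR1_le4 : expR 1 <= 4 :> R.
Proof.
have h : expR (2^-1) <= 2 :> R.
  by have := @expR_le_quadratic R 2^-1 (lexx _); rewrite expr2; lra.
have -> : expR 1 = expR (2^-1) ^+ 2 :> R by rewrite -expRM_natl; congr expR; lra.
rewrite (_ : 4 = 2 ^+ 2 :> R); last by rewrite -natrX.
by apply: lerXn2r; rewrite ?nnegrE ?expR_ge0.
Qed.

(* Bernoulli's inequality for exponents in [0, 1], as a weighted AM-GM. *)
Lemma ln_bernoulli (u v : R) : 0 <= v <= 1 -> u < 1 -> v * ln (1 - u) <= ln (1 - u * v).
Proof.
move=> /andP[v0 v1] u1.
have m0 : 0 < 1 - u * v.
  by case: (lerP 0 u) => hu; nra.
have A0 : 0 < 1 - u by lra.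
have hA : ln ((1 - u) / (1 - u * v)) <= (1 - u) / (1 - u * v) - 1.
  by apply: ln_le_sub1; rewrite divr_gt0.
have hB : ln ((1 - u * v)^-1) <= (1 - u * v)^-1 - 1.
  by apply: ln_le_sub1; rewrite invr_gt0.
rewrite lnV ?posrE // in hB; rewrite ln_div ?posrE // in hA.
have e : v * ((1 - u) / (1 - u * v) - 1) + (1 - v) * ((1 - u * v)^-1 - 1) = 0.
  by field; rewrite gt_eqF.
have h1 : v * (ln (1 - u) - ln (1 - u * v)) <= v * ((1 - u) / (1 - u * v) - 1) by rewrite ler_wpM2l.
have h2 : (1 - v) * (- ln (1 - u * v)) <= (1 - v) * ((1 - u * v)^-1 - 1).
  by rewrite ler_wpM2l // subr_ge0.
lra.
Qed.

(** By Bernoulli, -ln(1 - a/d) is at most a/tau times -ln(1 - tau/d), so [k] coordinates agree with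
    probability at least n^(-a/tau). As tau is within a factor 1 - 1/(2Kl) of b, a/tau is at most
    rho + 1/l, and n^(1/l) is at most e, hence at most 4. The extra coordinate costs 1 - a/d, at
    least 1 - rho, hence the factor [K]. *)
Lemma collision_exponent (n d k K l : nat) (a b tau rho : R) : (0 < n)%N -> 0 < d%:R :> R ->
  0 <= a -> a <= rho * b -> b <= d%:R -> 0 < b -> tau < b -> 0 <= rho < 1 ->
  1 <= K%:R * (1 - rho) -> (0 < l)%N -> ln n%:R <= l%:R :> R ->
  b * (1 - (2 * K%:R * l%:R)^-1) <= tau ->
  (k%:R <= ln n%:R / - ln (1 - tau / d%:R)) ->
  1 <= 4 * K%:R * n%:R `^ rho * (1 - a / d%:R) ^+ k.+1.
Proof.
move=> n0 dR a0 arb bd b0 taub /andP[r0 r1] hK l0 lnl htau hk.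
have nR : 1 <= n%:R :> R by rewrite ler1n.
have nR0 : 0 < n%:R :> R by apply: lt_le_trans nR.
have lR : 1 <= l%:R :> R by rewrite ler1n.
have K0 : 1 <= K%:R :> R by have : 0 <= K%:R :> R by []; nra.
set x := (2 * K%:R * l%:R)^-1 in htau.
have xl : x * (2 * l%:R) <= 1.
  rewrite /x mulrC ler_pdivrMr ?mulr_gt0 //; try lra.
  by rewrite mul1r -mulrA [K%:R * _]mulrC mulrA ler_pMr //; lra.
have x0 : 0 < x by rewrite invr_gt0 !mulr_gt0 //; lra.
have x2 : x <= 2^-1 by nra.
have xr : rho <= 1 - x.
  suff : x <= 1 - rho by lra.
  rewrite /x -[leLHS]mul1r ler_pdivrMr ?mulr_gt0 //; try lra.
  have h : 0 <= K%:R * (1 - rho) * (2 * l%:R - 1) by rewrite !mulr_ge0 //; lra.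
  by lra.
have tau0 : 0 < tau by apply: lt_le_trans htau; rewrite mulr_gt0 //; lra.
have atau : a <= tau.
  apply: le_trans arb _; apply: le_trans htau; rewrite mulrC ler_wpM2l //; lra.
set u := tau / d%:R; have u1 : u < 1.
  by rewrite ltr_pdivrMr // mul1r; lra.
have u0 : 0 < u by rewrite divr_gt0.
set y := - ln (1 - u) in hk; have y0 : 0 < y by rewrite oppr_gt0 ln_lt0 //; lra.
set z := 1 - a / d%:R.
have ad : a / d%:R <= rho.
  rewrite ler_pdivrMr //; apply: le_trans arb _; rewrite ler_wpM2l //.
have z0 : 0 < z by rewrite /z; lra.
have z1 : K%:R * z >= 1.
  by apply: le_trans hK _; rewrite ler_wpM2l // /z; lra.
have hlnz : - ln z <= a / tau * y.
  have h := @ln_bernoulli u (a / tau) _ u1; have e : u * (a / tau) = a / d%:R.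
    by rewrite /u; field; rewrite !gt_eqF.
  rewrite e in h; rewrite /y mulrN lerN2; apply: h.
  by rewrite divr_ge0 ?(ltW tau0) //= ler_pdivrMr // mul1r.
have hat : a / tau <= rho + l%:R^-1.
  rewrite ler_pdivrMr //; apply: le_trans arb _.
  have lV : 0 < l%:R^-1 :> R by rewrite invr_gt0; lra.
  have e1 : 2 * x <= l%:R^-1.
    by rewrite -[leRHS]div1r ler_pdivlMr; lra.
  apply: (@le_trans _ _ ((rho + 2 * x) * (b * (1 - x)))); last first.
    by apply: ler_pM => //; rewrite ?mulr_ge0 //; lra.
  have h : 0 <= b * (x * (2 - 2 * x - rho)) by rewrite !mulr_ge0 //; lra.
  by lra.
have hln : ln n%:R * (a / tau) <= rho * ln n%:R + 1.
  have ln0 : 0 <= ln n%:R :> R by apply: ln_ge0.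
  apply: (@le_trans _ _ (ln n%:R * (rho + l%:R^-1))); first by rewrite ler_wpM2l.
  rewrite mulrDr mulrC lerD2l ler_pdivrMr; lra.
have zk : expR (- (rho * ln n%:R + 1)) <= z ^+ k.
  have -> : z ^+ k = expR (k%:R * ln z) by rewrite expRM_natl lnK.
  rewrite ler_expR lerNl -mulrN; apply: le_trans hln.
  apply: (@le_trans _ _ (k%:R * (a / tau * y))); first by rewrite ler_wpM2l.
  rewrite mulrCA mulrC ler_wpM2r //; first by rewrite divr_ge0 // ltW.
  by rewrite -ler_pdivlMr.
have e4 := expR1_le4.
have en : n%:R `^ rho = expR (rho * ln n%:R) by rewrite /powR gt_eqF.
rewrite en exprS.
have -> : 4 * K%:R * expR (rho * ln n%:R) * (z * z ^+ k) =
  (K%:R * z) * (4 * expR (rho * ln n%:R) * z ^+ k) by ring.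
have h : 1 <= 4 * expR (rho * ln n%:R) * z ^+ k.
  apply: (@le_trans _ _ (4 * expR (rho * ln n%:R) * expR (- (rho * ln n%:R + 1)))); last first.
    by rewrite ler_wpM2l // mulr_ge0 // expR_ge0.
  rewrite -mulrA -expRD (_ : rho * ln n%:R + - (rho * ln n%:R + 1) = -1); last by ring.
  by rewrite expRN ler_pdivlMr ?expR_gt0 //; lra.
by rewrite -[leLHS]mul1r; apply: ler_pM.
Qed.

End Exponent.

(** * Choice of the parameters *)

(** The [b] in the bound on 2^h cancels against the d/b in the sample size; only [d] and logarithms
    remain. *)
Lemma level_time_bound d b l h E L : (0 < d)%N -> (0 < l)%N -> (0 < E)%N -> (0 < L)%N ->
  (b <= d)%N -> (2 ^ h <= 2 * (l * b))%N -> (h <= 2 * l)%N ->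
  (level_time L ((d %/ b).+1 * E) h + 2 * d + 4 <= 400 * (d * l ^ 2 * E * L))%N.
Proof.
move=> d0 l0 E0 L0 bd hh hl; set sg := ((d %/ b).+1 * E)%N.
have hb : (b * (d %/ b).+1 <= 2 * d)%N.
  by rewrite mulnS mulnC; have := leq_trunc_div d b; lia.
have hbs : (b * sg <= 2 * (d * E))%N by rewrite /sg mulnA [in leqRHS]mulnA leq_mul2r hb orbT.
have h1 : (2 ^ h * sg <= 4 * (l * (d * E)))%N.
  apply: (@leq_trans (2 * (l * b) * sg)%N); first by rewrite leq_mul2r hh orbT.
  have -> : (2 * (l * b) * sg = 2 * l * (b * sg))%N by ring.
  have -> : (4 * (l * (d * E)) = 2 * l * (2 * (d * E)))%N by ring.
  by rewrite leq_mul2l hbs orbT.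
have lL : (72 * L + 6 * h <= 84 * (l * L))%N.
  have a1 : (L <= l * L)%N by rewrite leq_pmull.
  have a2 : (l <= l * L)%N by rewrite leq_pmulr.
  lia.
have -> : level_time L sg h = (2 ^ h * sg * (72 * L + 6 * h))%N by rewrite /level_time; ring.
have h2 := leq_mul h1 lL.
have e : (4 * (l * (d * E)) * (84 * (l * L)) = 336 * (d * l ^ 2 * E * L))%N by ring.
have h3 : (d <= d * l ^ 2 * E * L)%N.
  by rewrite -!mulnA leq_pmulr // !muln_gt0 ?expn_gt0 ?l0 ?E0 ?L0.
rewrite e in h2; move: h2 h3; move: (_ * _)%N (d * l ^ 2 * E * L)%N => u v; clear -d0; lia.
Qed.

Lemma natr_le_half (R : realType) m : m%:R <= 2^-1 :> R -> m = 0%N.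
Proof. by case: m => // m; rewrite -natr1 => h; exfalso; have := ler0n R m; lra. Qed.

Lemma powR_nat_ge1 (R : realType) (rho : R) n : 0 <= rho -> (0 < n)%N -> 1 <= n%:R `^ rho.
Proof.
move=> r0 n0; have n1 : 1 <= n%:R :> R by rewrite ler1n.
by have := ler_powR n1 r0; rewrite powRr0.
Qed.

Section Params.
Variables (R : realType) (rho : R) (K : nat).
Hypotheses (rho01 : 0 <= rho < 1) (hK : 1 <= K%:R * (1 - rho)).

(** 400 comes from [level_time_bound], the middle factor from the bound on [E], and [17 * K] from
    [tables_le]. *)
Definition graph_const : R := 400 * (160 * (8 * K%:R) ^+ 2) * (17 * K%:R).

Fact K_ge1 : 1 <= K%:R :> R.
Proof.
have /andP[r0 _] := rho01; have h : 0 <= K%:R * rho by rewrite mulr_ge0.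
by have := hK; rewrite mulrBr mulr1; lra.
Qed.

Fact K_gt0 : (0 < K)%N. Proof. by rewrite -(ltr0n R); apply: lt_le_trans K_ge1. Qed.

Section Size.
Variables (n d a b : nat) (pt : 'I_n -> hcube d).
Hypotheses (n0 : (0 < n)%N) (d0 : (0 < d)%N) (b0 : (0 < b)%N) (bd : (b <= d)%N).
Hypothesis arb : a%:R <= rho * b%:R.

(* [h] is the number of rounds, consecutive thresholds differ by [b / G], the test
   of round [i] samples [2 ^ i * sg] coordinates, and there are [L] tables of
   [k0.+1] coordinates. *)
Let l := up_log 2 (n * d).+2.
Let h := up_log 2 (l * b).
Let G : nat := (8 * K * l ^ 2)%N.
Let E : nat := (32 * G ^ 2 * (l + 4))%N.
Let sg : nat := ((d %/ b).+1 * E)%N.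
Let eta : R := (8 * G%:R)^-1.
Let tau0 : R := b%:R * (1 - (h + 2)%:R / G%:R).
Let k0 : nat := Num.truncn (ln n%:R / - ln (1 - tau0 / d%:R)).
Let L : nat := (Num.truncn (16 * K%:R * n%:R `^ rho)).+1.

Fact log_gt0 : (0 < l)%N. Proof. by rewrite up_log_gt0. Qed.
Fact log_exp : ((n * d).+2 <= 2 ^ l)%N. Proof. exact: up_logP. Qed.
Fact n_le_exp : (n <= 2 ^ l)%N.
Proof. by apply: leq_trans log_exp; rewrite (leq_trans (leq_pmulr n d0)) // ltnW. Qed.
Fact d_lt_exp : (d.+1 <= 2 ^ l)%N.
Proof. by apply: leq_trans log_exp; rewrite ltnS (leq_trans (leq_pmull d n0)). Qed.
Fact gap_gt0 : (0 < G)%N. Proof. by rewrite !muln_gt0 ?K_gt0 ?expn_gt0 ?log_gt0. Qed.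
Fact reps_gt0 : (0 < E)%N. Proof. by rewrite (muln_gt0 (32 * G ^ 2)) (muln_gt0 32) expn_gt0 gap_gt0 addn_gt0 orbT. Qed.
Fact height_exp : (l * b <= 2 ^ h)%N. Proof. exact: up_logP. Qed.

Fact height_exp_le : (2 ^ h <= 2 * (l * b))%N.
Proof.
case: (ltnP 1 (l * b)) => lb1.
  have := up_log_gtn (isT : 1 < 2)%N lb1; rewrite -/h => hlt.
  have h0 : (0 < h)%N by rewrite up_log_gt0.
  have -> : (2 ^ h = 2 * 2 ^ h.-1)%N by rewrite -expnS prednK.
  by rewrite (leq_mul2l 2) /= ltnW.
have lb1' : (l * b = 1)%N by apply/eqP; rewrite eqn_leq lb1 muln_gt0 log_gt0.
by rewrite /h lb1' up_log1.
Qed.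

Fact height_le : (h <= 2 * l)%N.
Proof.
apply: up_log_min => //; rewrite mul2n -addnn expnD; apply: leq_mul.
  by rewrite ltnW // ltn_expl.
by apply: leq_trans bd _; apply: leq_trans d_lt_exp.
Qed.

Fact b_gt0 : 0 < b%:R :> R. Proof. by rewrite ltr0n. Qed.
Fact d_gt0 : 0 < d%:R :> R. Proof. by rewrite ltr0n. Qed.
Fact log_ge1 : 1 <= l%:R :> R. Proof. by rewrite ler1n log_gt0. Qed.
Fact gapR_gt0 : 0 < G%:R :> R. Proof. by rewrite ltr0n gap_gt0. Qed.
Fact gapE : G%:R = 8 * K%:R * l%:R ^+ 2 :> R. Proof. by rewrite -natrX -!natrM. Qed.
Fact repsE : E%:R = 32 * G%:R ^+ 2 * (l + 4)%:R :> R. Proof. by rewrite -natrX -!natrM. Qed.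

Ltac basic_facts := have K_ge1 := K_ge1; have log_ge1 := log_ge1; have b_gt0 := b_gt0; have d_gt0 := d_gt0; have gapR_gt0 := gapR_gt0;
  have log_gt0 := log_gt0; have gap_gt0 := gap_gt0; have reps_gt0 := reps_gt0; have n_le_exp := n_le_exp; have d_lt_exp := d_lt_exp; have height_le := height_le; have height_exp_le := height_exp_le.

(** There are h + 2 gaps, at most 4l, each a fraction 1 / (8Kl²) of b. Their total is the slack
    1/(2Kl) that [collision_exponent] tolerates, which explains [G]. *)
Fact tau0_ge : b%:R * (1 - (2 * K%:R * l%:R)^-1) <= tau0.
Proof. basic_facts.
rewrite ler_pM2l // lerD2l lerN2.
have -> : (2 * K%:R * l%:R)^-1 = (4 * l%:R) / G%:R :> R.
  by rewrite gapE; field; rewrite !gt_eqF //; lra.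
rewrite ler_pM2r ?invr_gt0 // -natrM ler_nat; move: height_le log_gt0; clear; lia.
Qed.

Fact tau0_lt : tau0 < b%:R.
Proof. basic_facts.
by rewrite /tau0 gtr_pMr // ltrBlDr ltrDl divr_gt0 // ltr0n addn2.
Qed.

Fact tau0_half : b%:R / 2 <= tau0.
Proof. basic_facts.
apply: le_trans tau0_ge; rewrite ler_pM2l // lerBrDr -lerBrDl.
have -> : 1 - 2^-1 = 2^-1 :> R by lra.
rewrite lef_pV2 ?posrE ?mulr_gt0 //; try lra.
have : 1 <= K%:R * l%:R :> R by rewrite -[leLHS]mul1r ler_pM.
by lra.
Qed.

Fact ln_le_log : ln n%:R <= l%:R :> R.
Proof. basic_facts.
apply: (@le_trans _ _ (ln (2 ^+ l))).
  by rewrite ler_ln ?posrE ?ltr0n ?exprn_gt0 // -natrX ler_nat n_le_exp.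
rewrite -[X in ln (X ^+ _)](@lnK R) ?posrE // -expRM_natl expRK ler_piMr //.
by have := @ln_le_sub1 R 2 _; lra.
Qed.

(** With eta = 1/(8G) the right side is at least E / (32 G²), which is why [E] is
    [32 * G ^ 2 * (l + 4)]. *)
Fact sample_size : (l + 4)%:R <= 2 * eta ^+ 2 * b%:R * (sg%:R / d%:R).
Proof. basic_facts.
have h1 : (d * E <= b * sg)%N.
  by rewrite /sg mulnA leq_mul2r [(b * _)%N]mulnC ltnW ?orbT // ltn_ceil.
have -> : 2 * eta ^+ 2 * b%:R * (sg%:R / d%:R) = 2 * eta ^+ 2 * ((b * sg)%:R / d%:R).
  by rewrite natrM; ring.
apply: (@le_trans _ _ (2 * eta ^+ 2 * ((d * E)%:R / d%:R))); last first.
  apply: ler_wpM2l; first by rewrite mulr_ge0 ?sqr_ge0.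
  by rewrite ler_pM2r ?invr_gt0 // ler_nat.
rewrite natrM [d%:R * _]mulrC mulfK ?gt_eqF // repsE /eta.
rewrite le_eqVlt; apply/orP; left; apply/eqP; field.
by rewrite gt_eqF.
Qed.

Fact tau0_div_lt1 : tau0 / d%:R < 1.
Proof. basic_facts. have tau0_lt := tau0_lt. by rewrite ltr_pdivrMr // mul1r; apply: lt_le_trans tau0_lt _; rewrite ler_nat. Qed.

Fact tau0_gt0 : 0 < tau0. Proof. basic_facts. by apply: lt_le_trans tau0_half; rewrite divr_gt0. Qed.

Fact rate_ge : tau0 / d%:R <= - ln (1 - tau0 / d%:R).
Proof. basic_facts.
have := @ln_le_sub1 R (1 - tau0 / d%:R); rewrite subr_gt0 tau0_div_lt1 => /(_ isT); lra.
Qed.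

Fact rate_gt0 : 0 < - ln (1 - tau0 / d%:R).
Proof. basic_facts. by apply: lt_le_trans rate_ge; rewrite divr_gt0 ?tau0_gt0. Qed.

Fact ln_ge0n : 0 <= ln n%:R :> R. Proof. basic_facts. by apply: ln_ge0; rewrite ler1n. Qed.

Ltac tau0_facts := have tau0_ge := tau0_ge; have tau0_lt := tau0_lt; have tau0_half := tau0_half;
  have tau0_gt0 := tau0_gt0; have rate_ge := rate_ge; have rate_gt0 := rate_gt0; have ln_ge0n := ln_ge0n; have tau0_div_lt1 := tau0_div_lt1.

Fact key_length_le : k0%:R <= ln n%:R / - ln (1 - tau0 / d%:R).
Proof. basic_facts; tau0_facts. by rewrite -truncn_ge_nat // divr_ge0 // ltW. Qed.

(** Hashing must not cost more than testing. Since -ln(1 - tau0/d) is at least tau0/d, and thus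
    b/(2d), the key has at most 2l·d/b + 1 bits. *)
Fact key_le_sample : (k0.+1 <= sg)%N.
Proof. basic_facts; tau0_facts.
rewrite -(ler_nat R).
have h1 : k0%:R <= (2 * l)%:R * (d%:R / b%:R) :> R.
  apply: le_trans key_length_le _; rewrite ler_pdivrMr //; apply: le_trans ln_le_log _.
  apply: (@le_trans _ _ ((2 * l)%:R * (d%:R / b%:R) * (tau0 / d%:R))); last first.
    by rewrite ler_wpM2l // mulr_ge0 // divr_ge0.
  have -> : (2 * l)%:R * (d%:R / b%:R) * (tau0 / d%:R) = l%:R * (2 * tau0 / b%:R).
    by rewrite natrM; field; rewrite !gt_eqF.
  by rewrite ler_peMr // ler_pdivlMr // mul1r; lra.
have h2 : (d%:R / b%:R) * E%:R <= sg%:R :> R.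
  rewrite /sg natrM ler_wpM2r // ler_pdivrMr // -natrM ler_nat ltnW // ltn_ceil //.
have h3 : 1 <= d%:R / b%:R :> R by rewrite ler_pdivlMr // mul1r ler_nat.
apply: le_trans h2; rewrite -natr1.
apply: (@le_trans _ _ ((2 * l).+1%:R * (d%:R / b%:R))).
  by rewrite -natr1 mulrDl mul1r lerD.
rewrite mulrC ler_wpM2l ?(le_trans _ h3) // ler_nat /E.
have g1 : (l + 4 <= G ^ 2 * (l + 4))%N by rewrite leq_pmull // expn_gt0 gap_gt0.
by rewrite -mulnA; clear -g1; lia.
Qed.

Fact far_collisions : n%:R * (1 - tau0 / d%:R) ^+ k0.+1 <= 1.
Proof. basic_facts; tau0_facts.
have nR : 0 < n%:R :> R by rewrite ltr0n.
have p0 : 0 < 1 - tau0 / d%:R by rewrite subr_gt0.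
rewrite -[X in X * _](lnK (_ : n%:R \is Num.pos)) ?posrE // -[X in X ^+ _](lnK (_ : _ \is Num.pos)) ?posrE //.
rewrite -expRM_natl -expRD -[leRHS]expR0 ler_expR -lerBrDr sub0r -mulrN -ler_pdivrMr //.
by rewrite ltW // truncnS_gt // num_real.
Qed.

(** A near point collides with probability at least 1 / (4K n^rho), so [16 K n^rho] tables give four
    expected collisions. *)
Fact enough_tables : 4 <= L%:R * (1 - a%:R / d%:R) ^+ k0.+1 :> R.
Proof. basic_facts; tau0_facts.
have bdR : b%:R <= d%:R :> R by rewrite ler_nat.
have h1 := @collision_exponent R n d k0 K l a%:R b%:R tau0 rho n0 d_gt0 (ler0n _ _) arb
  bdR b_gt0 tau0_lt rho01 hK log_gt0 ln_le_log tau0_ge key_length_le.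
set P := _ ^+ _ in h1 *.
have P0 : 0 <= P.
  apply: exprn_ge0; rewrite subr_ge0 ler_pdivrMr // mul1r; apply: le_trans arb _.
  have /andP[r0 r1] := rho01.
  apply: (@le_trans _ _ b%:R); last by rewrite ler_nat.
  by rewrite ler_piMl // ltW.
apply: (@le_trans _ _ (16 * K%:R * n%:R `^ rho * P)); first by lra.
by rewrite ler_wpM2r // ltW // truncnS_gt // num_real.
Qed.

Fact tables_le : L%:R <= 17 * K%:R * n%:R `^ rho :> R.
Proof. basic_facts; tau0_facts.
have p1 : 1 <= n%:R `^ rho :> R.
  by apply: powR_nat_ge1 => //; case/andP: rho01.
have p2 : 1 <= K%:R * n%:R `^ rho :> R by rewrite -[leLHS]mul1r ler_pM.
have p3 : 0 <= 16 * K%:R * n%:R `^ rho by lra.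
have p4 : (Num.truncn (16 * K%:R * n%:R `^ rho))%:R <= 16 * K%:R * n%:R `^ rho.
  by rewrite -truncn_ge_nat.
by rewrite /L -natr1; lra.
Qed.

Fact a_lt_b : (a < b)%N.
Proof. basic_facts; tau0_facts.
rewrite -(ltr_nat R); apply: le_lt_trans arb _.
by have /andP[_ r1] := rho01; rewrite gtr_pMl.
Qed.

Lemma graph_exists : exists X g, [/\ graph_shape n X g, (d <= X)%N,
    X%:R <= graph_const * d%:R * l%:R ^+ 7 * n%:R `^ rho
  & forall q : hcube d, let v := graph_output (nth 0%N g) (qbits q) d X in
    (v = 0%N /\ forall p, (a < hamming (pt p) q)%N) \/
    exists2 p : 'I_n, v = p.+1 & (hamming (pt p) q < b)%N].
Proof. basic_facts; tau0_facts; have a_lt_b := a_lt_b.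
pose X := (level_time L sg h + 2 * d + 4)%N.
pose Q := [set q | [exists p, (hamming (pt p) q <= a)%N]]%SET.
pose pstar q := odflt (Ordinal n0) [pick p | (hamming (pt p) q <= a)%N].
have hstar q : q \in Q -> (hamming (pt (pstar q)) q)%:R <= a%:R :> R.
  rewrite inE => /existsP[p hp]; rewrite ler_nat /pstar; case: pickP => //=.
  by move=> /(_ p); rewrite hp.
have Xn : (X <= n * X)%N by rewrite leq_pmull.
have dB : (d <= n * X)%N by apply: leq_trans Xn; rewrite /X; clear; lia.
have TB : (0 + level_time L sg h < n * X)%N by apply: leq_trans Xn; rewrite /X; clear; lia.
have eta2 : 0 <= eta <= 2^-1.
  rewrite invr_ge0 mulr_ge0 //= lef_pV2 ?posrE ?mulr_gt0 //.
  have : 1 <= G%:R :> R by rewrite ler1n.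
  by lra.
have tau0d : 0 <= tau0 <= d%:R.
  by rewrite (ltW tau0_gt0) /= (le_trans (ltW tau0_lt)) // ler_nat.
have ad : a%:R <= d%:R :> R by rewrite ler_nat (leq_trans (ltnW a_lt_b)).
have atau : a%:R <= tau0.
  apply: le_trans arb _; apply: le_trans tau0_ge; rewrite mulrC ler_wpM2l //.
  suff : (2 * K%:R * l%:R)^-1 <= 1 - rho by lra.
  rewrite -[leLHS]mul1r ler_pdivrMr ?mulr_gt0 //; try lra.
  have /andP[_ r1] := rho01.
  have h1 : 0 <= K%:R * (1 - rho) * (2 * l%:R - 1) by rewrite !mulr_ge0 //; lra.
  by have := hK; lra.
have gam : 8 * eta * b%:R = b%:R / G%:R by rewrite /eta; field; rewrite gt_eqF.
(* [tau0] leaves h + 2 gaps and the rounds use h + 1; the spare gap makes the final inequality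
   [hamming < b] strict. *)
have tauh : level_tau b%:R eta tau0 h.+1 = b%:R - b%:R / G%:R.
  by rewrite /level_tau gam /tau0 -natr1 natrD; field; rewrite gt_eqF.
have gpos : 0 < b%:R / G%:R :> R by rewrite divr_gt0.
have taub : level_tau b%:R eta tau0 h.+1 <= b%:R by rewrite tauh; lra.
have sg0 : (0 < sg)%N by rewrite muln_gt0 reps_gt0.
have [P [Bad [hBad ok]]] := level_ok d0 eta2 (ltW b_gt0) tau0d ad atau taub sample_size n_le_exp
  key_le_sample sg0 (ltn0Sn _) dB far_collisions enough_tables (leqnn h) hstar TB.
(* [Q] has at most n (d+1)^a elements, hence at most 2^(l(a+1)), 2^(lb) and finally 2^(2^h). The
   failures number at most 1/2, so there are none. *)
have Bad0 : #|Bad| = 0%N.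
  apply: (@natr_le_half R).
  apply: le_trans hBad _; rewrite mulrA -[leRHS]mul1r ler_pM2r ?invr_gt0 //.
  rewrite exprVn ler_pdivrMr ?exprn_gt0 // mul1r -natrX ler_nat.
  apply: leq_trans (card_near pt a) _.
  apply: (@leq_trans (2 ^ (l * b))%N); last by rewrite leq_exp2l // height_exp.
  apply: (@leq_trans (2 ^ l * (2 ^ l) ^ a)%N).
    apply: leq_mul => //; case: (a) => [|a']; first by rewrite !expn0.
    by rewrite leq_exp2r.
  by rewrite -expnS -expnM leq_exp2l // leq_mul2l a_lt_b orbT.
rewrite add0n in ok.
have VX : (level_size n L sg h + n * (2 * d + 1) + n + 1 < n * X)%N.
  have hs : (level_size n L sg h <= n * level_time L sg h)%N.
    by rewrite leq_mul2l leq_mul2l; apply/orP; right; apply/orP; right; clear; lia.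
  have -> : (n * X = n * level_time L sg h + n * (2 * d + 1) + n + 2 * n)%N.
    by rewrite /X; ring.
  clear -hs n0; lia.
have TX : (level_time L sg h + (2 * d + 1) <= X)%N by rewrite /X; clear; lia.
have bX : (b < n * X)%N by apply: leq_trans Xn; rewrite /X; clear -bd; lia.
have nearb q p : q \in Q /\ q \notin Bad ->
    (hamming (pt p) q)%:R <= level_tau b%:R eta tau0 h.+1 -> (hamming (pt p) q < b)%N.
  by rewrite tauh -(ltr_nat R) => _ hp; lra.
have [g gs gP] := graph_of_proc n0 d0 ok VX TX dB bX nearb.
exists X, g; split => //.
- by rewrite /X; clear; lia.
- apply: (@le_trans _ _ (400 * (d * l ^ 2 * E * L))%:R).
    by rewrite ler_nat; apply: level_time_bound.
  have E_le : E%:R <= 160 * (8 * K%:R) ^+ 2 * l%:R ^+ 5 :> R.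
    rewrite repsE natrD gapE.
    have -> : 160 * (8 * K%:R) ^+ 2 * l%:R ^+ 5 =
      32 * (8 * K%:R * l%:R ^+ 2) ^+ 2 * (5 * l%:R) :> R by ring.
    by rewrite ler_wpM2l ?mulr_ge0 ?sqr_ge0 //; lra.
  have -> : (400 * (d * l ^ 2 * E * L))%:R = 400 * (d%:R * l%:R ^+ 2 * E%:R * L%:R) :> R.
    by rewrite -natrX -!natrM.
  rewrite /graph_const.
  have -> : 400 * (160 * (8 * K%:R) ^+ 2) * (17 * K%:R) * d%:R * l%:R ^+ 7 * n%:R `^ rho =
    400 * (d%:R * l%:R ^+ 2 * (160 * (8 * K%:R) ^+ 2 * l%:R ^+ 5) *
    (17 * K%:R * n%:R `^ rho)) by ring.
  rewrite ler_pM2l //; apply: ler_pM (tables_le) => //.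
    by rewrite !mulr_ge0 ?sqr_ge0.
  by apply: ler_wpM2l E_le; rewrite mulr_ge0 ?sqr_ge0.
move=> q v; have [[v0 nG]|] := gP q; last by right.
left; split=> // p; rewrite ltnNge; apply/negP => hp; apply: nG.
split; first by rewrite inE; apply/existsP; exists p.
by rewrite (cards0_eq Bad0) inE.
Qed.

End Size.
End Params.

(** * From accepted outputs to correct answers *)

Lemma size_encode_point d (q : hcube d) : size (encode_point q) = d.
Proof. by rewrite size_map size_tuple. Qed.

Lemma size_encode_data n d (S : n.-tuple (hcube d)) : size (encode_data S) = (n * d)%N.
Proof.
rewrite /encode_data -[in RHS](size_tuple S); elim: (tval S) => //= p s ih.
by rewrite size_cat ih size_encode_point mulSn.
Qed.

Lemma nth_encode_data n d (S : n.-tuple (hcube d)) (i : 'I_n) j : (j < d)%N ->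
  nth 0%N (encode_data S) (i * d + j) = nth 0%N (encode_point (tnth S i)) j.
Proof.
move=> jd; rewrite (tnth_nth (tnth S i)) /encode_data.
have : (i < size S)%N by rewrite size_tuple.
move: (tnth S i) (nat_of_ord i) => p0 {}i.
elim: (tval S) i => // p s ih [|i] hi.
  by rewrite [flatten _]/= nth_cat size_encode_point jd.
by rewrite [flatten _]/= mulSn -addnA nth_cat size_encode_point ltnNge leq_addr /= addKn ih.
Qed.

Lemma row_dist_hamming n d (S : n.-tuple (hcube d)) q (i : 'I_n) :
  row_dist (encode_data S) (encode_point q) d i = hamming (tnth S i) q.
Proof.
rewrite /row_dist big_mkord /hamming -sum1_card [RHS]big_mkcond /=.
apply: eq_bigr => j _; rewrite nth_encode_data // -!/(qbits _ _) !qbits_ord inE.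
by case: (tnth _ _); case: (tnth _ _).
Qed.

Lemma acceptableP n d (S : n.-tuple (hcube d)) q a b v :
  acceptable (encode_data S) (encode_point q) n d a b v <->
  (v = 0%N /\ forall i, (a < hamming (tnth S i) q)%N) \/
  exists2 i : 'I_n, v = i.+1 & (hamming (tnth S i) q <= b)%N.
Proof.
rewrite /acceptable !big_mkord; case: eqP => [->|v0].
  rewrite sum_nat_eq0; split.
    move=> /forallP h; left; split => // i; have := h i.
    by rewrite row_dist_hamming implyTb eqb0 -ltnNge.
  case=> [[_ h]|[]//]; apply/forallP => i.
  by rewrite row_dist_hamming implyTb eqb0 -ltnNge.
rewrite sum_nat_eq0 negb_forall; split.
  move=> /existsP[i]; rewrite implyTb eqb0 negbK row_dist_hamming => /andP[h /eqP ->].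
  by right; exists i.
case=> [[]//|[i -> h]]; apply/existsP; exists i.
by rewrite implyTb eqb0 negbK row_dist_hamming h eqxx.
Qed.

Lemma encode_point_surj d u : size u = d -> all (fun v => v < 2)%N u ->
  exists q : hcube d, u = encode_point q.
Proof.
move=> su bu; exists [tuple nth 0%N u j == 1%N | j < d].
apply: (@eq_from_nth _ 0%N); rewrite ?size_encode_point // => j; rewrite su => jd.
have -> : nth 0%N (encode_point [tuple nth 0%N u j == 1%N | j < d]) j = (nth 0%N u j == 1%N).
  by have := qbits_ord [tuple nth 0%N u j == 1%N | j < d] (Ordinal jd); rewrite tnth_mktuple.
by move/allP: bu => /(_ (nth 0%N u j)); rewrite mem_nth ?su // => /(_ isT); case: (nth _ _ _) => [|[]].
Qed.

Lemma mem_hball (R : realType) n d (S : n.-tuple (hcube d)) q (x : R) p : 0 <= x ->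
  (p \in hball S q x) = (p \in S) && (hamming p q <= minn d (Num.truncn x))%N.
Proof.
move=> x0; rewrite inE leq_min truncn_ge_nat //; congr (_ && _).
by rewrite (_ : (hamming p q <= d)%N) // -[leqRHS]card_ord max_card.
Qed.

Lemma acceptable_correct (R : realType) (c r : R) n d (S : n.-tuple (hcube d)) q v :
  0 <= r -> 0 <= c * r ->
  acceptable (encode_data S) (encode_point q) n d (minn d (Num.truncn r))
    (minn d (Num.truncn (c * r))) v -> ann_correct c r S q (decode S v).
Proof.
move=> r0 cr0 /acceptableP[[-> far]|[i -> near]].
  have e : hball S q r = finset.set0.
    apply/setP => p; rewrite mem_hball // inE; apply/negP => /andP[/tnthP[i ->]].
    by rewrite leqNgt far.
  by split=> //; left.
have hp : tnth S i \in hball S q (c * r) by rewrite mem_hball // mem_tnth.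
have -> : decode S i.+1 = Some (tnth S i).
  exact: (tnth_onth _ S i).1.
split.
- by move=> _; exists (tnth S i).
- by move=> e; rewrite e inE in hp.
- by move=> _ _; right; exists (tnth S i).
Qed.

(** If the outer radius reaches [d], every point is a valid answer, and a single node that always
    returns the first point suffices. *)
Lemma graph_all_within n d (S : n.-tuple (hcube d)) a : (0 < n)%N -> (0 < d)%N ->
  exists g, graph_shape n (d + 5) g /\ good_graph (encode_data S) n d a d (d + 5) g.
Proof.
move=> n0 d0; have nX : (d + 5 <= n * (d + 5))%N by rewrite leq_pmull.
have cl : closed_mod d (n * (d + 5)) (fun=> False) [:: Halt 1].
  move=> T; rewrite inE => /eqP ->; split.
    by split=> //=; clear -nX; lia.
  by move=> U [] ->; left; rewrite inE.
have [||g gs gP] := graph_of_strats (mem_head (Halt 1) [::]) cl.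
- by rewrite /=; clear -nX; lia.
- by clear -nX; lia.
exists g; split=> // u su bu; have [q ->] := encode_point_surj su bu.
rewrite (gP _ 1%N 0%N 0%N 0%N) //; apply/acceptableP; right; exists (Ordinal n0) => //.
exact: hamming_le.
Qed.

Lemma good_graph_exists (R : realType) (c : R) : 1 < c -> exists2 C : nat, (0 < C)%N &
  forall (r : R) n d, 0 < r -> (0 < n)%N -> (0 < d)%N ->
  forall S : n.-tuple (hcube d), exists X g, [/\ graph_shape n X g, (d <= X)%N,
    X%:R <= C%:R * d%:R * (up_log 2 (n * d).+2)%:R ^+ 7 * n%:R `^ c^-1
  & good_graph (encode_data S) n d (minn d (Num.truncn r)) (minn d (Num.truncn (c * r))) X g].
Proof.
move=> c1; have c0 : 0 < c by lra.
have rho01 : 0 <= c^-1 < 1 by rewrite invr_ge0 (ltW c0) /= invf_lt1.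
have r1 : 0 < 1 - c^-1 by case/andP: rho01 => _; rewrite subr_gt0.
pose K : nat := (Num.truncn (1 - c^-1)^-1).+1.
have hK : 1 <= K%:R * (1 - c^-1).
  by rewrite -ler_pdivrMr // mul1r ltW // truncnS_gt // num_real.
(* The 6 is for the trivial graph, where d + 5 is at most 6d. *)
exists (maxn 6 (Num.truncn (graph_const R K)).+1); first by rewrite leq_max.
set C := maxn _ _.
have C6 : 6 <= C%:R :> R by rewrite ler_nat leq_maxl.
have CG : graph_const R K <= C%:R.
  apply: (@le_trans _ _ (Num.truncn (graph_const R K)).+1%:R); last by rewrite ler_nat leq_maxr.
  by rewrite ltW // truncnS_gt // num_real.
move=> r n d r0 n0 d0 S; set l := up_log _ _.
have l1 : 1 <= l%:R :> R by rewrite ler1n up_log_gt0.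
have p1 : 1 <= n%:R `^ c^-1 :> R by apply: powR_nat_ge1 => //; case/andP: rho01.
have l7 : 1 <= l%:R ^+ 7 :> R by rewrite exprn_ege1.
have cr0 : 0 < c * r by rewrite mulr_gt0.
case: (leqP d (Num.truncn (c * r))) => hd.
  have [g [gs gd]] := graph_all_within S (minn d (Num.truncn r)) n0 d0.
  exists (d + 5)%N, g; split => //; first by rewrite leq_addr.
  apply: (@le_trans _ _ (6 * d%:R)).
    by rewrite -natrM ler_nat; clear -d0; lia.
  apply: (@le_trans _ _ (C%:R * d%:R)); first by rewrite ler_wpM2r.
  by rewrite -[leRHS]mulrA ler_peMr ?mulr_ge0 // mulr_ege1.
set b := (Num.truncn (c * r)).+1.
(* Adding 1 to the truncation of [c * r] is what preserves the ratio of the radii after rounding,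
   besides making [b] positive. *)
have hr : (Num.truncn r)%:R <= c^-1 * b%:R :> R.
  rewrite mulrC ler_pdivlMr //; apply: (@le_trans _ _ (r * c)).
    by rewrite ler_pM2r // -truncn_ge_nat // ltW.
  by rewrite mulrC ltW // truncnS_gt // num_real.
have rd : (Num.truncn r <= d)%N.
  apply: leq_trans (ltnW hd); apply: le_truncn; rewrite ler_peMl // ltW //.
have [X [g [gs dX Xle gP]]] :=
  @graph_exists R c^-1 K rho01 hK n d (Num.truncn r) b (tnth S) n0 d0 (ltn0Sn _) hd hr.
exists X, g; split => //.
  apply: le_trans Xle _; apply: ler_wpM2r; first exact: powR_ge0.
  by apply: ler_wpM2r; [exact: exprn_ge0 | exact: ler_wpM2r].
move=> u su bu; have [q ->] := encode_point_surj su bu.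
apply/acceptableP; have [[v0 h]|[p ep hp]] := gP q.
  by left; split=> // i; apply: leq_ltn_trans (h i); rewrite geq_minr.
by right; exists p => //; rewrite leq_min hamming_le.
Qed.

(** * Word size, final bounds and the theorem *)

Lemma uniform_prob_true (R : realType) (T : finType) (E : T -> Prop) :
  (0 < #|T|)%N -> (forall x, E x) -> uniform_prob R E = 1.
Proof.
move=> T0 h; rewrite /uniform_prob (eq_card (B := T)); last by move=> x; rewrite !inE; apply/asboolP.
by rewrite divff // pnatr_eq0 -lt0n.
Qed.

(** Since ln 2 is at least 1/2, both [l.-1] and 1 are at most 2 ln m. *)
Lemma up_log_le_ln (R : realType) m : (1 < m)%N -> (up_log 2 m)%:R <= 4 * ln m%:R :> R.
Proof.
move=> m1; have h := up_log_gtn (isT : 1 < 2)%N m1.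
set l := up_log 2 m in h *; have l0 : (0 < l)%N by rewrite up_log_gt0.
have ln2 : 2^-1 <= ln 2 :> R.
  rewrite -ler_expR lnK ?posrE //.
  by have := @expR_le_quadratic R 2^-1 (lexx _); rewrite expr2; lra.
have lnm : ln 2 <= ln m%:R :> R by rewrite ler_ln ?posrE ?ltr0n ?ler_nat // ltnW.
have hl : l.-1%:R * ln 2 <= ln m%:R :> R.
  rewrite mulr_natl -lnXn // ler_ln ?posrE ?exprn_gt0 ?ltr0n //; last by rewrite ltnW.
  by rewrite -natrX ler_nat ltnW.
have -> : l%:R = l.-1%:R + 1 :> R by rewrite natr1 prednK.
have : 0 <= l.-1%:R :> R by [].
by nra.
Qed.

(** Addresses must fit in a word, which determines the word factor: 2l bits for (nd)², 7l for l^7,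
    6C·l for the constant, and one more l for strictness. *)
Lemma memory_fits n d l C X : (0 < n)%N -> (0 < d)%N -> (0 < C)%N ->
  ((n * d).+2 <= 2 ^ l)%N -> (d <= X)%N -> (X <= C * d * l ^ 7 * n)%N ->
  (d.+1 + n * X * 4 < 2 ^ ((10 + 6 * C) * l))%N.
Proof.
move=> n0 d0 C0 hl dX hX.
apply: (@leq_ltn_trans (6 * (n * X))%N).
  by have := leq_pmull X n0; clear -dX d0; lia.
have h2 : (2 <= 2 ^ l)%N by apply: leq_trans hl.
have l0 : (0 < l)%N by case: (l) h2.
have -> : ((10 + 6 * C) * l = l + (l + l + l * 7 + l * (6 * C)))%N by ring.
rewrite expnD; apply: (@leq_ltn_trans (2 ^ (l + l + l * 7 + l * (6 * C)))); last first.
  by rewrite ltn_Pmull // expn_gt0.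
apply: (@leq_trans (n * d * (n * d) * l ^ 7 * (6 * C)))%N.
  have -> : (n * d * (n * d) * l ^ 7 * (6 * C) = 6 * (n * (C * d * l ^ 7 * n)) * d)%N by ring.
  by rewrite -[leqLHS]muln1; apply: leq_mul => //; rewrite leq_mul2l leq_mul2l hX !orbT.
rewrite !expnD; apply: leq_mul; last first.
  apply: (@leq_trans (2 ^ (6 * C))%N); first by rewrite ltnW // ltn_expl.
  by rewrite leq_exp2l // leq_pmull.
apply: leq_mul; last by rewrite expnM leq_exp2r // ltnW // ltn_expl.
by apply: leq_mul; apply: leq_trans hl; rewrite ltnW.
Qed.

Lemma transcript_answers (R : realType) (c r : R) (A : ann_algo) n d M m
    (S : n.-tuple (hcube d)) (om : coins A n d m) adv h q a :
  transcript c r M S om adv h -> (q, a) \in h -> exists t, answers c r M S om q t a.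
Proof.
elim: h => // -[q' a'] h ih [th _ ans]; rewrite inE => /orP[/eqP[-> ->]|] //.
exact: ih.
Qed.

Lemma answers_det (R : realType) (c r : R) (A : ann_algo) n d M m
    (S : n.-tuple (hcube d)) (om : coins A n d m) q t a t' a' :
  answers c r M S om q t a -> answers c r M S om q t' a' -> a = a'.
Proof.
move=> [mu [s [[tp [sp [ep <-]]] eq _ <-]]] [mu' [s' [[tp' [sp' [ep' <-]]] eq' _ <-]]].
have [_ esp] := exec_det ep ep'; rewrite -esp in eq'.
by have [_ ->] := exec_det eq eq'.
Qed.

(** 57 covers the 41X + 16 steps of a query as well as the memory per point; 4^7 is the change from
    [up_log] to [ln]. *)
Lemma softO_bound (R : realType) (rho : R) (C n d X : nat) : (0 < n)%N -> (0 < d)%N ->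
  X%:R <= C%:R * d%:R * (up_log 2 (n * d).+2)%:R ^+ 7 * n%:R `^ rho ->
  57 * X%:R <= softO (57 * C * 4 ^ 7) 7 n d (d%:R * n%:R `^ rho).
Proof.
move=> n0 d0 hX; rewrite /softO; set l := up_log _ _ in hX *.
have hl : l%:R <= 4 * ln (n * d).+2%:R :> R by apply: up_log_le_ln.
set lam := ln _ in hl *.
have h7 : l%:R ^+ 7 <= (4 * lam) ^+ 7.
  by apply: lerXn2r; rewrite ?nnegrE //; apply: le_trans hl.
have -> : (57 * C * 4 ^ 7)%:R = 57 * C%:R * 4 ^+ 7 :> R by rewrite -natrX -!natrM.
have -> : 57 * C%:R * 4 ^+ 7 * (d%:R * n%:R `^ rho) * lam ^+ 7 =
    57 * (C%:R * d%:R * (4 * lam) ^+ 7 * n%:R `^ rho) by rewrite exprMn; ring.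
rewrite ler_pM2l //; apply: le_trans hX _.
by apply: ler_wpM2r; [exact: powR_ge0 | apply: ler_wpM2l h7; rewrite mulr_ge0].
Qed.

Theorem theorem17 (R : realType) (c : R) (hc : 1 < c) :
  let rho := c^-1 in
  exists (A : ann_algo) (C e : nat) (eps : nat -> R),
    (eps k @[k --> \oo] --> (0 : R))%classic /\
    forall (r : R) (n d : nat), 0 < r -> (0 < n)%N -> (0 < d)%N ->
    exists M m : nat,
      M%:R <= softO C e n d (d%:R * powR n%:R (1 + rho + eps n)) /\
      forall S : n.-tuple (hcube d), uniq S ->
        [/\ (forall (om : coins A n d m) (q : hcube d),
               exists t a, answers c r M S om q t a /\
                 t%:R <= softO C e n d (d%:R * powR n%:R rho)),
            1 - (n%:R ^+ 2)^-1 <=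
              uniform_prob R (fun om : coins A n d m =>
                answers_all c r M S om)
          & forall adv : adversary d,
              1 - (n%:R ^+ 2)^-1 <=
                uniform_prob R (fun om : coins A n d m =>
                  withstands c r M S om adv)].
Proof.
move=> rho; have [C0 C00 hC0] := good_graph_exists hc.
exists (AnnAlgo prep_cmd query_cmd (9 + 6 * C0)), (57 * C0 * 4 ^ 7)%N, 7%N, (fun=> 0).
split; first exact: cvg_cst.
set A := AnnAlgo _ _ _; move=> r n d r0 n0 d0.
have rho0 : 0 <= rho by rewrite invr_ge0; lra.
have rho1 : rho <= 1 by rewrite ltW // invf_lt1 //; lra.
pose l := up_log 2 (n * d).+2.
pose bound : R := C0%:R * d%:R * l%:R ^+ 7 * n%:R `^ rho.
have bound0 : 0 <= bound.
  by rewrite !mulr_ge0 // ?exprn_ge0 ?powR_ge0.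
(* [M] is chosen before the dataset, so it is computed from the common bound and not from the size
   of a particular graph. *)
pose Xb := Num.truncn bound; pose M := (d.+1 + n * Xb * 4)%N.
have Xbound : Xb%:R <= bound by rewrite -truncn_ge_nat.
have Xmax (S : n.-tuple (hcube d)) : exists X g, [/\ graph_shape n X g, (d <= X <= Xb)%N &
    good_graph (encode_data S) n d (minn d (Num.truncn r)) (minn d (Num.truncn (c * r))) X g].
  have [X [g [h1 h2 h3 h4]]] := hC0 r n d r0 n0 d0 S.
  by exists X, g; split=> //; rewrite h2 /= truncn_ge_nat.
(* Any dataset shows this; the one made of zero points is taken. *)
have dXb : (d <= Xb)%N.
  have [X [g [_ /andP[h1 h2] _]]] := Xmax (nseq_tuple n (nseq_tuple d false : hcube d)).
  exact: leq_trans h2.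
have Xb1 : (0 < Xb)%N by apply: leq_trans dXb.
have ew : wsize A n d = ((10 + 6 * C0) * l)%N by [].
have hl : ((n * d).+2 <= 2 ^ l)%N by apply: up_logP.
have nR : 1 <= n%:R :> R by rewrite ler1n.
have Mw : (M < 2 ^ wsize A n d)%N.
  rewrite ew; apply: memory_fits => //.
  rewrite -(ler_nat R); apply: le_trans Xbound _.
  have -> : (C0 * d * l ^ 7 * n)%:R = C0%:R * d%:R * l%:R ^+ 7 * n%:R :> R.
    by rewrite -natrX -!natrM.
  apply: ler_wpM2l; first by rewrite !mulr_ge0 // exprn_ge0.
  by have := ler_powR nR rho1; rewrite powRr1.
have l_w : (l <= wsize A n d)%N by rewrite ew leq_pmull.
have w4 : (4 < 2 ^ wsize A n d)%N.
  have l0 : (0 < l)%N by rewrite up_log_gt0.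
  have h10 : (3 <= wsize A n d)%N.
    by rewrite ew (leq_trans _ (leq_pmulr _ l0)).
  by apply: (@leq_trans (2 ^ 3)) => //; rewrite leq_exp2l.
have ndw : (n * d < 2 ^ wsize A n d)%N.
  by apply: leq_trans (_ : 2 ^ l <= _)%N; [apply: leq_trans hl | rewrite leq_exp2l].
have h57 : 57 * Xb%:R <= softO (57 * C0 * 4 ^ 7) 7 n d (d%:R * n%:R `^ rho).
  exact: softO_bound.
exists M, 0%N; split.
  have -> : softO (57 * C0 * 4 ^ 7) 7 n d (d%:R * n%:R `^ (1 + rho + 0)) =
      n%:R * softO (57 * C0 * 4 ^ 7) 7 n d (d%:R * n%:R `^ rho).
    rewrite addr0 powRD ?powRr1 /softO //; last by rewrite gt_eqF //; lra.
    by ring.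
  apply: (@le_trans _ _ (n%:R * (57 * Xb%:R))); last by rewrite ler_wpM2l.
  rewrite -!natrM ler_nat /M; have := leq_pmull Xb n0; clear -dXb d0; lia.
move=> S _.
have key (om : coins A n d 0) : exists2 mu, prepares c r M S om mu &
    forall q : hcube d, exists t s, [/\ exec (wsize A n d) M (encode_point q) query_cmd
      (State (init_regs c r n d) mu [::]) t s, mem s = mu, (t <= 57 * Xb)%N
      & ann_correct c r S q (decode S (regs s 0%N))].
  have [Xs [gs [shs /andP[dXs XsXb] gds]]] := Xmax S.
  have hM : (d.+1 + n * Xs * 4 <= M)%N by rewrite leq_add2l leq_mul2r leq_mul2l XsXb !orbT.
  have Xs0 : (0 < Xs)%N by apply: leq_trans dXs.
  have [t [s [ex [X [g [emem /andP[X0 XXs] sh gd]]]]]] :=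
    @prep_spec (wsize A n d) M (encode_data S) [seq val v | v <- om] n d
      (minn d (Num.truncn r)) (minn d (Num.truncn (c * r))) Xs w4 n0 d0
      (size_encode_data S) ndw hM Mw gs Xs0 shs gds (init_regs c r n d)
      erefl erefl erefl erefl erefl.
  exists (upd (layout d (nseq d 0%N) g) 0%N X); first by exists t, s.
  move=> q; have hM2 : (d.+1 + n * X * 4 <= M)%N.
    by apply: leq_trans hM; rewrite leq_add2l leq_mul2r leq_mul2l XXs !orbT.
  have [t' [s' [ex' [ht' em' er]]]] := @query_spec (wsize A n d) M (encode_point q) [::]
    n d X g (init_regs c r n d) w4 n0 d0 X0 (size_encode_point q) hM2 Mw sh erefl erefl.
  exists t', s'; split=> //.
    by apply: leq_trans ht' _; have := leq_trans XXs XsXb; clear -Xb1; lia.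
  rewrite er; apply: acceptable_correct; first exact: ltW.
    by rewrite mulr_ge0 ?ltW //; lra.
  apply: gd; rewrite ?size_encode_point //.
  by apply/allP => v /mapP[b _ ->]; case: b.
have om0 : (0 < #|coins A n d 0|)%N by rewrite card_tuple expn0.
have all_ok (om : coins A n d 0) : answers_all c r M S om.
  move=> q; have [mu pr /(_ q)[t [s [ex em ht ok]]]] := key om.
  by exists t, (decode S (regs s 0%N)); split=> //; exists mu, s.
have le1 : 1 - (n%:R ^+ 2)^-1 <= 1 :> R by rewrite gerBl invr_ge0 exprn_ge0.
split.
- move=> om q; have [mu pr /(_ q)[t [s [ex em ht ok]]]] := key om.
  exists t, (decode S (regs s 0%N)); split; first by exists mu, s.
  by apply: le_trans h57; rewrite -natrM ler_nat.
- by rewrite uniform_prob_true.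
(* Each recorded answer is an answer of the program to that query, and by determinism it is the
   correct one, however the query was chosen. *)
move=> adv; rewrite uniform_prob_true // => om h th q a qah.
have [t ans] := transcript_answers th qah.
have [t' [a' [ans' ok]]] := all_ok om q.
by rewrite (answers_det ans ans').
Qed.
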